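(* Let $d\ge 1$, $a>0$, $R>0$, and let $h\in (L^1\cap L^2)(\mathbb{R}^d)$ be real-valued. Then $$\mathrm{Var}\big(N_{s}(h,R)\big)=R^d\int_{\mathbb{R}^d}|\widehat h(\lambda)|^2\Big(1-e^{-2a\pi^2|\lambda|^2/R^2}\Big)\,dm_d(\lambda)+R^{2d}\sum_{m\in\mathbb{Z}^d\setminus\{0\}}e^{-2a\pi^2|m|^2}\,|\widehat h(Rm)|^2 .$$
   Context: $m_d$ is Lebesgue measure on $\mathbb{R}^d$, and $|\cdot|$, $\langle\cdot,\cdot\rangle$ are the Euclidean norm and inner product. For a fixed $a>0$, $\{\xi_n\}_{n\in\mathbb{Z}^d}$ are independent identically distributed random vectors in $\mathbb{R}^d$ with density $\phi_a(x)=(a\pi)^{-d/2}e^{-|x|^2/a}$ with respect to $m_d$, and $\zeta$ is a random vector uniformly distributed on $[0,1]^d$ and independent of all the $\xi_n$. The stationarized point process is $W_{s}=\{n+\xi_n+\zeta: n\in\mathbb{Z}^d\}$, and its linear statistic is $N_{s}(h,R)=\sum_{w\in W_s}h(w/R)=\sum_{n\in\mathbb{Z}^d}h\big((n+\xi_n+\zeta)/R\big)$. The variance is $\mathrm{Var}(X)=\mathbb{E}[(X-\mathbb{E}X)^2]$. The Fourier transform is $\widehat f(\lambda)=\int_{\mathbb{R}^d}f(x)e^{-2\pi i\langle x,\lambda\rangle}\,dm_d(x)$. *)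

(* Defs.v *)
From HB Require Import structures.
From mathcomp Require Import all_boot all_order all_algebra finmap.
From mathcomp Require Import all_classical all_reals all_analysis.
From mathcomp.real_closed Require Import complex.

Set Implicit Arguments.
Unset Strict Implicit.
Unset Printing Implicit Defensive.
Import Order.TTheory GRing.Theory Num.Theory.
Import numFieldNormedType.Exports.

Local Open Scope classical_set_scope.
Local Open Scope ring_scope.
Local Open Scope complex_scope.

(* R^d is d.-tuple R with the library's product (= Borel) sigma-algebra; *)
(* Z^d is d.-tuple int.                                                  *)

Section euclidean.
Context {R : realType} {d : nat}.
Implicit Types x y : d.-tuple R.

Definition tadd x y : d.-tuple R := [tuple tnth x i + tnth y i | i < d].
Definition tscale (c : R) x : d.-tuple R := [tuple c * tnth x i | i < d].
Definition tdot x y : R := \sum_(i < d) tnth x i * tnth y i.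
Definition tnorm x : R := Num.sqrt (tdot x x).
Definition tint (n : d.-tuple int) : d.-tuple R :=
  [tuple (tnth n i)%:~R | i < d].
Definition tcube : set (d.-tuple R) :=
  [set x | forall i, 0 <= tnth x i <= 1].

End euclidean.

Section lebesgue_tuple.
Context {R : realType}.

(* lebesgue_measure lives on the alias measurableTypeR R of R. *)
Definition tcons {d} (p : measurableTypeR R * d.-tuple R) : d.+1.-tuple R :=
  [tuple of (p.1 : R) :: p.2].

Lemma measurable_tcons d : measurable_fun setT (@tcons d).
Proof.
exact: (@measurable_cons _ _ _ R (fun p : measurableTypeR R * d.-tuple R =>
  p.1 : R) d (fun p => p.2) measurable_fst measurable_snd).
Qed.

Section tcons_measure.
Context {d : nat} (m : {sigma_finite_measure set (d.-tuple R) -> \bar R}).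

Definition tcons_measure : set (d.+1.-tuple R) -> \bar R :=
  pushforward (@lebesgue_measure R \x m)%E tcons.

Let mtcons (A : set (d.+1.-tuple R)) : measurable A ->
  measurable (@tcons d @^-1` A).
Proof.
by move=> mA; rewrite -[X in measurable X]setTI; exact: measurable_tcons.
Qed.

Let tcons_measure0 : tcons_measure set0 = 0%E.
Proof. by rewrite /tcons_measure /pushforward preimage_set0 measure0. Qed.

Let tcons_measure_ge0 A : (0 <= tcons_measure A)%E.
Proof. exact: (measure_ge0 (@lebesgue_measure R \x m)%E). Qed.

Let tcons_measure_sigma_additive : semi_sigma_additive tcons_measure.
Proof.
move=> F mF tF mUF; rewrite /tcons_measure /pushforward preimage_bigcup.
apply: measure_semi_sigma_additive.
- by move=> n; exact: mtcons.
- apply/trivIsetP => /= i j _ _ ij; rewrite -preimage_setI.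
  by move/trivIsetP : tF => /(_ _ _ _ _ ij) ->//; rewrite preimage_set0.
- by rewrite -preimage_bigcup; exact: mtcons.
Qed.

HB.instance Definition _ := isMeasure.Build _ _ _ tcons_measure
  tcons_measure0 tcons_measure_ge0 tcons_measure_sigma_additive.

Let tcons_measure_sigma_finite : sigma_finite setT tcons_measure.
Proof.
have /sigma_finiteP[F [TF ndF Foo]] := sigma_finiteT (@lebesgue_measure R).
have /sigma_finiteP[G [TG ndG Goo]] := sigma_finiteT m.
pose g (x : d.+1.-tuple R) : measurableTypeR R * d.-tuple R :=
  (thead x, [tuple of behead x]).
have gK : cancel tcons g.
  by move=> [u v]; rewrite /g theadE; congr pair; exact: val_inj.
have mg : measurable_fun setT g.
  apply/measurable_fun_pair => /=; last exact: measurable_behead.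
  exact: (@measurable_tnth _ R d.+1 ord0).
exists (fun k => g @^-1` (F k `*` G k)) => [|k].
  apply/seteqP; split=> // x _.
  have [n _ Fn] : (\bigcup_k F k) (g x).1 by rewrite -TF.
  have [k _ Gk] : (\bigcup_k G k) (g x).2 by rewrite -TG.
  exists (maxn n k) => //; split.
  - by move: Fn; exact/subsetPset/ndF/leq_maxl.
  - by move: Gk; exact/subsetPset/ndG/leq_maxr.
have [mF Fk] := Foo k; have [mG Gk] := Goo k; split.
  rewrite -[X in measurable X]setTI; apply: mg => //.
  exact: measurableX.
rewrite /tcons_measure /pushforward [X in (_ \x _)%E X](_ : _ = F k `*` G k).
  by rewrite product_measure1E// lte_mul_pinfty// ge0_fin_numE.
by apply/funext => z; exact: (congr1 (F k `*` G k) (gK z)).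
Qed.

HB.instance Definition _ := Measure_isSigmaFinite.Build _ _ _ tcons_measure
  tcons_measure_sigma_finite.

End tcons_measure.

(* Lebesgue measure on R^d, as the d-fold product of Lebesgue measure on R *)
Fixpoint lebesgue_tuple d : {sigma_finite_measure set (d.-tuple R) -> \bar R} :=
  match d with
  | 0 => \d_[tuple]
  | d'.+1 => tcons_measure (lebesgue_tuple d')
  end.

End lebesgue_tuple.

Section fourier.
Context {R : realType} {d : nat}.

Definition expi (t : R) : R[i] := cos t +i* sin t.

Definition complex_integral (f : d.-tuple R -> R[i]) : R[i] :=
  (\int[lebesgue_tuple d]_x complex.Re (f x)) +i*
  (\int[lebesgue_tuple d]_x complex.Im (f x)).

Definition fourier (f : d.-tuple R -> R[i]) (l : d.-tuple R) : R[i] :=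
  complex_integral (fun x => f x * expi (- (2 * pi * tdot x l))).

End fourier.

Section probability_notions.
Context {d d'} {T : measurableType d} {T' : measurableType d'} {R : realType}.
Variable P : probability T R.

Definition has_density (mu : {measure set T' -> \bar R}) (X : {RV P >-> T'})
    (phi : T' -> R) : Prop :=
  forall A : set T', measurable A ->
    distribution P X A = (\int[mu]_(x in A) (phi x)%:E)%E.

Definition uniform_on (mu : {measure set T' -> \bar R}) (X : {RV P >-> T'})
    (B : set T') : Prop :=
  forall A : set T', measurable A ->
    distribution P X A = (((fine (mu B))^-1)%:E * mu (A `&` B))%E.

Definition mutually_independent (I : choiceType) (X : I -> {RV P >-> T'}) :
    Prop :=
  forall (J : {fset I}) (A : I -> set T'), (forall i, measurable (A i)) ->
    P (\bigcap_(i in [set` J]) (X i @^-1` A i)) =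
    (\prod_(i <- J) P (X i @^-1` A i))%E.

End probability_notions.

(* Unconditional real sum over a countable index type; when f is not     *)
(* absolutely summable the value is junk (for the linear statistic below *)
(* of an integrable h this happens on a null event only).                *)
Definition rsum {R : realType} {I : choiceType} (f : I -> R) : R :=
  fine (\esum_(i in setT) (EFin \o f)^\+ i -
        \esum_(i in setT) (EFin \o f)^\- i)%E.

Section perturbed_lattice.
Context {R : realType} {d : nat}.

Definition gauss_density (a : R) (x : d.-tuple R) : R :=
  (a * pi) `^ (- (d%:R / 2)) * expR (- (tnorm x ^+ 2 / a)).

Context {T : Type} (xi : d.-tuple int -> T -> d.-tuple R)
  (zeta : T -> d.-tuple R).

Definition stationarized_point (n : d.-tuple int) (w : T) : d.-tuple R :=
  tadd (tadd (tint n) (xi n w)) (zeta w).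

Definition linear_statistic (h : d.-tuple R -> R) (r : R) (w : T) : R :=
  rsum (fun n => h (tscale r^-1 (stationarized_point n w))).

End perturbed_lattice.

(* Main.v *)
(** For [f, g >= 0] put [A f = sum_n f (n + xi_n + zeta)]. Averaging over [zeta] unfolds the sum over
the unit cube into an integral over R^d, and the convolution of two Gaussian densities of parameter
[a] is the one of parameter [2a]; hence, the diagonal terms being treated separately,
  E [A f * A g] = int f g + int int f x * g y * (theta (x - y) - phi (x - y)) dx dy,
where [phi] is the Gaussian density of parameter [2a] and [theta] its Z^d-periodization. For
[H x = h (x / r)] this gives
  Var N = int H^2 - Q phi + Q theta - (int H)^2,  Q K = int int H x * H y * K (x - y) dx dy.
By Plancherel's theorem, [int H^2 - Q phi] is the integral of [|H^|^2] against one minus the Fourier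
transform of [phi]; by Poisson summation, [Q theta] is the sum over Z^d of [|H^|^2] against that
transform, and its term at [0] is [(int H)^2]. Scaling by [r] gives the two terms of the formula. *)

Require Import Defs.
From HB Require Import structures.
From mathcomp Require Import all_boot all_order all_algebra.
From mathcomp Require Import all_classical all_reals all_analysis.
From mathcomp.real_closed Require Import complex.
From mathcomp Require Import measurable_realfun ring lra.

Set Implicit Arguments.
Unset Strict Implicit.
Unset Printing Implicit Defensive.
Import Order.TTheory GRing.Theory Num.Theory.
Import numFieldNormedType.Exports.

Local Open Scope classical_set_scope.
Local Open Scope ring_scope.

(** * Gaussian integrals on the line *)

(** For [h] merely in L^1 and L^2, the transform need be neither integrable nor summable over the
    lattice, so every exchange of sums and integrals is made on nonnegative functions by Tonelli's
    theorem. Fourier identities are kept nonnegative by writing them for [1 + cos (c + x)] with a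
    free phase [c]: the phase [pi / 2] isolates total masses, [pi] yields upper bounds, and a phase
    chosen pointwise absorbs the sign of [H x * H y]. Plancherel's identity comes from Gaussian
    kernels of shrinking width. Their convergence rests on the continuity of translations, proved in
    a Gaussian-weighted mean by a sigma-algebra argument starting from coordinate rays. Poisson
    summation is the pointwise convergence of the Fourier series of a Lipschitz function, the
    periodized Gaussian, through the Dirichlet kernel and Bessel's inequality. Lattice sums of
    nonnegative functions take values in [[0, +oo]] and are finite only almost surely; diagonal
    terms are therefore added to both sides of the second moment identity before anything is
    subtracted, and the sign of [H] enters last, through its positive and negative parts. *)

Section line.
Context {R : realType}.
Notation mu := (@lebesgue_measure R).

Lemma measurable_affine (c b : R) : measurable_fun [set: R] (fun x => c * x + b).
Proof. by apply: measurable_funD => //; apply: measurable_funM. Qed.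

Let affine_preimage (c b x y : R) : 0 < c ->
  (fun t : R => c * t + b) @^-1` [set` `]x, y]] = [set` `](x - b) / c, (y - b) / c]].
Proof.
move=> c0; apply/seteqP; split => t /=; rewrite !in_itv/=.
  by rewrite ltr_pdivrMr// ler_pdivlMr// mulrC ltrBlDr lerBrDr.
by rewrite ltr_pdivrMr// ler_pdivlMr// mulrC ltrBlDr lerBrDr.
Qed.

(** By uniqueness of Lebesgue measure, compared on half-open intervals, [mu] equals [c] times its
    image under [x -> c x + b]. *)
Lemma ge0_integral_affine (c b : R) (f : R -> \bar R) : 0 < c ->
  measurable_fun setT f -> (forall x, 0 <= f x)%E ->
  (\int[mu]_x f (c * x + b)%R = c^-1%:E * \int[mu]_x f x)%E.
Proof.
move=> c0 mf f0.
have ci0 : 0 <= c by exact: ltW.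
pose phi (x : measurableTypeR R) : measurableTypeR R := c * x + b.
have mphi : measurable_fun setT phi by exact: measurable_affine.
pose pm' : {measure set (measurableTypeR R) -> \bar R} := pushforward mu phi.
pose nu := mscale (NngNum ci0) (pm' mphi).
have E : forall A, measurable A -> mu A = nu A.
  apply: lebesgue_measure_unique => X /ocitvP[->|[[x y] /= xy ->]].
    by rewrite !measure0.
  rewrite /nu /mscale /pm' /= /pushforward affine_preimage// !lebesgue_measure_itv/= !lte_fin.
  rewrite xy ltr_pM2r ?invr_gt0// ltrD2r xy -!EFinB -EFinM; congr EFin.
  by field; rewrite gt_eqF.
have -> : (\int[mu]_x f x = \int[nu]_x f x)%E.
  by apply: eq_measure_integral => A mA _; exact: E.
rewrite ge0_integral_mscale//= muleA -EFinM mulVf ?gt_eqF// mul1e.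
by rewrite ge0_integral_pushforward//.
Qed.

Lemma ge0_integral_oppr (f : R -> \bar R) :
  measurable_fun setT f -> (forall x, 0 <= f x)%E ->
  (\int[mu]_x f (- x)%R = \int[mu]_x f x)%E.
Proof.
move=> mf f0.
pose phi (x : measurableTypeR R) : measurableTypeR R := - x.
have mphi : measurable_fun setT phi by exact: oppr_measurable.
pose pm' : {measure set (measurableTypeR R) -> \bar R} := pushforward mu phi.
have E : forall A, measurable A -> mu A = pm' mphi A.
  apply: lebesgue_measure_unique => X /ocitvP[->|[[x y] /= xy ->]].
    by rewrite !measure0.
  rewrite /pm' /= /pushforward.
  rewrite (_ : phi @^-1` _ = [set` `[- y, - x[]); last first.
    by apply/seteqP; split => t /=; rewrite !in_itv/= /phi lerNl ltrNr andbC.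
  by rewrite !lebesgue_measure_itv/= !lte_fin ltrN2 xy -!EFinB opprK addrC.
have -> : (\int[mu]_x f x = \int[pm' mphi]_x f x)%E.
  by apply: eq_measure_integral => A mA _; exact: E.
by rewrite ge0_integral_pushforward//.
Qed.

(** The one-dimensional factor of [gauss_density]: the centered normal density of variance [a / 2],
    so that convolution adds the parameters. *)
Definition gauss1 (a x : R) : R := (Num.sqrt (a * pi))^-1 * expR (- (x ^+ 2 / a)).

Lemma gauss1_ge0 a x : 0 <= gauss1 a x.
Proof. by rewrite mulr_ge0 ?invr_ge0 ?sqrtr_ge0 ?expR_ge0. Qed.

Lemma gauss1N a x : gauss1 a (- x) = gauss1 a x.
Proof. by rewrite /gauss1 sqrrN. Qed.

Lemma measurable_gauss1 a : measurable_fun [set: R] (gauss1 a).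
Proof.
apply: measurable_funM => //; apply: measurableT_comp => //.
apply: measurableT_comp => //; exact: measurable_funM.
Qed.

Lemma integral_gauss1 (a y : R) : 0 < a ->
  (\int[mu]_x (gauss1 a (x - y))%:E = 1)%E.
Proof.
move=> a0; have sa0 : 0 < Num.sqrt a by rewrite sqrtr_gt0.
have sp0 : 0 < Num.sqrt (pi : R) by rewrite sqrtr_gt0 pi_gt0.
have saE : Num.sqrt a ^+ 2 = a by rewrite sqr_sqrtr// ltW.
under eq_integral => x _.
  rewrite (_ : gauss1 a (x - y) =
    (Num.sqrt (a * pi))^-1 * gauss_fun ((Num.sqrt a)^-1 * x + - y / Num.sqrt a)).
    rewrite EFinM; over.
  rewrite /gauss1 /gauss_fun; congr (_ * expR (- _)).
  by rewrite -{1}saE; field; rewrite gt_eqF// saE.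
rewrite ge0_integralZl//=; last 2 first.
- apply/measurable_EFinP; apply: (measurableT_comp measurable_gauss_fun).
  exact: measurable_affine.
- by move=> x _; rewrite lee_fin gauss_fun_ge0.
rewrite (@ge0_integral_affine _ _ (fun x => (gauss_fun x)%:E)) ?invr_gt0//; last 2 first.
- apply/measurable_EFinP; exact: measurable_gauss_fun.
- by move=> x; rewrite lee_fin gauss_fun_ge0.
rewrite integralT_gauss invrK -!EFinM; congr EFin.
rewrite sqrtrM ?ltW//; field.
by rewrite !gt_eqF.
Qed.

(** Completing the square in [t]: the second factor is a Gaussian density in [t] centered at the
    midpoint of [x] and [y], so integrating over [t] leaves only the first. *)
Lemma gauss1_mul (a x y t : R) : 0 < a ->
  gauss1 a (x - t) * gauss1 a (y - t) = gauss1 (2 * a) (x - y) * gauss1 (a / 2) (t - (x + y) / 2).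
Proof.
move=> a0; rewrite /gauss1.
have [p0 ap0] : 0 < pi :> R /\ 0 < a * pi by rewrite mulr_gt0 ?pi_gt0.
rewrite mulrACA -expRD [RHS]mulrACA -expRD -!invfM -!sqrtrM ?(ltW ap0)//; last first.
  by rewrite -mulrA mulr_ge0// ltW.
congr ((Num.sqrt _)^-1 * expR _).
  by field.
by field; rewrite gt_eqF.
Qed.

Lemma integral_gauss1_conv (a x y : R) : 0 < a ->
  (\int[mu]_t (gauss1 a (x - t) * gauss1 a (y - t))%:E = (gauss1 (2 * a) (x - y))%:E)%E.
Proof.
move=> a0; under eq_integral do rewrite gauss1_mul// EFinM.
rewrite ge0_integralZl//=; last 3 first.
- apply/measurable_EFinP; apply: (measurableT_comp (measurable_gauss1 _)).
  exact: measurable_funB.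
- by move=> t _; rewrite lee_fin gauss1_ge0.
- by rewrite lee_fin gauss1_ge0.
by rewrite integral_gauss1 ?mule1// divr_gt0.
Qed.

End line.

Section real_integrable.
Context {R : realType} d (T : measurableType d) (m : {measure set T -> \bar R}).
Variables (D : set T) (mD : measurable D).
Implicit Types f g : T -> R.

Lemma integrable_funD f g : m.-integrable D (EFin \o f) -> m.-integrable D (EFin \o g) ->
  m.-integrable D (EFin \o (fun x => f x + g x)).
Proof. by move=> fi gi; exact: (integrableD mD fi gi). Qed.

Lemma integrable_funB f g : m.-integrable D (EFin \o f) -> m.-integrable D (EFin \o g) ->
  m.-integrable D (EFin \o (fun x => f x - g x)).
Proof. by move=> fi gi; exact: (integrableB mD fi gi). Qed.

Lemma integrable_funZ (k : R) f : m.-integrable D (EFin \o f) ->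
  m.-integrable D (EFin \o (fun x => k * f x)).
Proof. by move=> fi; exact: (@integrableZl _ _ _ m _ mD k _ fi). Qed.

Lemma EFin_Rintegral f : m.-integrable D (EFin \o f) ->
  (\int[m]_(x in D) (f x)%:E = (\int[m]_(x in D) f x)%R%:E)%E.
Proof. by move=> fi; rewrite /Rintegral fineK//; exact: integrable_fin_num. Qed.

End real_integrable.

(** * Cosine transform of the Gaussian *)

Section gaussian_fourier.
Context {R : realType}.
Notation mu := (@lebesgue_measure R).

Lemma integrable_le_bounded d (T : measurableType d) (m : {measure set T -> \bar R})
    (D : set T) (f g : T -> R) (k : R) : measurable D ->
  measurable_fun D f -> m.-integrable D (EFin \o g) ->
  (forall x : T, D x -> `|f x| <= k * `|g x|) -> m.-integrable D (EFin \o f).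
Proof.
move=> mD mf ig fg.
apply: (@le_integrable _ _ _ m D mD _ (fun x => (k%:E * (EFin \o g) x)%E)) => //.
- exact/measurable_EFinP.
- move=> x Dx /=; rewrite lee_fin normrM; apply: le_trans (fg x Dx) _.
  by rewrite ler_wpM2r// ler_norm.
- exact: integrableZl.
Qed.

Let gD (x : R) : is_derive x 1 gauss_fun (- (2 * x) * gauss_fun x).
Proof.
apply: is_derive_eq; rewrite /GRing.scale/= /gauss_fun /=.
by ring.
Qed.

Let cD (v x : R) : is_derive v 1 (fun v => cos (2 * v * x)) (- (2 * x) * sin (2 * v * x)).
Proof. apply: is_derive_eq; rewrite /GRing.scale/=. by ring. Qed.

Let sD (v x : R) : is_derive x 1 (fun x => sin (2 * v * x)) (2 * v * cos (2 * v * x)).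
Proof. apply: is_derive_eq; rewrite /GRing.scale/=. by ring. Qed.

Lemma measurable_cosM v : measurable_fun [set: R] (fun x => cos (v * x)).
Proof. by apply: continuous_measurable_fun => x; apply: continuous_comp; [exact: mulrl_continuous|exact: continuous_cos]. Qed.

Lemma measurable_sinM v : measurable_fun [set: R] (fun x => sin (v * x)).
Proof. by apply: continuous_measurable_fun => x; apply: continuous_comp; [exact: mulrl_continuous|exact: continuous_sin]. Qed.

Let i0 v : mu.-integrable setT (EFin \o (fun x => gauss_fun x * cos (2 * v * x))).
Proof.
apply: (@integrable_le_bounded _ _ mu _ _ gauss_fun 1) => //.
- apply: measurable_funM; [exact: measurable_gauss_fun|exact: measurable_cosM].
- exact: integrableT_gauss.
- by move=> x _; rewrite mul1r normrM ler_piMr// ler_norml cos_geN1 cos_le1.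
Qed.

Let gauss2 (x : R) := gauss1 2 x.

(** The dominating function for differentiation under the integral sign. Since
    [|x| <= 1 + x^2 / 2 <= exp (x^2 / 2)], the factor [|x|] costs half of the exponent, which leaves
    a multiple of [gauss2]. *)
Let iG : mu.-integrable setT (EFin \o (fun x => 2 * `|x| * gauss_fun x)).
Proof.
apply: (@integrable_le_bounded _ _ mu _ _ gauss2 (2 * Num.sqrt (2 * pi))) => //.
- apply: measurable_funM; last exact: measurable_gauss_fun.
  by apply: measurable_funM => //; exact: measurableT_comp.
- apply/integrableP; split; first by apply/measurable_EFinP; exact: measurable_gauss1.
  under eq_integral do rewrite /= ger0_norm ?gauss1_ge0// -[X in gauss2 X]subr0.
  by rewrite integral_gauss1// ltry.
- move=> x _; rewrite (ger0_norm (gauss1_ge0 _ _)) ger0_norm; last first.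
    by rewrite mulr_ge0 ?gauss_fun_ge0// mulr_ge0.
  rewrite /gauss2 /gauss1 -!mulrA ler_pM2l// !mulrA mulfV ?mul1r; last first.
    by rewrite gt_eqF// sqrtr_gt0 mulr_gt0// pi_gt0.
  rewrite /gauss_fun (_ : - (x ^+ 2 / 2) = x ^+ 2 / 2 + - x ^+ 2); last by field.
  rewrite expRD ler_pM2r ?expR_gt0//; apply: le_trans (expR_ge1Dx _).
  rewrite -(real_normK (num_real x)); set y := `|x|.
  by have := sqr_ge0 (y - 1); rewrite sqrrB; lra.
Qed.

Let i1 v : mu.-integrable setT (EFin \o (fun x => gauss_fun x * (- (2 * x) * sin (2 * v * x)))).
Proof.
apply: (@integrable_le_bounded _ _ mu _ _ (fun x => 2 * `|x| * gauss_fun x) 1) => //.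
- apply: measurable_funM; first exact: measurable_gauss_fun.
  apply: measurable_funM; last exact: measurable_sinM.
  by apply: measurableT_comp => //; exact: measurable_funM.
- move=> x _; rewrite mul1r [leRHS]ger0_norm; last by rewrite mulr_ge0 ?gauss_fun_ge0// mulr_ge0.
  rewrite !normrM (ger0_norm (gauss_fun_ge0 _)) mulrC ler_wpM2r ?gauss_fun_ge0//.
  by rewrite normrN normrM ger0_norm// ler_piMr ?mulr_ge0// ler_norml sin_geN1 sin_le1.
Qed.

(** The transform is found from its differential equation [F' = - 2 v F]: [F1] differentiates under
    the integral sign, [FE] integrates by parts, and [F v * exp (v^2)] is then constant. *)
Let F v : R := \int[mu]_x (gauss_fun x * cos (2 * v * x)).

Let F1 (v : R) : is_derive v 1 F (\int[mu]_x (gauss_fun x * (- (2 * x) * sin (2 * v * x)))).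
Proof.
pose f v x : R := gauss_fun x * cos (2 * v * x).
have df (w x : R) : is_derive w 1 (f^~ x) (gauss_fun x * (- (2 * x) * sin (2 * w * x))).
  rewrite /f; apply: is_derive_eq; rewrite /GRing.scale /=; ring.
have pf (w x : R) : partial1of2 f w x = gauss_fun x * (- (2 * x) * sin (2 * w * x)).
  by rewrite partial1of2E derive_val.
have vI : `]v - 1, v + 1[%classic v by rewrite /= in_itv/=; lra.
have H1 := @derivable_under_integral R _ _ mu f setT measurableT v (v - 1) (v + 1) vI
  (fun w _ => i0 w) (fun w x _ _ => @ex_derive _ _ _ _ _ _ _ (df w x)) (fun x => 2 * `|x| * gauss_fun x).
have H2 := @differentiation_under_integral R _ _ mu f setT measurableT v (v - 1) (v + 1) vI
  (fun w _ => i0 w) (fun w x _ _ => @ex_derive _ _ _ _ _ _ _ (df w x)) (fun x => 2 * `|x| * gauss_fun x).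
have g0 (x : R) : 0 <= 2 * `|x| * gauss_fun x by rewrite mulr_ge0 ?gauss_fun_ge0// mulr_ge0.
have gub w y : `]v - 1, v + 1[%classic w -> setT y -> `|partial1of2 f w y| <= 2 * `|y| * gauss_fun y.
  move=> _ _; rewrite pf !normrM (ger0_norm (gauss_fun_ge0 _)) mulrC ler_wpM2r ?gauss_fun_ge0//.
  by rewrite normrN normrM ger0_norm// ler_piMr ?mulr_ge0// ler_norml sin_geN1 sin_le1.
apply: DeriveDef.
  exact: (H1 g0 iG gub).
rewrite -derive1E (H2 g0 iG gub).
by apply: eq_Rintegral => x _; exact: pf.
Qed.

(** The boundary term of the integration by parts: [h v] tends to [0] at both ends of the line, so
    its derivative [h' v] has integral zero. *)
Let h (v x : R) := gauss_fun x * sin (2 * v * x).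
Let h' (v x : R) := gauss_fun x * (- (2 * x) * sin (2 * v * x)) + (2 * v) * (gauss_fun x * cos (2 * v * x)).

Let hD (v x : R) : is_derive x 1 (h v) (h' v x).
Proof. rewrite /h /h'; apply: is_derive_eq; rewrite /GRing.scale /= /gauss_fun.
ring. Qed.

Let ih v : mu.-integrable setT (EFin \o h' v).
Proof.
rewrite (_ : EFin \o h' v =  (fun x => (gauss_fun x * (- (2 * x) * sin (2 * v * x)))%:E +
  (2 * v)%:E * (gauss_fun x * cos (2 * v * x))%:E)%E) //.
apply: integrableD => //; first exact: i1.
apply: integrableZl => //; exact: i0.
Qed.

Let ch' v : continuous (h' v).
Proof.
move=> x; apply: differentiable_continuous; apply/derivable1_diffP.
have : derivable (h' v) x 1 by rewrite /h'; apply: ex_derive.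
by [].
Qed.

Lemma cvg_integral_symitv (f : R -> R) : mu.-integrable setT (EFin \o f) ->
  (\int[mu]_(x in `[(- n%:R : R)%R, n%:R]) (f x)%:E)%E @[n --> \oo] --> (\int[mu]_x (f x)%:E)%E.
Proof.
move=> intf.
under eq_fun do rewrite integral_mkcond.
have mf := measurable_int mu intf.
apply: (@dominated_cvg _ _ _ mu setT measurableT _ _ (abse \o (EFin \o f))) => //=.
- move=> n; apply/(measurable_restrict _ _ _) => //.
  by rewrite setTI; exact: measurable_funTS.
- move=> x _; apply: cvg_near_cst; near=> n.
  rewrite patchE mem_set//= in_itv/= -ler_norml.
  by near: n; exact: nbhs_infty_ger.
- exact: integrable_abse.
- move=> n x _; rewrite patchE; case: ifPn => //= _.
  by rewrite normr0 lee_fin.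
Unshelve. all: by end_near. Qed.

Let int_h' v : \int[mu]_x (h' v x) = 0.
Proof.
rewrite /Rintegral.
suff : (\int[mu]_(x in `[(- n%:R : R)%R, n%:R]) (h' v x)%:E)%E @[n --> \oo] --> 0%E.
  move=> /(cvg_unique _ (cvg_integral_symitv (@ih v))) -> //.
have hn0 : (h v n%:R - h v (- n%:R)) @[n --> \oo] --> (0 : R).
  have -> : (fun n : nat => h v n%:R - h v (- n%:R)) = (fun n : nat => (gauss_fun n%:R) * (2 * sin (2 * v * n%:R))).
    by apply/funext => n; rewrite /h /gauss_fun sqrrN mulrN sinN; ring.
  have gn : gauss_fun (n%:R : R) @[n --> \oo] --> (0 : R).
    exact: (@cvg_comp _ _ _ (fun n : nat => n%:R : R) (@gauss_fun R) _ _ _ (@cvgr_idn R) cvg_gauss_fun).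
  apply/norm_cvg0P/(@squeeze_cvgr _ _ _ _ (cst 0) (fun n => gauss_fun n%:R * 2)).
  - apply: nearW => n /=; rewrite normr_ge0 /= normrM ger0_norm ?gauss_fun_ge0//.
    rewrite ler_wpM2l ?gauss_fun_ge0// normrM ger0_norm// ler_piMr//.
    by rewrite ler_norml sin_geN1 sin_le1.
  - exact: cvg_cst.
  - by rewrite -[0 in X in _ --> X](mul0r 2); apply: cvgMl.
have hn1 : (h v n%:R - h v (- n%:R))%:E @[n --> \oo] --> (0 : R)%:E.
  by apply: cvg_EFin; [exact: nearW|exact: hn0].
apply: cvg_trans hn1.
apply: near_eq_cvg; near=> n.
have n0 : (0 < n%:R :> R)%R by rewrite ltr0n; near: n; exact: nbhs_infty_gt.
rewrite (@continuous_FTC2 _ _ (h v))//.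
- by rewrite ltrNl (lt_trans _ n0)// oppr_lt0.
- exact/continuous_subspaceT/ch'.
- have ch : continuous (h v).
    by move=> x; apply: differentiable_continuous; apply/derivable1_diffP; exact: ex_derive.
  split.
  + by move=> x _; exact: ex_derive.
  + exact/cvg_at_right_filter/ch.
  + exact/cvg_at_left_filter/ch.
- by move=> x _; rewrite derive1E; exact: (@derive_val _ _ _ _ _ _ _ (hD v x)).
Unshelve. all: by end_near. Qed.

Let FE v : \int[mu]_x (gauss_fun x * (- (2 * x) * sin (2 * v * x))) = - (2 * v) * F v.
Proof.
apply/eqP; rewrite -subr_eq0 mulNr opprK; apply/eqP.
rewrite -[RHS](int_h' v) /F -RintegralZl//.
rewrite -RintegralD//.
by apply: (@integrableZl _ _ _ mu _ _ (2 * v) _ (i0 v)).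
Qed.

Lemma Rintegral_gauss_cos v : F v = Num.sqrt pi * gauss_fun v.
Proof.
have F2 (w : R) : is_derive w 1 F (- (2 * w) * F w) by rewrite -FE; exact: F1.
have K (w : R) : is_derive w 1 (fun w => F w * expR (w ^+ 2)) 0.
  apply: is_derive_eq; rewrite /GRing.scale/=; ring.
have := is_derive_0_is_cst v 0 K.
rewrite expr0n expR0 mulr1 {2}/F.
rewrite (_ : \int[mu]_x _ = Num.sqrt pi); last first.
  rewrite /Rintegral -[RHS]/(fine (Num.sqrt pi)%:E) -integralT_gauss; congr fine.
  by apply: eq_integral => x _; rewrite mulr0 mul0r cos0 mulr1.
by move=> <-; rewrite /gauss_fun expRN mulfK// gt_eqF// expR_gt0.
Qed.

End gaussian_fourier.

Section gaussian_fourier_phase.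
Context {R : realType}.
Notation mu := (@lebesgue_measure R).

(** The summand [1] makes the integrand nonnegative, ready for Tonelli's theorem, and the phase [c]
    lets further coordinates be added inside the cosine later on. *)
Let j (c v x : R) : R := gauss_fun x * (1 + cos (c + 2 * v * x)).

Let mj c v : measurable_fun setT (j c v).
Proof.
apply: measurable_funM; first exact: measurable_gauss_fun.
apply: measurable_funD => //; apply: measurableT_comp => //.
  by apply: continuous_measurable_fun => x; exact: continuous_cos.
by apply: measurable_funD => //; exact: measurable_funM.
Qed.

Let j0 c v x : 0 <= j c v x.
Proof. by rewrite mulr_ge0 ?gauss_fun_ge0// -lerBlDl sub0r cos_geN1. Qed.

Let ji c v : mu.-integrable setT (EFin \o j c v).
Proof.
apply: (@integrable_le_bounded _ _ _ mu _ _ gauss_fun 2) => //.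
- exact: mj.
- exact: integrableT_gauss.
- move=> x _; rewrite !ger0_norm ?gauss_fun_ge0 ?j0// /j mulrC ler_wpM2r ?gauss_fun_ge0//.
  by rewrite -[2]/(1 + 1) lerD2l cos_le1.
Qed.

(** The reflection [x -> - x] shows that the phases [c] and [- c] give the same integral; in their
    sum the sines cancel, since [cos (c + y) + cos (- c + y) = 2 cos c cos y]. *)
Lemma Rintegral_gauss_cos_phase (c v : R) :
  \int[mu]_x (gauss_fun x * (1 + cos (c + 2 * v * x))) =
  Num.sqrt pi * (1 + cos c * gauss_fun v).
Proof.
have jN : \int[mu]_x (j (- c) v x) = \int[mu]_x (j c v x).
  rewrite /Rintegral; congr fine.
  rewrite -[RHS]ge0_integral_oppr//; last 2 first.
  - by apply/measurable_EFinP; exact: mj.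
  - by move=> x; rewrite lee_fin.
  apply: eq_integral => x _; congr EFin; rewrite /j /gauss_fun sqrrN; congr (_ * (1 + _)).
  by rewrite mulrN -[RHS]cosN opprD opprK.
have ci : mu.-integrable setT (EFin \o (fun x => gauss_fun x * cos (2 * v * x))).
  apply: (@integrable_le_bounded _ _ _ mu _ _ gauss_fun 1) => //.
  - apply: measurable_funM; [exact: measurable_gauss_fun|exact: measurable_cosM].
  - exact: integrableT_gauss.
  - by move=> x _; rewrite mul1r normrM ler_piMr// ler_norml cos_geN1 cos_le1.
have G : \int[mu]_x gauss_fun x = Num.sqrt (pi : R) by rewrite /Rintegral integralT_gauss.
have : \int[mu]_x (j c v x) + \int[mu]_x (j (- c) v x) = 2 * (Num.sqrt pi * (1 + cos c * gauss_fun v)).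
  rewrite -RintegralD//.
  rewrite (@eq_Rintegral _ _ _ _ _ (fun x : measurableTypeR R => 2 * (gauss_fun x + cos c * (gauss_fun x * cos (2 * v * x))))); last first.
    by move=> x _; rewrite /j cosD [in cos (- c + _)]cosD cosN sinN; ring.
  rewrite RintegralZl//; last first.
    apply: integrable_funD => //; first exact: integrableT_gauss.
    exact: integrable_funZ.
  rewrite RintegralD//; last 2 first.
  - exact: integrableT_gauss.
  - exact: (integrable_funZ _ (cos c) ci).
  by rewrite RintegralZl// Rintegral_gauss_cos G; ring.
rewrite jN -/(j c v); set x := \int[mu]_x _ => H.
have -> : x = 2^-1 * (x + x) by field.
by rewrite H; field.
Qed.

Lemma integral_gauss1_cos (a c t : R) : 0 < a ->
  (\int[mu]_x (gauss1 a x * (1 + cos (c + 2 * pi * (x * t))))%:E =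
   (1 + cos c * expR (- (a * pi ^+ 2 * t ^+ 2)))%:E)%E.
Proof.
move=> a0; have sa0 : 0 < Num.sqrt a by rewrite sqrtr_gt0.
have sp0 : 0 < Num.sqrt (pi : R) by rewrite sqrtr_gt0 pi_gt0.
have saE : Num.sqrt a ^+ 2 = a by rewrite sqr_sqrtr// ltW.
(* The frequency of [j] after the substitution of [sqrt a * x] for [x]. *)
pose v := pi * t * Num.sqrt a.
rewrite (@eq_integral _ _ _ _ _ (fun x : measurableTypeR R => (Num.sqrt (a * pi))^-1%:E * (j c v ((Num.sqrt a)^-1 * x + 0))%:E)%E); last first.
  move=> x _; rewrite -EFinM; congr EFin; rewrite /gauss1 /j /gauss_fun addr0 [in RHS]mulrA.
  congr (_ * expR (- _) * (1 + cos (c + _))).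
    by rewrite -{1}saE; field; rewrite gt_eqF.
  by rewrite /v; field; rewrite gt_eqF.
rewrite ge0_integralZl//=; last 2 first.
- apply/measurable_EFinP; apply: (measurableT_comp (mj c v)).
  exact: measurable_affine.
- by move=> x _; rewrite lee_fin.
rewrite (@ge0_integral_affine _ _ _ (fun x => (j c v x)%:E)) ?invr_gt0//; last 2 first.
- by apply/measurable_EFinP; exact: mj.
- by move=> x; rewrite lee_fin.
rewrite (EFin_Rintegral _ (ji c v))// /j Rintegral_gauss_cos_phase -!EFinM; congr EFin.
rewrite invrK sqrtrM ?ltW// /gauss_fun /v exprMn saE exprMn.
rewrite (_ : pi ^+ 2 * t ^+ 2 * a = a * pi ^+ 2 * t ^+ 2); last by ring.
by field; rewrite !gt_eqF.
Qed.

End gaussian_fourier_phase.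

(** * Integration over R^d, one coordinate at a time *)

Section tuple_integral.
Context {R : realType}.
Notation mu := (@lebesgue_measure R).
Notation lebT := (@lebesgue_tuple R).

Lemma integral_tuple0 (f : 0.-tuple R -> \bar R) : measurable_fun setT f ->
  (\int[lebT 0]_x f x = f [tuple])%E.
Proof. by move=> mf; rewrite integral_dirac// diracT mul1e. Qed.

Lemma ge0_integral_tcons d (f : d.+1.-tuple R -> \bar R) :
  measurable_fun setT f -> (forall x, 0 <= f x)%E ->
  (\int[lebT d.+1]_x f x = \int[mu]_x \int[lebT d]_y f (tcons (x, y)))%E.
Proof.
move=> mf f0.
rewrite (ge0_integral_pushforward (@measurable_tcons R d))//.
rewrite preimage_setT fubini_tonelli1//; last by move=> x; exact: f0.
exact: (measurableT_comp mf (@measurable_tcons R d)).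
Qed.

Lemma tnth_tcons0 d (x : R) (y : d.-tuple R) : tnth (tcons (x, y)) ord0 = x.
Proof. by []. Qed.

Lemma tnth_tconsS d (x : R) (y : d.-tuple R) i : tnth (tcons (x, y)) (lift ord0 i) = tnth y i.
Proof. by rewrite tnthS; congr (tnth _ i); exact: val_inj. Qed.

Lemma measurable_tcons_l d (x : R) : measurable_fun setT (fun y : d.-tuple R => tcons (x, y)).
Proof. exact: (measurableT_comp (@measurable_tcons R d) (pair1_measurable _)). Qed.

Lemma measurable_integral_tcons d (f : d.+1.-tuple R -> \bar R) :
  measurable_fun setT f -> (forall x, 0 <= f x)%E ->
  measurable_fun [set: R] (fun x => \int[lebT d]_y f (tcons (x, y)))%E.
Proof.
move=> mf f0.
apply: (@measurable_fun_fubini_tonelli_F _ _ (measurableTypeR R) (d.-tuple R) R (lebT d) (fun z => f (tcons z))) => //.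
exact: (measurableT_comp mf (@measurable_tcons R d)).
Qed.

Lemma measurable_tuple_prod d (q : 'I_d -> R -> R) : (forall i, measurable_fun setT (q i)) ->
  measurable_fun setT (fun x : d.-tuple R => \prod_(i < d) q i (tnth x i)).
Proof.
move=> mq; apply: measurable_prod => i _.
by apply: (measurableT_comp (mq i)); exact: measurable_tnth.
Qed.

Lemma integral_tuple_prod d (q : 'I_d -> R -> R) (c : 'I_d -> R) :
  (forall i, measurable_fun setT (q i)) -> (forall i x, 0 <= q i x) ->
  (forall i, \int[mu]_x (q i x)%:E = (c i)%:E)%E ->
  (\int[lebT d]_x (\prod_(i < d) q i (tnth x i))%:E = (\prod_(i < d) c i)%:E)%E.
Proof.
elim: d q c => [|d IH] q c mq q0 qc.
  rewrite integral_tuple0 ?big_ord0//.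
  by apply/measurable_EFinP; exact: measurable_tuple_prod.
rewrite ge0_integral_tcons; last 2 first.
- by apply/measurable_EFinP; exact: measurable_tuple_prod.
- by move=> x; rewrite lee_fin prodr_ge0.
under eq_integral => x _.
  under eq_integral => y _.
    rewrite big_ord_recl tnth_tcons0 EFinM.
    under eq_bigr do rewrite tnth_tconsS.
    over.
  rewrite ge0_integralZl//; last 3 first.
  - apply/measurable_EFinP; exact: (@measurable_tuple_prod d (fun i => q (lift ord0 i))).
  - by move=> y _; rewrite lee_fin prodr_ge0.
  - by rewrite lee_fin.
  rewrite (IH (fun i => q (lift ord0 i)) (fun i => c (lift ord0 i)))// muleC.
  over.
rewrite ge0_integralZl//; last 3 first.
- by apply/measurable_EFinP; exact: mq.
- by move=> x _; rewrite lee_fin.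
- rewrite lee_fin; apply: prodr_ge0 => i _.
  by rewrite -lee_fin -qc integral_ge0// => x _; rewrite lee_fin.
by rewrite qc big_ord_recl mulrC EFinM.
Qed.

Lemma measurable_tadd d d' (T : measurableType d') (f g : T -> d.-tuple R) :
  measurable_fun setT f -> measurable_fun setT g ->
  measurable_fun setT (fun x => tadd (f x) (g x)).
Proof.
move=> mf mg; apply/measurable_fun_tnthP => i.
rewrite (_ : _ \o _ = (fun x => tnth (f x) i + tnth (g x) i)).
  by apply: measurable_funD; apply: (measurableT_comp (measurable_tnth i)).
by apply/funext => x /=; rewrite tnth_mktuple.
Qed.

Lemma measurable_tscale d d' (T : measurableType d') (c : R) (f : T -> d.-tuple R) :
  measurable_fun setT f -> measurable_fun setT (fun x => tscale c (f x)).
Proof.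
move=> mf; apply/measurable_fun_tnthP => i.
rewrite (_ : _ \o _ = (fun x => c * tnth (f x) i)).
  by apply: measurable_funM => //; apply: (measurableT_comp (measurable_tnth i)).
by apply/funext => x /=; rewrite tnth_mktuple.
Qed.

Lemma measurable_tdot d d' (T : measurableType d') (f g : T -> d.-tuple R) :
  measurable_fun setT f -> measurable_fun setT g ->
  measurable_fun setT (fun x => tdot (f x) (g x)).
Proof.
move=> mf mg; apply: measurable_sum => i.
by apply: measurable_funM; apply: (measurableT_comp (measurable_tnth i)).
Qed.

Lemma tuple0_eq (T : Type) (x y : 0.-tuple T) : x = y.
Proof. by rewrite (tuple0 x) (tuple0 y). Qed.

Lemma tuple_taffine d (c : R) (b : d.+1.-tuple R) (x : R) (y : d.-tuple R) :
  tadd (tscale c (tcons (x, y))) b =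
  tcons (c * x + thead b, tadd (tscale c y) [tuple of behead b]).
Proof.
apply: eq_from_tnth => i; rewrite !tnth_mktuple.
case: (unliftP ord0 i) => [j|] ->; last by rewrite !tnth_tcons0.
by rewrite !tnth_tconsS !tnth_mktuple [in LHS](tuple_eta b) tnthS.
Qed.

Lemma ge0_integral_taffine d (c : R) (b : d.-tuple R) (f : d.-tuple R -> \bar R) : 0 < c ->
  measurable_fun setT f -> (forall x, 0 <= f x)%E ->
  (\int[lebT d]_x f (tadd (tscale c x) b) = (c^-1 ^+ d)%:E * \int[lebT d]_x f x)%E.
Proof.
move=> c0; elim: d b f => [|d IH] b f mf f0.
  rewrite !integral_tuple0//; last by apply: (measurableT_comp mf); apply: measurable_tadd => //; exact: measurable_tscale.
  by rewrite expr0 mul1e; congr f; exact: tuple0_eq.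
rewrite [LHS]ge0_integral_tcons//; last first.
  by apply: (measurableT_comp mf); apply: measurable_tadd => //; exact: measurable_tscale.
under eq_integral => x _.
  under eq_integral do rewrite tuple_taffine.
  rewrite (IH _ (fun y => f (tcons (c * x + thead b, y))))//; last first.
    exact: (measurableT_comp mf (@measurable_tcons_l _ _)).
  over.
have mI := measurable_integral_tcons mf f0.
rewrite ge0_integralZl//; last 3 first.
- by apply: (measurableT_comp mI); exact: measurable_affine.
- by move=> x _; exact: integral_ge0.
- by rewrite lee_fin exprn_ge0// invr_ge0 ltW.
rewrite (@ge0_integral_affine _ c (thead b) (fun x => \int[lebT d]_y f (tcons (x, y)))%E)//; last first.
  by move=> x; exact: integral_ge0.
by rewrite [in RHS]ge0_integral_tcons// muleA -EFinM exprSr.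
Qed.

End tuple_integral.

(** * Sums over Z^d and unfolding *)

Section esum_extra.
Context {R : realType}.
Local Open Scope ereal_scope.

(** Unconditional sums over a countable type become series along [pickle], with the term [0] at
    numbers that encode no element; monotone convergence for series then applies. *)
Lemma esum_pickle (T : countType) (a : T -> \bar R) : (forall i, 0 <= a i) ->
  \esum_(i in [set: T]) a i = \sum_(n <oo) oapp a 0 (@pickle_inv T n).
Proof.
move=> a0.
rewrite nneseries_esumT; last by move=> n; case: pickle_inv => //=.
transitivity (\esum_(n in pickle @` [set: T]) oapp a 0 (@pickle_inv T n)).
  rewrite esum_image; last by move=> x y _ _; exact: (pcan_inj pickleK).
  apply: eq_esum => i _; by rewrite /pickle_inv pickleK /= eqxx.
rewrite esum_mkcond; apply: eq_esum => n _; case: ifPn => // nP.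
have := @pickle_invK T n; case: pickle_inv => //= x xn.
by exfalso; move/negP: nP; apply; rewrite inE; exists x.
Qed.

Lemma esumZl (T : countType) (c : R) (a : T -> \bar R) : (0 <= c)%R -> (forall i, 0 <= a i) ->
  \esum_(i in [set: T]) (c%:E * a i) = c%:E * \esum_(i in [set: T]) a i.
Proof.
move=> c0 a0; rewrite !esum_pickle//; last by move=> i; rewrite mule_ge0.
rewrite -nneseriesZl//; last by move=> n _; case: pickle_inv => //=.
by apply: eq_eseriesr => n _; case: pickle_inv => //=; rewrite mule0.
Qed.

Section esum_integral.
Context d (X : measurableType d) (m : {measure set X -> \bar R}).
Variables (T : countType) (f : T -> X -> \bar R).
Hypothesis mf : forall i, measurable_fun setT (f i).
Hypothesis f0 : forall i x, 0 <= f i x.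

Let g n x := oapp (f ^~ x) 0 (@pickle_inv T n).

Let mg n : measurable_fun setT (g n).
Proof. by rewrite /g; case: pickle_inv => //=. Qed.

Lemma measurable_esum : measurable_fun setT (fun x => \esum_(i in [set: T]) f i x).
Proof.
under eq_fun do rewrite esum_pickle//.
apply: (@ge0_emeasurable_sum _ _ _ _ g xpredT) => //.
by move=> k x _ _; rewrite /g; case: pickle_inv => /=.
Qed.

Lemma ge0_integral_esum :
  \int[m]_x (\esum_(i in [set: T]) f i x) = \esum_(i in [set: T]) \int[m]_x f i x.
Proof.
under eq_integral do rewrite esum_pickle//.
rewrite (@integral_nneseries _ _ _ m setT measurableT g)//; last first.
  by move=> n x _; rewrite /g; case: pickle_inv => /=.
rewrite esum_pickle; last by move=> i; exact: integral_ge0.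
apply: eq_eseriesr => n _; rewrite /g; case: pickle_inv => //=.
by rewrite integral0.
Qed.

End esum_integral.

Lemma esum_int (f : int -> \bar R) : (forall i, 0 <= f i) ->
  \esum_(i in [set: int]) f i = \sum_(n <oo) f (Posz n) + \sum_(n <oo) f (Negz n).
Proof.
move=> f0; rewrite (esumID (range Posz))//; congr (_ + _).
  by rewrite setTI esum_image//; [rewrite -nneseries_esumT|move=> x y _ _ []].
rewrite (_ : _ `&` _ = range Negz).
  by rewrite esum_image//; [rewrite -nneseries_esumT|move=> x y _ _ []].
apply/seteqP; split => [[n [_ /=]|n _]|_ [n _ <-]] //=.
- by case; exists n.
- by exists n.
- by split => // -[k _].
Qed.

Definition zcons {T : Type} {d} (p : T * d.-tuple T) : d.+1.-tuple T := [tuple of p.1 :: p.2].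

Lemma esum_tuple_cons (T : choiceType) d (f : d.+1.-tuple T -> \bar R) : (forall i, 0 <= f i) ->
  \esum_(m in [set: d.+1.-tuple T]) f m =
  \esum_(i in [set: T]) (\esum_(m in [set: d.-tuple T]) f (zcons (i, m))).
Proof.
move=> f0; rewrite esum_esum//.
rewrite (reindex_esum (setT `*`` fun=> setT) setT zcons)//.
split => //.
- move=> [x y] [x' y'] _ _ [-> /= e]; congr pair; exact: val_inj.
- move=> m _ /=; exists (thead m, [tuple of behead m]) => //.
  by rewrite [RHS]tuple_eta; apply: val_inj.
Qed.

Lemma esum_tuple0 (T : choiceType) (f : 0.-tuple T -> \bar R) : (forall i, 0 <= f i) ->
  \esum_(m in [set: 0.-tuple T]) f m = f [tuple].
Proof.
move=> f0; rewrite (_ : setT = [set [tuple]]) ?esum_set1//.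
by apply/seteqP; split => // x _ /=; exact: tuple0_eq.
Qed.

Lemma tnth_zcons0 (T : Type) d (x : T) (y : d.-tuple T) : tnth (zcons (x, y)) ord0 = x.
Proof. by []. Qed.

Lemma tnth_zconsS (T : Type) d (x : T) (y : d.-tuple T) i : tnth (zcons (x, y)) (lift ord0 i) = tnth y i.
Proof. by rewrite tnthS; congr (tnth _ i); exact: val_inj. Qed.

Lemma esum_tuple_prod (T : countType) d (q : 'I_d -> T -> R) (c : 'I_d -> R) :
  (forall i x, 0 <= q i x)%R ->
  (forall i, \esum_(x in [set: T]) (q i x)%:E = (c i)%:E) ->
  \esum_(x in [set: d.-tuple T]) (\prod_(i < d) q i (tnth x i))%:E = (\prod_(i < d) c i)%:E.
Proof.
elim: d q c => [|d IH] q c q0 qc.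
  by rewrite esum_tuple0 ?big_ord0// => x; rewrite big_ord0 lee_fin.
have P0 (x : d.-tuple T) : 0 <= (\prod_(i < d) q (lift ord0 i) (tnth x i))%:E.
  by rewrite lee_fin prodr_ge0.
rewrite esum_tuple_cons; last by move=> x; rewrite lee_fin prodr_ge0.
transitivity (\esum_(x in [set: T]) ((\prod_(i < d) c (lift ord0 i))%:E * (q ord0 x)%:E)).
  apply: eq_esum => x _.
  under eq_esum => m _.
    rewrite big_ord_recl tnth_zcons0 EFinM.
    under eq_bigr do rewrite tnth_zconsS.
    over.
  rewrite esumZl//.
  by rewrite (IH (fun i => q (lift ord0 i)) (fun i => c (lift ord0 i)))// muleC.
have c0 : (0 <= \prod_(i < d) c (lift ord0 i))%R.
  rewrite -lee_fin -(IH (fun i => q (lift ord0 i)) (fun i => c (lift ord0 i)))//.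
  exact: esum_ge0.
rewrite esumZl//; last by move=> x; rewrite lee_fin.
by rewrite qc big_ord_recl mulrC EFinM.
Qed.

End esum_extra.

Section unfolding.
Context {R : realType}.
Notation mu := (@lebesgue_measure R).
Notation lebT := (@lebesgue_tuple R).
Local Open Scope ereal_scope.

(** Each [x] lies in exactly one interval [[n, n + 1[], the one with [n = floor x]; each of these
    integrals is then translated back to the unit interval. *)
Lemma ge0_integral_unfold1 (f : R -> \bar R) : measurable_fun setT f -> (forall x, 0 <= f x) ->
  \int[mu]_x f x = \esum_(n in [set: int]) \int[mu]_z (f (n%:~R + z)%R * (\1_(`[0%R, 1%R]) z)%:E).
Proof.
move=> mf f0.
pose I := [set` `[0%R, 1%R[] : set R.
have mI : measurable I by exact: measurable_itv.
pose F (n : int) x := f x * (\1_I (x - n%:~R)%R)%:E.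
have mF n : measurable_fun setT (F n).
  apply: emeasurable_funM => //; apply/measurable_EFinP.
  apply: (measurableT_comp (measurable_indic mI)); exact: measurable_funB.
have F0 n x : 0 <= F n x by rewrite mule_ge0// lee_fin.
transitivity (\int[mu]_x (\esum_(n in [set: int]) F n x)).
  apply: eq_integral => x _.
  have -> : f x = F (Num.floor x) x.
    rewrite /F indicE mem_set ?mule1//= /I /= in_itv/= subr_ge0 ltrBlDl.
    by rewrite floor_le_tmp -intrD1 floorD1_gt.
  rewrite -(@esum_set1 R int (Num.floor x) (F ^~ x))// esum_mkcond.
  apply: eq_esum => n _; case: ifPn => // nx.
  rewrite /F indicE memNset ?mule0//= /I /= in_itv/= subr_ge0 ltrBlDl => nI.
  move/negP: nx; apply; rewrite inE /=; apply/esym.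
  by apply: floor_def; rewrite intrD.
rewrite (ge0_integral_esum mu mF F0); apply: eq_esum => n _.
have := @ge0_integral_affine R 1 n%:~R (F n) ltr01 (mF n) (F0 n).
rewrite invr1 mul1e => <-.
transitivity (\int[mu]_(z in `[0%R, 1%R[) f (n%:~R + z)%R).
  rewrite [RHS]integral_mkcond epatch_indic; apply: eq_integral => z _.
  by rewrite /F mul1r addrK addrC.
(* The half-open interval gives a partition; closing it, to match the closed cube of the statement,
   changes only a null set. *)
rewrite integral_itv_bndo_bndc; last first.
  apply: measurable_funTS; apply: (measurableT_comp mf); exact: measurable_funD.
by rewrite integral_mkcond epatch_indic.
Qed.

Lemma measurable_tcube d : measurable (@tcube R d).
Proof.
rewrite (_ : tcube = \bigcap_(i in [set` 'I_d]) (fun x : d.-tuple R => tnth x i) @^-1` `[0%R, 1%R]); last first.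
  apply/seteqP; split => x /=.
    by move=> H i _ /=; rewrite in_itv/=.
  by move=> H i; have := H i isT; rewrite /= in_itv/=.
apply: fin_bigcap_measurable; first exact: finite_finset.
move=> i _; rewrite -[X in measurable X]setTI.
by apply: (measurable_tnth i) => //; exact: measurable_itv.
Qed.

Lemma indic_tcube_tcons d (x : R) (y : d.-tuple R) :
  \1_tcube (tcons (x, y)) = (\1_(`[0%R, 1%R]) x * \1_tcube y)%R :> R.
Proof.
rewrite !indicE -natrM mulnb; congr (_ _)%:R.
apply/idP/andP => [/set_mem H|[/set_mem Hx /set_mem Hy]].
  split; apply/mem_set.
    by have := H ord0; rewrite tnth_tcons0 /= in_itv/=.
  by move=> i; have := H (lift ord0 i); rewrite tnth_tconsS.
apply/mem_set => i; case: (unliftP ord0 i) => [j|] ->.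
  by rewrite tnth_tconsS; exact: Hy.
by rewrite tnth_tcons0; move: Hx; rewrite /= in_itv/=.
Qed.

(** The translates of the closed cube overlap only in null sets; the induction on the dimension
    reduces this to the one-dimensional unfolding. *)
Lemma ge0_integral_unfold d (f : d.-tuple R -> \bar R) :
  measurable_fun setT f -> (forall x, 0 <= f x) ->
  \int[lebT d]_x f x =
  \esum_(n in [set: d.-tuple int]) \int[lebT d]_z (f (tadd (tint n) z) * (\1_tcube z)%:E).
Proof.
have mS e (n : e.-tuple int) : measurable_fun setT (fun z : e.-tuple R => tadd (tint n) z).
  by apply: measurable_tadd.
have m1 e : measurable_fun setT (fun z : e.-tuple R => (\1_tcube z : R)%:E).
  by apply/measurable_EFinP; apply: measurable_indic; exact: measurable_tcube.
elim: d f => [|d IH] f mf f0.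
  rewrite esum_tuple0; last by move=> n; apply: integral_ge0 => x _; rewrite mule_ge0// lee_fin.
  have mg : measurable_fun setT (fun z : 0.-tuple R => f (tadd (tint [tuple]) z) * (\1_tcube z)%:E).
    by apply: emeasurable_funM; [exact: (measurableT_comp mf (mS 0%N [tuple]))|exact: m1].
  rewrite (integral_tuple0 mf) (integral_tuple0 mg).
  rewrite indicE mem_set ?mule1; last by move=> -[].
  by congr f; exact: tuple0_eq.
have mg (n : d.+1.-tuple int) : measurable_fun setT (fun z : d.+1.-tuple R => f (tadd (tint n) z) * (\1_tcube z)%:E).
  by apply: emeasurable_funM; [exact: (measurableT_comp mf (mS _ n))|exact: m1].
rewrite ge0_integral_tcons// ge0_integral_unfold1//; last 2 first.
- exact: measurable_integral_tcons.
- by move=> x; exact: integral_ge0.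
rewrite [RHS]esum_tuple_cons; last first.
  by move=> n; apply: integral_ge0 => x _; rewrite mule_ge0// lee_fin.
apply: eq_esum => n _.
have E (m : d.-tuple int) x y : f (tadd (tint (zcons (n, m))) (tcons (x, y))) =
    f (tcons ((n%:~R + x)%R, tadd (tint m) y)).
  congr f; apply: eq_from_tnth => i; rewrite !tnth_mktuple.
  case: (unliftP ord0 i) => [j|] ->; last by rewrite tnth_zcons0 !tnth_tcons0.
  by rewrite tnth_zconsS !tnth_tconsS !tnth_mktuple.
under [RHS]eq_esum => m _.
  rewrite ge0_integral_tcons; last 2 first.
  - exact: mg.
  - by move=> x; rewrite mule_ge0// lee_fin.
  under eq_integral => x _ do under eq_integral => y _ do rewrite E indic_tcube_tcons.
  over.
rewrite -ge0_integral_esum; last 2 first.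
- move=> m.
  have g0 z : 0 <= f (tadd (tint (zcons (n, m))) z) * (\1_tcube z : R)%:E.
    by rewrite mule_ge0// lee_fin.
  apply: eq_measurable_fun (measurable_integral_tcons (mg (zcons (n, m))) g0) => x _.
  by apply: eq_integral => y _; rewrite E indic_tcube_tcons.
- by move=> m x; apply: integral_ge0 => y _; rewrite mule_ge0// lee_fin mulr_ge0.
apply: eq_integral => x _.
rewrite (IH (fun y => f (tcons ((n%:~R + x)%R, y))))//; last first.
  exact: (measurableT_comp mf (@measurable_tcons_l _ _ _)).
rewrite muleC -esumZl//; last by move=> m; apply: integral_ge0 => y _; rewrite mule_ge0// lee_fin.
apply: eq_esum => m _; rewrite -ge0_integralZl//; last 2 first.
- apply: emeasurable_funM; last exact: m1.
  exact: (measurableT_comp (measurableT_comp mf (@measurable_tcons_l _ _ _)) (mS _ m)).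
- by move=> y _; rewrite mule_ge0// lee_fin.
by apply: eq_integral => y _; rewrite muleCA EFinM.
Qed.

End unfolding.

(** * Poisson summation for Gaussians *)

Section bessel.
Context {R : realType}.
Notation mu := (@lebesgue_measure R).
Notation I := ([set` `[0%R, 1%R]] : set R).

Let mu01 : mu I = 1%E.
Proof. by rewrite lebesgue_measure_itv/= lte_fin ltr01 oppr0 adde0. Qed.

Lemma Rintegral01_cst (c : R) : \int[mu]_(x in I) c = c.
Proof.
rewrite Rintegral_cst//; transitivity (c * fine (1%E : \bar R)); last by rewrite mulr1.
by congr (_ * fine _); exact: mu01.
Qed.

(** A class closed under sums and products, all of whose members are integrable on the unit
    interval; membership discharges the integrability conditions in the Fourier series
    computations. *)
Definition bounded_measurable (f : R -> R) :=
  measurable_fun setT f /\ exists B : R, forall x, `|f x| <= B.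

Lemma bounded_measurable_cst c : bounded_measurable (cst c).
Proof. by split => //; exists `|c|. Qed.

Lemma bounded_measurableD f g : bounded_measurable f -> bounded_measurable g ->
  bounded_measurable (fun x => f x + g x).
Proof.
move=> [mf [B fB]] [mg [C gC]]; split; first exact: measurable_funD.
by exists (B + C) => x; apply: le_trans (ler_normD _ _) _; exact: lerD.
Qed.

Lemma bounded_measurableM f g : bounded_measurable f -> bounded_measurable g ->
  bounded_measurable (fun x => f x * g x).
Proof.
move=> [mf [B fB]] [mg [C gC]]; split; first exact: measurable_funM.
by exists (B * C) => x; rewrite normrM ler_pM.
Qed.

Lemma bounded_measurable_sum (T : Type) (s : seq T) (f : T -> R -> R) :
  (forall i, bounded_measurable (f i)) -> bounded_measurable (fun x => \sum_(i <- s) f i x).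
Proof.
move=> bf; elim: s => [|i s IH].
  by under eq_fun do rewrite big_nil; exact: bounded_measurable_cst.
by under eq_fun do rewrite big_cons; exact: bounded_measurableD.
Qed.

Lemma bounded_measurable_sin v : bounded_measurable (fun x => sin (v * x)).
Proof. by split; [exact: measurable_sinM|exists 1 => x; rewrite ler_norml sin_geN1 sin_le1]. Qed.

Lemma bounded_measurable_cos v : bounded_measurable (fun x => cos (v * x)).
Proof. by split; [exact: measurable_cosM|exists 1 => x; rewrite ler_norml cos_geN1 cos_le1]. Qed.

Lemma bounded_measurable_integrable f : bounded_measurable f -> mu.-integrable I (EFin \o f).
Proof.
move=> [mf [B fB]]; apply: measurable_bounded_integrable => //.
- by apply: (@le_lt_trans _ _ 1%E); [rewrite -mu01|rewrite ltry].
- exact: measurable_funTS.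
- by exists B; split; [exact: num_real|move=> x Bx y _; exact: le_trans (fB y) (ltW Bx)].
Qed.

Lemma Rintegral01_sum (T : Type) (s : seq T) (f : T -> R -> R) :
  (forall i, bounded_measurable (f i)) ->
  \int[mu]_(x in I) (\sum_(i <- s) f i x) = \sum_(i <- s) \int[mu]_(x in I) f i x.
Proof.
move=> bf; elim: s => [|i s IH].
  by rewrite big_nil; under eq_Rintegral do rewrite big_nil; rewrite Rintegral01_cst.
under eq_Rintegral do rewrite big_cons.
rewrite RintegralD//; last 2 first.
- exact: bounded_measurable_integrable.
- by apply: bounded_measurable_integrable; exact: bounded_measurable_sum.
by rewrite IH big_cons.
Qed.

Lemma Rintegral01_cos (k : nat) : (0 < k)%N -> \int[mu]_(x in I) cos (2 * pi * k%:R * x) = 0.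
Proof.
move=> k0; pose v : R := 2 * pi * k%:R.
have v0 : v != 0 by rewrite !mulf_neq0// gt_eqF// ?pi_gt0// ltr0n.
pose F x : R := v^-1 * sin (v * x).
have FD x : is_derive x (1 : R) F (cos (v * x)).
  by rewrite /F; apply: is_derive_eq; rewrite /GRing.scale/=; field.
have cF : continuous F.
  by move=> x; apply: differentiable_continuous; apply/derivable1_diffP; exact: ex_derive.
rewrite /Rintegral -/v (@continuous_FTC2 _ _ F)//.
- rewrite /F !mulr0 sin0 mulr0 mulr1 (_ : v = 0 + pi *+ 2 *+ k); last first.
    by rewrite /v add0r -mulrnA -[RHS]mulr_natr natrM; ring.
  by rewrite (periodicn (@sinD2pi R)) sin0 mulr0 /= subrr.
- apply: continuous_subspaceT => x; apply: continuous_comp; [exact: mulrl_continuous|exact: continuous_cos].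
- split.
  + by move=> x _; exact: ex_derive.
  + exact/cvg_at_right_filter/cF.
  + exact/cvg_at_left_filter/cF.
- by move=> x _; rewrite derive1E; exact: (@derive_val _ _ _ _ _ _ _ (FD x)).
Qed.

(** The numerators of the Dirichlet kernels. On the unit interval they are orthogonal with squared
    norm [1 / 2], so the projection of [k] has coefficients [2 * c i]. *)
Let e (n : nat) (x : R) := sin ((2 * n%:R + 1) * pi * x).

Let be n : bounded_measurable (e n). Proof. exact: bounded_measurable_sin. Qed.

Let sinM (x y : R) : sin x * sin y = 2^-1 * (cos (x - y) - cos (x + y)).
Proof. by rewrite cosB cosD; field. Qed.

Let bc (v : R) : mu.-integrable I (EFin \o (fun x => cos (v * x))).
Proof. by apply: bounded_measurable_integrable; exact: bounded_measurable_cos. Qed.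

Let ee n m : \int[mu]_(x in I) (e n x * e m x) = 2^-1 * (n == m)%:R.
Proof.
wlog nm : n m / (m <= n)%N.
  move=> H; have [/H//|/ltnW/H] := leqP m n.
  rewrite eq_sym => <-; apply: eq_Rintegral => x _; exact: mulrC.
transitivity (\int[mu]_(x in I) (2^-1 * (cos (2 * pi * (n - m)%:R * x) - cos (2 * pi * (n + m + 1)%:R * x)))).
  apply: eq_Rintegral => x _; rewrite sinM; congr (_ * (cos _ - cos _)).
    by rewrite natrB//; ring.
  by rewrite !natrD; ring.
rewrite RintegralZl//; last by apply: integrable_funB => //; exact: bc.
rewrite RintegralB// [X in _ - X]Rintegral01_cos ?addn1// subr0; congr (_ * _).
have [->|nm'] := eqVneq n m.
  rewrite subnn; under eq_Rintegral do rewrite mulr0 mul0r cos0.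
  by rewrite Rintegral01_cst.
by rewrite Rintegral01_cos// subn_gt0 ltn_neqAle eq_sym nm'.
Qed.

(** Bessel's inequality [H], obtained by expanding the squared distance from [k] to its projection
    on the first [n] sines, bounds the partial sums of the squared coefficients; the series
    converges, so its terms tend to [0]. *)
Lemma riemann_lebesgue_odd_sin (k : R -> R) : bounded_measurable k ->
  (fun n : nat => \int[mu]_(x in I) (k x * sin ((2 * n%:R + 1) * pi * x))) @ \oo --> (0 : R).
Proof.
move=> bk; pose c n := \int[mu]_(x in I) (k x * e n x).
have bkk : bounded_measurable (fun x => k x * k x) by exact: bounded_measurableM.
have bke n : bounded_measurable (fun x => k x * e n x) by exact: bounded_measurableM.
have bee n m : bounded_measurable (fun x => e n x * e m x) by exact: bounded_measurableM.
have bM (a : R) f : bounded_measurable f -> bounded_measurable (fun x => a * f x).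
  by move=> bf; apply: bounded_measurableM => //; exact: bounded_measurable_cst.
have bi := bounded_measurable_integrable.
have H n : 2 * \sum_(0 <= i < n) c i ^+ 2 <= \int[mu]_(x in I) (k x * k x).
  rewrite -subr_ge0.
  have : 0 <= \int[mu]_(x in I) ((k x - \sum_(0 <= i < n) 2 * c i * e i x) ^+ 2).
    by apply: Rintegral_ge0 => x _; exact: sqr_ge0.
  rewrite (_ : \int[mu]_(x in I) _ = \int[mu]_(x in I) (k x * k x) - 2 * \sum_(0 <= i < n) c i ^+ 2) //.
  transitivity (\int[mu]_(x in I) (k x * k x + (\sum_(0 <= i < n) (- (4 * c i)) * (k x * e i x) +
      \sum_(0 <= i < n) \sum_(0 <= j < n) (4 * c i * c j) * (e i x * e j x)))).
    apply: eq_Rintegral => x _.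
    set S := \sum_(0 <= i < n) 2 * c i * e i x.
    have -> : (k x - S) ^+ 2 = k x * k x - 2 * k x * S + S * S by ring.
    rewrite -addrA; congr (_ + (_ + _)).
      by rewrite /S mulr_sumr -sumrN; apply: eq_bigr => i _; ring.
    rewrite /S mulr_suml; apply: eq_bigr => i _; rewrite mulr_sumr; apply: eq_bigr => j _; ring.
  rewrite RintegralD//; last 2 first.
  - exact: bi.
  - apply/bi/bounded_measurableD; first by apply: bounded_measurable_sum => i; exact: bM.
    by do 2 (apply: bounded_measurable_sum => ?); exact: bM.
  congr (_ + _); rewrite RintegralD//; last 2 first.
  - by apply/bi/bounded_measurable_sum => i; exact: bM.
  - by apply/bi; do 2 (apply: bounded_measurable_sum => ?); exact: bM.
  rewrite Rintegral01_sum; last by move=> i; exact: bM.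
  rewrite Rintegral01_sum; last by move=> i; apply: bounded_measurable_sum => j; exact: bM.
  rewrite -big_split/= mulr_sumr -sumrN big_nat [RHS]big_nat; apply: eq_bigr => i /andP[_ ni].
  rewrite RintegralZl//; last exact: bi.
  rewrite Rintegral01_sum; last by move=> j; exact: bM.
  rewrite -/(c i).
  transitivity (- (4 * c i) * c i + \sum_(0 <= j < n) 2 * c i * c j * (i == j)%:R).
    congr (_ + _); apply: eq_bigr => j _; rewrite RintegralZl//; last exact: bi.
    by rewrite ee; field.
  rewrite big_mkord (bigD1 (Ordinal ni))//= eqxx big1 ?addr0; last first.
    by move=> j; rewrite -val_eqE/= eq_sym => /negbTE ->; rewrite mulr0.
  by rewrite mulr1; ring.
have cs : cvgn (series (fun n => c n ^+ 2)).
  apply: nondecreasing_is_cvgn.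
    by apply: nondecreasing_series => n _ _; exact: sqr_ge0.
  exists (2^-1 * \int[mu]_(x in I) (k x * k x)) => _ [n _ <-].
  by rewrite seriesEnat /= -(@ler_pM2l _ 2)// mulrA divff// mul1r H.
have c20 := cvg_series_cvg_0 cs.
apply/norm_cvg0P.
rewrite (_ : (fun n => _) = (fun n => Num.sqrt (c n ^+ 2))); last first.
  by apply/funext => n; rewrite sqrtr_sqr.
rewrite -[X in _ --> X]sqrtr0.
exact: (continuous_cvg _ (@sqrt_continuous R 0) c20).
Qed.

End bessel.

(** * The periodized Gaussian: boundedness, periodicity, Lipschitz continuity *)

Section theta.
Context {R : realType}.
Notation mu := (@lebesgue_measure R).
Notation I := ([set` `[0%R, 1%R]] : set R).
Variables (b : R) (b0 : 0 < b).

Definition etheta (b t : R) : \bar R := \esum_(n in [set: int]) (gauss1 b (t + n%:~R))%:E.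
Definition theta (b t : R) : R := fine (etheta b t).

Let EF_ge0 (b' t : R) (n : int) : (0 <= (gauss1 b' (t + n%:~R))%:E)%E.
Proof. by rewrite lee_fin gauss1_ge0. Qed.

Lemma etheta_ge0 (b' t : R) : (0 <= etheta b' t)%E.
Proof. by apply: esum_ge0 => n _; exact: EF_ge0. Qed.

Lemma gauss1_double z :
  gauss1 (2 * b) z = (Num.sqrt 2)^-1 * (Num.sqrt (b * pi))^-1 * expR (- (z ^+ 2 / (2 * b))).
Proof. by rewrite /gauss1 -mulrA [Num.sqrt (2 * _)]sqrtrM// invfM. Qed.

(* gauss1 b is dominated by its average over a unit interval at width 2b,
   and these averages sum to the total mass *)
Lemma etheta_le t : (etheta b t <= (Num.sqrt 2 * expR b^-1)%:E)%E.
Proof.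
pose K := Num.sqrt 2 * expR b^-1.
have b20 : 0 < 2 * b by rewrite mulr_gt0.
have K0 : 0 <= K by rewrite mulr_ge0 ?sqrtr_ge0 ?expR_ge0.
pose f x := (gauss1 (2 * b) (x - (- t)))%:E.
have mf : measurable_fun setT f.
  apply/measurable_EFinP; apply: (measurableT_comp (measurable_gauss1 _)).
  exact: measurable_funB.
have f0 x : (0 <= f x)%E by rewrite lee_fin gauss1_ge0.
rewrite -[leRHS]mule1 -(integral_gauss1 (- t) b20) (ge0_integral_unfold1 mf f0).
rewrite -/K -esumZl//; last by move=> n; apply: integral_ge0 => z _; rewrite mule_ge0// lee_fin.
apply: le_esum => n _.
apply: (@le_trans _ _ (K%:E * \int[mu]_(z in I) ((K^-1 * gauss1 b (t + n%:~R))%:E))%E).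
  have Kp : 0 < K by rewrite mulr_gt0 ?sqrtr_gt0 ?expR_gt0.
  rewrite EFin_Rintegral//; last first.
    by apply: bounded_measurable_integrable; exact: bounded_measurable_cst.
  by rewrite Rintegral01_cst -EFinM mulVKf// gt_eqF.
apply: lee_wpmul2l; first by rewrite lee_fin.
rewrite integral_mkcond epatch_indic; apply: ge0_le_integral => //.
- by move=> z _; rewrite mule_ge0// lee_fin// mulr_ge0 ?invr_ge0 ?gauss1_ge0.
- by apply: emeasurable_funM => //; apply/measurable_EFinP; exact: measurable_indic.
- apply: emeasurable_funM; last by apply/measurable_EFinP; exact: measurable_indic.
  apply: (measurableT_comp mf); exact: measurable_funD.
move=> z _; rewrite /= indicE; case: (boolP (z \in I)) => zI; last by rewrite !mule0.
rewrite !mule1 lee_fin /f opprK.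
rewrite ler_pdivrMl ?mulr_gt0 ?sqrtr_gt0 ?expR_gt0//; set y := t + n%:~R.
move: zI; rewrite inE /= in_itv/= => /andP[z0 z1].
have -> : n%:~R + z + t = y + z by rewrite /y; ring.
have s2 : 0 < Num.sqrt 2 :> R by rewrite sqrtr_gt0.
rewrite gauss1_double /gauss1 /K.
rewrite (_ : _ * (_ * expR _) = (Num.sqrt (b * pi))^-1 * (expR b^-1 * expR (- ((y + z) ^+ 2 / (2 * b))))); last first.
  by rewrite -!mulrA mulrCA mulVKf ?gt_eqF// mulrCA.
rewrite -expRD ler_wpM2l ?invr_ge0 ?sqrtr_ge0// ler_expR.
(* Since [z] lies in the unit interval, [(y + z)^2 <= 2 y^2 + 2 z^2 <= 2 y^2 + 2]; the last [2],
   divided by [2 b], is the origin of the factor [exp (1 / b)]. *)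
rewrite -subr_ge0 (_ : _ - _ = (2 + 2 * y ^+ 2 - (y + z) ^+ 2) / (2 * b)); last first.
  by field; rewrite gt_eqF.
rewrite divr_ge0// ?(ltW b20)//.
have := sqr_ge0 (y - z); nra.
Qed.

Lemma EFin_theta t : (theta b t)%:E = etheta b t.
Proof.
rewrite /theta fineK// ge0_fin_numE ?etheta_ge0//.
by apply: le_lt_trans (etheta_le t) _; rewrite ltry.
Qed.

Lemma theta_ge0 t : 0 <= theta b t.
Proof. by rewrite -lee_fin EFin_theta etheta_ge0. Qed.

Lemma theta_le t : theta b t <= Num.sqrt 2 * expR b^-1.
Proof. by rewrite -lee_fin EFin_theta etheta_le. Qed.

Lemma thetaD1 t : theta b (t + 1) = theta b t.
Proof.
rewrite /theta /etheta; congr fine.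
rewrite [RHS](reindex_esum setT setT (fun n : int => 1 + n)).
  by apply: eq_esum => n _; rewrite intrD addrA.
split.
- by [].
- by move=> x y _ _ /addrI.
by move=> x _; exists (x - 1) => //; rewrite addrCA subrr addr0.
Qed.

Lemma measurable_theta : measurable_fun [set: R] (theta b).
Proof.
apply: (measurableT_comp (fine_measurable _)) => //.
apply: measurable_esum => [n|n t]; last exact: EF_ge0.
apply/measurable_EFinP; apply: (measurableT_comp (measurable_gauss1 _)).
exact: measurable_funD.
Qed.

Lemma gauss_lipschitz x y :
  `|expR (- (x ^+ 2 / (2 * b))) - expR (- (y ^+ 2 / (2 * b)))| <= (1 + 2 * b) / b * `|x - y|.
Proof.
have b20 : 0 < 2 * b by rewrite mulr_gt0.
wlog xy : x y / y <= x.
  move=> H; have [/H//|/ltW/H] := leP y x.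
  by rewrite distrC (distrC y).
pose f z := expR (- (z ^+ 2 / (2 * b))).
have fD z : is_derive z (1 : R) f (- (z / b) * f z).
  rewrite /f; apply: is_derive_eq; rewrite /GRing.scale/=; field.
  by rewrite gt_eqF.
have cf : {within `[y, x], continuous f}.
  apply: continuous_subspaceT => z.
  by apply: differentiable_continuous; apply/derivable1_diffP; exact: ex_derive.
have [c _ E] := @MVT_segment _ f (fun z => - (z / b) * f z) _ _ xy (fun z _ => fD z) cf.
rewrite -/(f x) -/(f y) E normrM ler_wpM2r//.
rewrite normrM normrN normrM (gtr0_norm (expR_gt0 _)) normrV ?unitfE ?gt_eqF// (gtr0_norm b0).
rewrite mulrAC ler_pM2r ?invr_gt0// /f expRN ler_pdivrMr ?expR_gt0//.
(* By [1 + t <= exp t], bounding the derivative reduces to the polynomial inequality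
   [|c| <= (1 + 2 b) (1 + c^2 / (2 b))], which follows from [(|c| - 1)^2 >= 0]. *)
apply: (@le_trans _ _ ((1 + 2 * b) * (1 + c ^+ 2 / (2 * b)))); last first.
  by rewrite ler_wpM2l ?expR_ge1Dx// addr_ge0// ltW.
rewrite (_ : _ * _ = 1 + 2 * b + c ^+ 2 + c ^+ 2 / (2 * b)); last by field; rewrite gt_eqF.
have h1 : 0 <= c ^+ 2 / (2 * b) by rewrite divr_ge0 ?sqr_ge0// ltW.
rewrite -(real_normK (num_real c)) in h1 *; set z := `|c| in h1 *.
have := sqr_ge0 (z - 1); nra.
Qed.

Let L := Num.sqrt 2 * ((1 + 2 * b) / b).

(** With [f z = exp (- z^2 / (2 b))] the exponential in [gauss1 b] is [f z ^ 2], and in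
    [(f x - f y) (f x + f y)] the first factor is Lipschitz while the second keeps Gaussian decay,
    hence is summable over the lattice. The factor [sqrt 2] in [L] compensates the normalization of
    [gauss1 (2 * b)]. *)
Lemma gauss1_lipschitz x y :
  `|gauss1 b x - gauss1 b y| <= L * `|x - y| * (gauss1 (2 * b) x + gauss1 (2 * b) y).
Proof.
pose f z := expR (- (z ^+ 2 / (2 * b))).
have s2 : 0 < Num.sqrt 2 :> R by rewrite sqrtr_gt0.
have fE z : expR (- (z ^+ 2 / b)) = f z ^+ 2.
  by rewrite /f [RHS]expr2 -expRD; congr expR; field; rewrite gt_eqF.
rewrite !gauss1_double /gauss1 !fE -mulrBr subr_sqr -/(f x) -/(f y) -mulrDr normrM [`|(Num.sqrt _)^-1|]ger0_norm ?invr_ge0 ?sqrtr_ge0//.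
rewrite normrM [`|f x + f y|]ger0_norm ?addr_ge0 ?expR_ge0//.
rewrite /L [leRHS](_ : _ = (Num.sqrt (b * pi))^-1 * ((1 + 2 * b) / b * `|x - y| * (f x + f y))); last first.
  by field; rewrite !gt_eqF// sqrtr_gt0 mulr_gt0// pi_gt0.
rewrite ler_wpM2l ?invr_ge0 ?sqrtr_ge0// ler_wpM2r ?addr_ge0 ?expR_ge0//.
exact: gauss_lipschitz.
Qed.

End theta.

Section theta_lipschitz.
Context {R : realType}.
Notation mu := (@lebesgue_measure R).
Notation I := ([set` `[0%R, 1%R]] : set R).
Variables (b : R) (b0 : 0 < b).

(** Summing [gauss1_lipschitz] over the lattice leaves two periodized Gaussians of parameter [2 b],
    each at most [K] by [theta_le]. The inequality is proved one-sidedly, so that all sums keep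
    nonnegative terms. *)
Lemma theta_lipschitz : exists2 C : R, 0 <= C &
  forall x y, `|theta b x - theta b y| <= C * `|x - y|.
Proof.
have b20 : 0 < 2 * b by rewrite mulr_gt0.
pose L := Num.sqrt 2 * ((1 + 2 * b) / b).
pose K := Num.sqrt 2 * expR (2 * b)^-1.
have L0 : 0 <= L by rewrite mulr_ge0 ?sqrtr_ge0// divr_ge0 ?(ltW b0)// addr_ge0// ltW.
have K0 : 0 <= K by rewrite mulr_ge0 ?sqrtr_ge0 ?expR_ge0.
exists (L * (2 * K)); first by rewrite mulr_ge0// mulr_ge0.
suff H x y : theta b x <= theta b y + L * (2 * K) * `|x - y|.
  move=> x y; rewrite ler_norml; apply/andP; split.
    by have := H y x; rewrite distrC; lra.
  by have := H x y; lra.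
apply: (@le_trans _ _ (theta b y + L * `|x - y| * (theta (2 * b) x + theta (2 * b) y))); last first.
  rewrite lerD2l [leRHS]mulrAC; apply: ler_wpM2l; first exact: mulr_ge0.
  by have := theta_le b20 x; have := theta_le b20 y; rewrite -/K; lra.
rewrite -lee_fin EFinD EFinM EFinD !EFin_theta// -esumD; last 2 first.
- by move=> n _; rewrite lee_fin gauss1_ge0.
- by move=> n _; rewrite lee_fin gauss1_ge0.
rewrite -esumZl; last 2 first.
- by rewrite mulr_ge0.
- by move=> n; rewrite -EFinD lee_fin addr_ge0// gauss1_ge0.
rewrite -esumD; last 2 first.
- by move=> n _; rewrite lee_fin gauss1_ge0.
- by move=> n _; rewrite lee_fin mulr_ge0 ?addr_ge0 ?gauss1_ge0// mulr_ge0.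
apply: le_esum => n _; rewrite -EFinD lee_fin.
have := gauss1_lipschitz b0 (x + n%:~R) (y + n%:~R).
rewrite (_ : x + n%:~R - (y + n%:~R) = x - y); last by ring.
by rewrite ler_norml => /andP[_]; rewrite -/L; lra.
Qed.

End theta_lipschitz.

Lemma measurable_inv {R : realType} : measurable_fun [set: R] (fun x => x^-1).
Proof.
rewrite -(setUv [set 0 : R]); apply/measurable_funU => //; first exact: measurableC.
split; first exact: measurable_fun_set1.
apply: open_continuous_measurable_fun; first exact/closed_openC/closed_eq.
by move=> x; rewrite inE/= => /eqP x0; exact: inv_continuous.
Qed.

(** * Pointwise convergence of the Fourier series of the periodized Gaussian *)

Section poisson1.
Context {R : realType}.
Notation mu := (@lebesgue_measure R).
Notation I := ([set` `[0%R, 1%R]] : set R).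
Variables (b : R) (b0 : 0 < b).

Let w (k : nat) : R := expR (- (b * pi ^+ 2 * k%:R ^+ 2)).

Lemma cos_int_period (x : R) (k : nat) (n : int) : cos (x + 2 * pi * k%:R * n%:~R) = cos x.
Proof.
have P (y : R) (m : nat) : cos (y + 2 * pi * m%:R) = cos y.
  rewrite (_ : 2 * pi * m%:R = pi *+ 2 *+ m); last first.
    by rewrite -mulr_natr -[pi *+ 2]mulr_natr; ring.
  exact: (periodicn (@cosD2pi R)).
case: n => m.
  by rewrite -mulrA -natrM P.
have -> : 2 * pi * k%:R * (Negz m)%:~R = - (2 * pi * (k * m.+1)%:R) :> R.
  by rewrite NegzE mulrNz natrM -pmulrn; ring.
by rewrite -[RHS](P _ (k * m.+1)%N) -{2}(subrK (2 * pi * (k * m.+1)%:R) x) P.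
Qed.

(** Unfolding read backwards: the cosine has integer period, so the unit intervals reassemble into
    the line, where the Gaussian transform is known. The translation by [t] enters as a phase. *)
Let ft (k : nat) t :
  (\int[mu]_(u in I) (theta b (t + u) * (1 + cos (2 * pi * k%:R * u)))%:E =
   (1 + w k * cos (2 * pi * k%:R * t))%:E)%E.
Proof.
pose f x := (gauss1 b (x + t) * (1 + cos (2 * pi * k%:R * x)))%:E.
have cge x : 0 <= 1 + cos x :> R by rewrite -lerBlDl sub0r cos_geN1.
have mc (s : R) : measurable_fun setT (fun x : R => 1 + cos (s * x)).
  by apply: measurable_funD => //; exact: measurable_cosM.
have mg (s : R) : measurable_fun setT (fun x : R => gauss1 b (x + s)).
  by apply: (measurableT_comp (measurable_gauss1 _)); exact: measurable_funD.
have mf : measurable_fun setT f by apply/measurable_EFinP; exact: measurable_funM.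
have f0 x : (0 <= f x)%E by rewrite lee_fin mulr_ge0 ?gauss1_ge0.
transitivity (\int[mu]_x f x)%E.
  rewrite (ge0_integral_unfold1 mf f0) -ge0_integral_esum; last 2 first.
  - move=> n; apply: emeasurable_funM; last by apply/measurable_EFinP; exact: measurable_indic.
    by apply: (measurableT_comp mf); exact: measurable_funD.
  - by move=> n z; rewrite mule_ge0// lee_fin.
  rewrite [LHS]integral_mkcond epatch_indic; apply: eq_integral => u _.
  transitivity (((1 + cos (2 * pi * k%:R * u)) * \1_I u)%:E * etheta b (t + u))%E.
    by rewrite -EFin_theta// -!EFinM; congr EFin; ring.
  rewrite /etheta -esumZl//; last by move=> n; rewrite lee_fin gauss1_ge0.
  apply: eq_esum => n _; rewrite /f -!EFinM; congr EFin.
  have -> : 2 * pi * k%:R * (n%:~R + u) = 2 * pi * k%:R * u + 2 * pi * k%:R * n%:~R by ring.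
  rewrite cos_int_period (_ : n%:~R + u + t = t + u + n%:~R); last by ring.
  by ring.
have := @ge0_integral_affine _ 1 (- t) f ltr01 mf f0.
rewrite invr1 mul1e => <-.
rewrite -[X in X * cos _]/(expR (- (b * pi ^+ 2 * k%:R ^+ 2))) [X in 1 + X]mulrC -[X in X * expR _]cosN.
rewrite -integral_gauss1_cos//; apply: eq_integral => x _.
by rewrite /f mul1r addrNK; congr (_ * (1 + cos _))%:E; ring.
Qed.

Let btheta t : bounded_measurable (fun u => theta b (t + u)).
Proof.
split.
  by apply: (measurableT_comp (measurable_theta b)); exact: measurable_funD.
by exists (Num.sqrt 2 * expR b^-1) => u; rewrite ger0_norm ?theta_ge0// theta_le.
Qed.

Let bi := @bounded_measurable_integrable R.

Let fcos (k : nat) t :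
  \int[mu]_(u in I) (theta b (t + u) * (1 + cos (2 * pi * k%:R * u))) =
  1 + w k * cos (2 * pi * k%:R * t).
Proof. by rewrite /Rintegral ft. Qed.

Let f0 t : \int[mu]_(u in I) theta b (t + u) = 1.
Proof.
have := fcos 0 t; rewrite /w mulr0 !mul0r cos0 expr0n/= mulr0 oppr0 expR0 mulr1.
under eq_Rintegral do rewrite mul0r cos0 mulrC.
rewrite RintegralZl//; last exact: bi.
by move=> H; lra.
Qed.

Let fk (k : nat) t :
  \int[mu]_(u in I) (theta b (t + u) * cos (2 * pi * k%:R * u)) = w k * cos (2 * pi * k%:R * t).
Proof.
have := fcos k t; under eq_Rintegral do rewrite mulrDr mulr1.
rewrite RintegralD//; last 2 first.
- exact: bi.
- apply/bi/bounded_measurableM => //; exact: bounded_measurable_cos.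
by rewrite f0 => /addrI.
Qed.

(** The Dirichlet kernel, with opposite frequencies merged into cosines; [D_sin] is its closed form
    cleared of the denominator [sin (pi * u)]. *)
Let D (N : nat) (u : R) := 1 + \sum_(0 <= k < N) 2 * cos (2 * pi * k.+1%:R * u).

Let bD N : bounded_measurable (D N).
Proof.
apply: bounded_measurableD; first exact: bounded_measurable_cst.
apply: bounded_measurable_sum => k; apply: bounded_measurableM; first exact: bounded_measurable_cst.
exact: bounded_measurable_cos.
Qed.

Let D_sin N u : sin (pi * u) * D N u = sin ((2 * N%:R + 1) * pi * u).
Proof.
rewrite /D; elim: N => [|N IH].
  by rewrite big_nil addr0 mulr1 mulr0 add0r mul1r.
rewrite big_nat_recr//= addrA mulrDr IH.
have -> : (2 * N%:R + 1) * pi * u = 2 * pi * N.+1%:R * u - pi * u.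
  by rewrite -natr1; ring.
have -> : (2 * N.+1%:R + 1) * pi * u = 2 * pi * N.+1%:R * u + pi * u by ring.
by rewrite sinB sinD; ring.
Qed.

Definition theta_partial (N : nat) (t : R) :=
  1 + \sum_(0 <= k < N) 2 * (expR (- (b * pi ^+ 2 * k.+1%:R ^+ 2)) * cos (2 * pi * k.+1%:R * t)).

Let sumD (g : R -> R) N : bounded_measurable g ->
  \int[mu]_(u in I) (g u * D N u) =
  \int[mu]_(u in I) g u + \sum_(0 <= k < N) 2 * \int[mu]_(u in I) (g u * cos (2 * pi * k.+1%:R * u)).
Proof.
move=> bg.
have bgc k : bounded_measurable (fun u => g u * cos (2 * pi * k.+1%:R * u)).
  by apply: bounded_measurableM => //; exact: bounded_measurable_cos.
have b2gc k : bounded_measurable (fun u => 2 * (g u * cos (2 * pi * k.+1%:R * u))).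
  by apply: bounded_measurableM => //; exact: bounded_measurable_cst.
transitivity (\int[mu]_(u in I) (g u + \sum_(0 <= k < N) 2 * (g u * cos (2 * pi * k.+1%:R * u)))).
  apply: eq_Rintegral => u _; rewrite /D mulrDr mulr1; congr (_ + _).
  by rewrite mulr_sumr; apply: eq_bigr => k _; rewrite mulrCA.
rewrite RintegralD//; [|exact: bi|by apply/bi/bounded_measurable_sum].
rewrite Rintegral01_sum//; congr (_ + _); apply: eq_bigr => k _.
by rewrite RintegralZl//; exact: bi.
Qed.

(** The kernel [D N] has integral [1] over the unit interval, so the constant [theta b t] can be
    brought under the integral sign. *)
Let partialE N t : theta_partial N t - theta b t =
  \int[mu]_(u in I) ((theta b (t + u) - theta b t) * D N u).
Proof.
have bth : bounded_measurable (cst (theta b t)) by exact: bounded_measurable_cst.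
under eq_Rintegral do rewrite mulrBl.
rewrite RintegralB//; last 2 first.
- by apply/bi/bounded_measurableM.
- by apply/bi/(bounded_measurableM bth).
rewrite sumD// (sumD N bth) f0 Rintegral01_cst; congr (_ - _).
  by congr (_ + _); apply: eq_bigr => k _; rewrite fk.
rewrite big1 ?addr0// => k _.
by rewrite RintegralZl ?Rintegral01_cos ?mulr0//; apply: bi; exact: bounded_measurable_cos.
Qed.

(** With [y = pi u / 2], at most [pi / 4], one has [sin (2 y) = 2 sin y cos y >= 2 y cos^2 y >= y];
    the mean value theorem gives [y cos y <= sin y], and [cos (2 y) >= 0] gives [2 cos^2 y >= 1]. *)
Let sin_lb (u : R) : 0 <= u <= 2^-1 -> pi / 2 * u <= sin (pi * u).
Proof.
move=> /andP[u0 u2]; set y := pi * u / 2.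
have p0 := @pi_gt0 R.
have y0 : 0 <= y by rewrite /y divr_ge0// mulr_ge0// ltW.
have yp : y <= pi / 2 / 2 by rewrite /y ler_pM2r// ler_pM2l.
have -> : sin (pi * u) = 2 * (sin y * cos y).
  rewrite (_ : pi * u = y + y); last by rewrite /y; field.
  by rewrite sinD; ring.
have c2 : 1 <= 2 * cos y ^+ 2.
  have : 0 <= cos (y + y).
    by apply: cos_ge0_pihalf; lra.
  rewrite cosD; have := cos2Dsin2 y; lra.
have cy : 0 <= cos y by apply: cos_ge0_pihalf; lra.
have sy : y * cos y <= sin y.
  have cs : {within `[0, y], continuous (@sin R)} by exact/continuous_subspaceT/continuous_sin.
  have [c /andP[c0 cy'] E] := @MVT_segment _ sin cos 0 y y0 (fun z _ => is_derive_sin z) cs.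
  move: E; rewrite sin0 !subr0 => ->; rewrite mulrC ler_wpM2r//.
  move: c0 cy'; rewrite !bnd_simp => c0 cy'.
  have [->//|nc] := eqVneq c y.
  by rewrite ltW// ltr_cos ?in_itv/=; lra.
have -> : pi / 2 * u = y by rewrite /y; ring.
by nra.
Qed.

(** Dini's argument: the Lipschitz bound makes the quotient [k] of [theta b (t + u) - theta b t] by
    [sin (pi * u)] bounded, and the error of the partial sum is the integral of [k] against an odd
    sine, which tends to [0]. *)
Lemma cvg_theta_partial t : theta_partial ^~ t @ \oo --> theta b t.
Proof.
have [C C0 LC] := theta_lipschitz b0.
pose k u := (theta b (t + u) - theta b t) / sin (pi * u) * \1_I u.
have p0 := @pi_gt0 R.
have kb u : `|k u| <= C * 2 / pi.
  have B0 : 0 <= C * 2 / pi by rewrite divr_ge0 ?mulr_ge0// ltW.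
  rewrite /k indicE; case: (boolP (u \in I)) => [|_]; last by rewrite mulr0 normr0.
  rewrite inE/= in_itv/= mulr1 => /andP[u0 u1].
  (* [v] stands for the distance from [u] to the nearer endpoint of the unit interval, the endpoints
     being the zeros of [sin (pi * u)]: it is [u] or [1 - u], and periodicity of [theta b] serves
     the second case. *)
  have key (v : R) : 0 <= v <= 2^-1 -> sin (pi * u) = sin (pi * v) ->
      `|theta b (t + u) - theta b t| <= C * v ->
      `|(theta b (t + u) - theta b t) / sin (pi * u)| <= C * 2 / pi.
    move=> v01 -> H; have [v0|vn0] := eqVneq v 0.
      by rewrite v0 mulr0 sin0 invr0 mulr0 normr0.
    have vp : 0 < v by rewrite lt_neqAle eq_sym vn0; case/andP: v01.
    have sl := sin_lb v01.
    have sp : 0 < sin (pi * v) by apply: lt_le_trans sl; rewrite !mulr_gt0.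
    rewrite normrM normfV (gtr0_norm sp) ler_pdivrMr//.
    apply: le_trans H _; apply: (@le_trans _ _ (C * 2 / pi * (pi / 2 * v))).
      rewrite (_ : C * 2 / pi * (pi / 2 * v) = C * v)//.
      by move: (pi : R) p0 => q q0; field; rewrite gt_eqF.
    by rewrite ler_wpM2l.
  have [ul|ug] := leP u 2^-1.
    apply: (key u) => //; first by rewrite u0.
    by apply: le_trans (LC _ _) _; rewrite addrAC subrr add0r ger0_norm.
  apply: (key (1 - u)); first by lra.
    rewrite mulrBr mulr1 -[pi - _]opprB sinN -[pi * u in LHS](subrK pi) sinDpi.
    by [].
  rewrite -(thetaD1 b t); apply: le_trans (LC _ _) _.
  rewrite (_ : t + u - (t + 1) = - (1 - u)); last by ring.
  by rewrite normrN ger0_norm// subr_ge0.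
have bk : bounded_measurable k.
  split; last by exists (C * 2 / pi).
  apply: measurable_funM; last exact: measurable_indic.
  apply: measurable_funM.
    by apply: measurable_funB => //; exact: (btheta t).1.
  apply: (measurableT_comp measurable_inv); exact: measurable_sinM.
apply/subr_cvg0.
rewrite (_ : (fun N => _) = (fun n : nat => \int[mu]_(x in I) (k x * sin ((2 * n%:R + 1) * pi * x)))).
  exact: riemann_lebesgue_odd_sin.
apply/funext => N; rewrite partialE; apply: eq_Rintegral => u uI.
rewrite -D_sin /k indicE uI mulr1 mulrA -[_ / _ * _]mulrA.
(* Where the sine vanishes the quotient is [0] by the convention on division. The integrands still
   agree there: [u] is [0] or [1], and [theta b] has period [1]. *)
have [s0|s0] := eqVneq (sin (pi * u)) 0; last by rewrite mulVf// mulr1.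
rewrite s0 !mulr0 mul0r; suff -> : theta b (t + u) = theta b t by rewrite subrr mul0r.
move: uI; rewrite inE/= in_itv/= => /andP[u0 u1].
have [->|un0] := eqVneq u 0; first by rewrite addr0.
have [->|un1] := eqVneq u 1; first by rewrite thetaD1.
have : 0 < sin (pi * u).
  have up : 0 < u by rewrite lt_neqAle eq_sym un0 u0.
  have ul : u < 1 by rewrite lt_neqAle un1 u1.
  by apply: sin_gt0_pi; rewrite mulr_gt0//= gtr_pMr.
by rewrite s0 ltxx.
Qed.

(** The terms are nonnegative, so the sum may be taken along symmetric blocks of frequencies.
    Pairing [m] with [- m] by [cos (c + x) + cos (c - x) = 2 cos c cos x] gives the Fourier partial
    sums at [0] and at [t]. *)
Lemma poisson1 c t :
  (\esum_(m in [set: int])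
     (expR (- (b * pi ^+ 2 * m%:~R ^+ 2)) * (1 + cos (c + 2 * pi * (m%:~R * t))))%:E =
   (theta b 0 + cos c * theta b t)%:E)%E.
Proof.
pose a (m : int) : R := expR (- (b * pi ^+ 2 * m%:~R ^+ 2)) * (1 + cos (c + 2 * pi * (m%:~R * t))).
have a0 m : (0 <= (a m)%:E)%E by rewrite lee_fin mulr_ge0 ?expR_ge0// -lerBlDl sub0r cos_geN1.
rewrite (esum_int a0).
(* [Negz n] is [- n.+1], so taking one more nonnegative index than negative ones gives exactly the
   frequencies of absolute value at most [N]. *)
pose S N := (\sum_(0 <= n < N.+1) (a (Posz n))%:E + \sum_(0 <= n < N) (a (Negz n))%:E)%E.
have E N : S N = (theta_partial N 0 + cos c * theta_partial N t)%:E.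
  rewrite /S big_nat_recl// -addeA -big_split/= /theta_partial.
  under eq_bigr do rewrite -EFinD.
  rewrite sumEFin -EFinD; congr EFin.
  rewrite [cos c * (1 + _)]mulrDr mulr1 addrACA mulr_sumr -big_split/=; congr (_ + _).
    by rewrite /a mul0r mulr0 addr0 expr0n/= mulr0 oppr0 expR0 mul1r.
  apply: eq_bigr => n _.
  rewrite /a NegzE mulrNz sqrrN -!pmulrn mulr0 cos0 mulNr mulrN -mulrDr mulr1.
  rewrite [cos (c + _)]cosD cosB.
  by rewrite (_ : 2 * pi * (n.+1%:R * t) = 2 * pi * n.+1%:R * t); ring.
have cvS : S @ \oo --> (\sum_(n <oo) (a (Posz n))%:E + \sum_(n <oo) (a (Negz n))%:E)%E.
  apply: cvgeD.
  - by apply: ge0_adde_def; rewrite inE; apply: nneseries_ge0.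
  - rewrite (cvg_shiftS (fun N => \sum_(0 <= n < N) (a (Posz n))%:E)%E).
    exact: is_cvg_nneseries.
  - exact: is_cvg_nneseries.
apply/esym; apply: cvg_unique cvS => //.
rewrite (_ : S = fun N => (theta_partial N 0 + cos c * theta_partial N t)%:E); last by apply/funext.
apply: cvg_EFin; first exact: nearW.
apply: cvgD; first exact: cvg_theta_partial.
by apply: cvgMr; exact: cvg_theta_partial.
Qed.

End poisson1.

(** * From one coordinate to R^d and Z^d *)

Section cosine_transform_tuple.
Context {R : realType}.
Notation mu := (@lebesgue_measure R).
Notation lebT := (@lebesgue_tuple R).

Let cge x : 0 <= 1 + cos x :> R.
Proof. by rewrite -lerBlDl sub0r cos_geN1. Qed.

Lemma tdot_tcons d (x : R) (y t' : d.-tuple R) (t : R) :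
  tdot (tcons (x, y)) (tcons (t, t')) = x * t + tdot y t'.
Proof.
rewrite /tdot big_ord_recl !tnth_tcons0; congr (_ + _).
by apply: eq_bigr => i _; rewrite !tnth_tconsS.
Qed.

Lemma tuple_tcons d (t : d.+1.-tuple R) : t = tcons (thead t, [tuple of behead t]).
Proof. by rewrite [LHS]tuple_eta; apply: val_inj. Qed.

Lemma tint_zcons d (n : int) (m : d.-tuple int) : tint (zcons (n, m)) = tcons (n%:~R, tint m) :> d.+1.-tuple R.
Proof.
apply: eq_from_tnth => i; rewrite !tnth_mktuple.
case: (unliftP ord0 i) => [j|] ->; last by rewrite tnth_zcons0 tnth_tcons0.
by rewrite tnth_zconsS tnth_tconsS tnth_mktuple.
Qed.

Variables (B : R -> R) (B0 : forall t, 0 <= B t).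

(** Drives both inductions on the dimension. The inner coordinates leave [A + cos (c + x) * P],
    which is rewritten as a combination of two one-dimensional integrands with coefficients [A - P]
    and [P], nonnegative by [B_le]. Phase [pi / 2] at frequency [0] kills the cosine, so the total
    mass comes from the same hypothesis as the transform. *)
Let step (A P w x c : R) : w * (A + cos (c + x) * P) = (A - P) * (w * (1 + cos (pi / 2 + 0)))
  + P * (w * (1 + cos (c + x))).
Proof. by rewrite addr0 cos_pihalf; ring. Qed.

Section sum.
Variables (w : int -> R) (w0 : forall m, 0 <= w m).
Hypothesis Bw : forall c t, (\esum_(m in [set: int])
     (w m * (1 + cos (c + 2 * pi * (m%:~R * t))))%:E = (B 0 + cos c * B t)%:E)%E.

(** The phase [pi] expresses [B 0 - B t] as a sum of nonnegative terms. *)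
Let B_le t : B t <= B 0.
Proof.
rewrite -subr_ge0; have := Bw pi t; rewrite cospi mulN1r => H.
by rewrite -lee_fin -H esum_ge0// => m _; rewrite lee_fin mulr_ge0.
Qed.

Lemma esum_tuple_cos d c (t : d.-tuple R) :
  (\esum_(m in [set: d.-tuple int])
    ((\prod_(i < d) w (tnth m i)) * (1 + cos (c + 2 * pi * tdot (tint m) t)))%:E =
   (B 0 ^+ d + cos c * \prod_(i < d) B (tnth t i))%:E)%E.
Proof.
elim: d c t => [|d IH] c t.
  rewrite esum_tuple0; last by move=> m; rewrite lee_fin mulr_ge0 ?prodr_ge0.
  by rewrite !big_ord0 /tdot big_ord0 expr0 mul1r mulr0 addr0 mulr1.
rewrite esum_tuple_cons; last by move=> m; rewrite lee_fin mulr_ge0 ?prodr_ge0.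
rewrite (tuple_tcons t); set t0 := thead t; set t' := [tuple of behead t].
pose P := \prod_(i < d) B (tnth t' i).
have P0 : 0 <= P by rewrite prodr_ge0.
have PB : 0 <= B 0 ^+ d - P.
  rewrite subr_ge0 -[X in _ ^+ X]card_ord -prodr_const; apply: ler_prod => i _.
  by rewrite B0 B_le.
transitivity (\esum_(x in [set: int])
   ((B 0 ^+ d - P)%:E * (w x * (1 + cos (pi / 2 + 2 * pi * (x%:~R * 0))))%:E +
   P%:E * (w x * (1 + cos (c + 2 * pi * (x%:~R * t0))))%:E))%E.
  apply: eq_esum => x _; rewrite -!EFinM -EFinD !mulr0 -step EFinM -(IH _ t').
  rewrite -esumZl//; last by move=> m; rewrite lee_fin mulr_ge0 ?prodr_ge0.
  apply: eq_esum => m _; rewrite tint_zcons tdot_tcons big_ord_recl tnth_zcons0.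
  under eq_bigr do rewrite tnth_zconsS.
  have -> : c + 2 * pi * (x%:~R * t0 + tdot (tint m) t') = c + 2 * pi * (x%:~R * t0) + 2 * pi * tdot (tint m) t' by ring.
  by rewrite -EFinM -(mulrA (w x)).
rewrite esumD; last 2 first.
- by move=> x _; rewrite -EFinM lee_fin !mulr_ge0.
- by move=> x _; rewrite -EFinM lee_fin !mulr_ge0.
rewrite !esumZl//; last 2 first.
- by move=> x; rewrite lee_fin mulr_ge0.
- by move=> x; rewrite lee_fin mulr_ge0.
rewrite !Bw -!EFinM -EFinD; congr EFin.
rewrite big_ord_recl tnth_tcons0; under eq_bigr do rewrite tnth_tconsS.
by rewrite -/P cos_pihalf exprS; ring.
Qed.

End sum.

Section integral.
Variables (w : R -> R) (w0 : forall m, 0 <= w m) (mw : measurable_fun setT w).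
Hypothesis Bw : forall c t, (\int[mu]_x
     (w x * (1 + cos (c + 2 * pi * (x * t))))%:E = (B 0 + cos c * B t)%:E)%E.

Let B_le t : B t <= B 0.
Proof.
rewrite -subr_ge0; have := Bw pi t; rewrite cospi mulN1r => H.
by rewrite -lee_fin -H integral_ge0// => m _; rewrite lee_fin mulr_ge0.
Qed.

Let mcos d (T : measurableType d) (f : T -> R) c : measurable_fun setT f ->
  measurable_fun setT (fun x => 1 + cos (c + 2 * pi * f x)).
Proof.
move=> mf; apply: measurable_funD => //; apply: measurableT_comp.
  by apply: continuous_measurable_fun => x; exact: continuous_cos.
by apply: measurable_funD => //; exact: measurable_funM.
Qed.

Let mP d c (t : d.-tuple R) : measurable_fun setT (fun x : d.-tuple R =>
  ((\prod_(i < d) w (tnth x i)) * (1 + cos (c + 2 * pi * tdot x t)))%:E).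
Proof.
apply/measurable_EFinP; apply: measurable_funM.
  exact: (@measurable_tuple_prod _ _ (fun=> w)).
by apply: mcos; exact: measurable_tdot.
Qed.

Let mW c t : measurable_fun setT (fun x : R => (w x * (1 + cos (c + 2 * pi * (x * t))))%:E).
Proof.
apply/measurable_EFinP; apply: measurable_funM => //.
by apply: mcos; exact: measurable_funM.
Qed.

Lemma integral_tuple_cos d c (t : d.-tuple R) :
  (\int[lebT d]_x
    ((\prod_(i < d) w (tnth x i)) * (1 + cos (c + 2 * pi * tdot x t)))%:E =
   (B 0 ^+ d + cos c * \prod_(i < d) B (tnth t i))%:E)%E.
Proof.
elim: d c t => [|d IH] c t.
  by rewrite integral_tuple0// !big_ord0 /tdot big_ord0 expr0 mul1r mulr0 addr0 mulr1.
rewrite ge0_integral_tcons//; last by move=> m; rewrite lee_fin mulr_ge0 ?prodr_ge0.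
rewrite (tuple_tcons t); set t0 := thead t; set t' := [tuple of behead t].
pose P := \prod_(i < d) B (tnth t' i).
have P0 : 0 <= P by rewrite prodr_ge0.
have PB : 0 <= B 0 ^+ d - P.
  rewrite subr_ge0 -[X in _ ^+ X]card_ord -prodr_const; apply: ler_prod => i _.
  by rewrite B0 B_le.
transitivity (\int[mu]_x
   ((B 0 ^+ d - P)%:E * (w x * (1 + cos (pi / 2 + 2 * pi * (x * 0))))%:E +
   P%:E * (w x * (1 + cos (c + 2 * pi * (x * t0))))%:E))%E.
  apply: eq_integral => x _; rewrite -!EFinM -EFinD !mulr0 -step EFinM -(IH _ t').
  have wx0 : (0 <= (w x)%:E)%E by rewrite lee_fin.
  rewrite -ge0_integralZl//; last 2 first.
  - exact: mP.
  - by move=> m _; rewrite lee_fin mulr_ge0 ?prodr_ge0.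
  apply: eq_integral => m _; rewrite tdot_tcons big_ord_recl tnth_tcons0.
  under eq_bigr do rewrite tnth_tconsS.
  have -> : c + 2 * pi * (x * t0 + tdot m t') = c + 2 * pi * (x * t0) + 2 * pi * tdot m t' by ring.
  by rewrite -EFinM -(mulrA (w x)).
rewrite ge0_integralD//; last 4 first.
- by move=> x _; rewrite -EFinM lee_fin !mulr_ge0.
- by apply: measurable_funeM; exact: mW.
- by move=> x _; rewrite -EFinM lee_fin !mulr_ge0.
- by apply: measurable_funeM; exact: mW.
rewrite !ge0_integralZl//; last 4 first.
- exact: mW.
- by move=> x _; rewrite lee_fin mulr_ge0.
- exact: mW.
- by move=> x _; rewrite lee_fin mulr_ge0.
rewrite !Bw -!EFinM -EFinD; congr EFin.
rewrite big_ord_recl tnth_tcons0; under eq_bigr do rewrite tnth_tconsS.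
by rewrite -/P cos_pihalf exprS; ring.
Qed.

End integral.

End cosine_transform_tuple.

Section gauss_density_theory.
Context {R : realType} {d : nat}.
Notation mu := (@lebesgue_measure R).
Notation lebT := (@lebesgue_tuple R).
Implicit Types t : d.-tuple R.

Lemma tnorm_sqr t : tnorm t ^+ 2 = \sum_(i < d) tnth t i ^+ 2.
Proof.
rewrite sqr_sqrtr; first by apply: eq_bigr => i _; rewrite expr2.
by apply: sumr_ge0 => i _; rewrite -expr2 sqr_ge0.
Qed.

Lemma expR_tnorm (k : R) t :
  expR (- (k * tnorm t ^+ 2)) = \prod_(i < d) expR (- (k * tnth t i ^+ 2)).
Proof. by rewrite tnorm_sqr mulr_sumr -sumrN expR_sum. Qed.

Lemma gauss_densityE (a : R) t : 0 < a -> gauss_density a t = \prod_(i < d) gauss1 a (tnth t i).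
Proof.
move=> a0; have ap : 0 < a * pi by rewrite mulr_gt0// pi_gt0.
rewrite /gauss_density /gauss1 big_split/= prodr_const card_ord [tnorm t ^+ 2 / a]mulrC expR_tnorm.
congr (_ * _); last by apply: eq_bigr => i _; rewrite mulrC.
rewrite (_ : - (d%:R / 2) = - 2^-1 * d%:R :> R); last by ring.
by rewrite powRrM powR_mulrn ?powR_ge0// powRN powR12_sqrt// ltW.
Qed.

Lemma gauss_density_ge0 (a : R) t : 0 <= gauss_density a t.
Proof. by rewrite mulr_ge0 ?powR_ge0 ?expR_ge0. Qed.

Definition theta_tuple (b : R) t : R := \prod_(i < d) theta b (tnth t i).

Lemma esum_gauss_density (b : R) t : 0 < b ->
  (\esum_(n in [set: d.-tuple int]) (gauss_density b (tadd t (tint n)))%:E = (theta_tuple b t)%:E)%E.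
Proof.
move=> b0; under eq_esum do rewrite gauss_densityE//.
rewrite -(@esum_tuple_prod _ _ _ (fun i n => gauss1 b (tnth t i + n%:~R))).
- by apply: eq_esum => n _; congr EFin; apply: eq_bigr => i _; rewrite !tnth_mktuple.
- by move=> i n; exact: gauss1_ge0.
- by move=> i; rewrite EFin_theta.
Qed.

Lemma poisson_tuple (b c : R) t : 0 < b ->
  (\esum_(m in [set: d.-tuple int])
     (expR (- (b * pi ^+ 2 * tnorm (tint m) ^+ 2)) * (1 + cos (c + 2 * pi * tdot (tint m) t)))%:E =
   (theta b 0 ^+ d + cos c * theta_tuple b t)%:E)%E.
Proof.
move=> b0.
rewrite -(@esum_tuple_cos _ (theta b) (theta_ge0 b0) (fun m => expR (- (b * pi ^+ 2 * m%:~R ^+ 2)))).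
- apply: eq_esum => m _; rewrite expR_tnorm; congr (_ * _)%:E.
  by apply: eq_bigr => i _; rewrite tnth_mktuple.
- by move=> m; exact: expR_ge0.
- by move=> c' t'; exact: poisson1.
Qed.

Lemma gauss_fourier_tuple (b c : R) t : 0 < b ->
  (\int[lebT d]_l
     (expR (- (b * pi ^+ 2 * tnorm l ^+ 2)) * (1 + cos (c + 2 * pi * tdot l t)))%:E =
   (gauss1 b 0 ^+ d + cos c * gauss_density b t)%:E)%E.
Proof.
move=> b0; rewrite gauss_densityE//.
rewrite -(@integral_tuple_cos _ (gauss1 b) (gauss1_ge0 b) (fun x => expR (- (b * pi ^+ 2 * x ^+ 2)))).
- by apply: eq_integral => m _; rewrite expR_tnorm.
- by move=> m; exact: expR_ge0.
- apply: measurableT_comp => //; apply: measurableT_comp => //; by apply: measurable_funM.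
(* The weight [exp (- b pi^2 x^2)] is [1 / sqrt (b * pi)] times the Gaussian density of parameter
   [al], and the transform of that density at [t'] has exponent [- t'^2 / b]. *)
move=> c' t'; pose al := (b * pi ^+ 2)^-1.
have p0 := @pi_gt0 R.
have al0 : 0 < al by rewrite invr_gt0 mulr_gt0// exprn_gt0.
have sp : 0 < Num.sqrt (al * pi) by rewrite sqrtr_gt0 mulr_gt0.
have sE : Num.sqrt (al * pi) = (Num.sqrt (b * pi))^-1.
  rewrite -sqrtrV ?mulr_ge0 ?ltW//; congr Num.sqrt; rewrite /al.
  by move: (pi : R) p0 => q q0; field; rewrite !gt_eqF.
transitivity (\int[mu]_x ((Num.sqrt (b * pi))^-1%:E * (gauss1 al x * (1 + cos (c' + 2 * pi * (x * t'))))%:E))%E.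
  apply: eq_integral => x _; rewrite -EFinM [in RHS](mulrA (Num.sqrt (b * pi))^-1); congr (_ * _)%:E.
  by rewrite /gauss1 -sE mulrA mulfV ?gt_eqF// mul1r /al invrK mulrC.
rewrite ge0_integralZl//; last 2 first.
- apply/measurable_EFinP; apply: measurable_funM; first exact: measurable_gauss1.
  apply: measurable_funD => //; apply: measurableT_comp.
    by apply: continuous_measurable_fun => x; exact: continuous_cos.
  by apply: measurable_funD => //; apply: measurable_funM => //; exact: measurable_funM.
- by move=> x _; rewrite lee_fin mulr_ge0 ?gauss1_ge0// -lerBlDl sub0r cos_geN1.
rewrite integral_gauss1_cos// -EFinM; congr EFin.
rewrite mulrDr mulr1 /gauss1 expr0n/= mul0r oppr0 expR0 mulr1; congr (_ + _).
rewrite mulrCA; congr (_ * (_ * expR (- _))).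
by rewrite /al; move: (pi : R) p0 => q q0; field; rewrite !gt_eqF.
Qed.

End gauss_density_theory.

(** * The power spectrum as a quadratic form *)

Section sigma_finite_product.
Context {d1 d2} {T1 : measurableType d1} {T2 : measurableType d2} {R : realType}.
Variables (m1 : {sigma_finite_measure set T1 -> \bar R}) (m2 : {sigma_finite_measure set T2 -> \bar R}).

(** A named copy of the product measure that carries sigma-finiteness, so that it can itself be a
    factor when Tonelli's theorem is applied to three variables. *)
Definition prodm : set (T1 * T2) -> \bar R := (m1 \x m2)%E.

HB.instance Definition _ := Measure.copy prodm (m1 \x m2)%E.

Let prodm_sigma_finite : sigma_finite setT prodm.
Proof.
have /sigma_finiteP[F [TF ndF Foo]] := sigma_finiteT m1.
have /sigma_finiteP[G [TG ndG Goo]] := sigma_finiteT m2.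
exists (fun n => F n `*` G n) => [|k].
  apply/seteqP; split => // -[x y] _.
  have [n _ Fn] : (\bigcup_k F k) x by rewrite -TF.
  have [k _ Gk] : (\bigcup_k G k) y by rewrite -TG.
  exists (maxn n k) => //; split.
  - by move: Fn; exact/subsetPset/ndF/leq_maxl.
  - by move: Gk; exact/subsetPset/ndG/leq_maxr.
have [mF Fk] := Foo k; have [mG Gk] := Goo k; split; first exact: measurableX.
by rewrite /prodm product_measure1E// lte_mul_pinfty// ge0_fin_numE.
Qed.

HB.instance Definition _ := Measure_isSigmaFinite.Build _ _ _ prodm prodm_sigma_finite.

Lemma ge0_integral_prodm (f : T1 * T2 -> \bar R) : measurable_fun setT f -> (forall z, 0 <= f z)%E ->
  (\int[prodm]_z f z = \int[m1]_x \int[m2]_y f (x, y))%E.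
Proof. by move=> mf f0; rewrite /prodm fubini_tonelli1. Qed.

End sigma_finite_product.

Definition tsub {R : realType} {d} (x y : d.-tuple R) : d.-tuple R := tadd x (tscale (-1) y).

Lemma measurable_tsub {R : realType} d d' (T : measurableType d') (f g : T -> d.-tuple R) :
  measurable_fun setT f -> measurable_fun setT g -> measurable_fun setT (fun x => tsub (f x) (g x)).
Proof. by move=> mf mg; apply: measurable_tadd => //; exact: measurable_tscale. Qed.

Lemma tdot_tsub {R : realType} d (l x y : d.-tuple R) : tdot l (tsub x y) = tdot x l - tdot y l.
Proof.
rewrite /tdot -sumrB; apply: eq_bigr => i _; rewrite !tnth_mktuple; ring.
Qed.

Section product_integrals.
Context {R : realType} d1 d2 (T1 : measurableType d1) (T2 : measurableType d2).
Variables (m1 : {sigma_finite_measure set T1 -> \bar R}) (m2 : {sigma_finite_measure set T2 -> \bar R}).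
Variables (f : T1 -> R) (g : T2 -> R).
Hypotheses (fi : m1.-integrable setT (EFin \o f)) (gi : m2.-integrable setT (EFin \o g)).

Lemma measurable_prodfun : measurable_fun setT (fun z : T1 * T2 => f z.1 * g z.2).
Proof.
apply: measurable_funM; apply: measurableT_comp => //.
  by apply/measurable_EFinP; exact: measurable_int fi.
by apply/measurable_EFinP; exact: measurable_int gi.
Qed.

Lemma integrable_prodfun : (prodm m1 m2).-integrable setT (fun z => (f z.1 * g z.2)%:E).
Proof.
have mf := measurable_int m1 fi; have mg := measurable_int m2 gi.
apply/integrable12ltyP; first by apply/measurable_EFinP; exact: measurable_prodfun.
have -> : (\int[m1]_x \int[m2]_y `|(f (x, y).1 * g (x, y).2)%:E| =
    \int[m2]_y `|(g y)%:E| * \int[m1]_x `|(f x)%:E|)%E.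
  rewrite -ge0_integralZl//; last 2 first.
  - by apply: measurableT_comp => //; exact: mf.
  - by apply: integral_ge0.
  have mga : measurable_fun setT (fun y => `|(g y)%:E|%E) by apply: measurableT_comp => //; exact: mg.
  apply: eq_integral => x _ /=; rewrite muleC -ge0_integralZl ?abse_ge0//.
  by apply: eq_integral => y _; rewrite /= normrM EFinM.
have [_ foo] := integrableP _ _ _ fi; have [_ goo] := integrableP _ _ _ gi.
by apply: lte_mul_pinfty; [exact: integral_ge0|rewrite ge0_fin_numE//; exact: integral_ge0|].
Qed.

Lemma Rintegral_prodfun :
  \int[prodm m1 m2]_z (f z.1 * g z.2) = \int[m1]_x f x * \int[m2]_y g y.
Proof.
rewrite /Rintegral -integral12_prod_meas1; last exact: integrable_prodfun.
rewrite /fubini_F /=.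
under eq_integral => x _.
  under eq_integral do rewrite EFinM.
  rewrite integralZl// EFin_Rintegral// muleC.
  over.
by rewrite integralZl// EFin_Rintegral// -EFinM/= mulrC.
Qed.

End product_integrals.

Section bilinear_form.
Context {R : realType} {d : nat}.
Notation lebT := (@lebesgue_tuple R d).
Notation leb2 := (prodm lebT lebT).

Definition bilin (F G K : d.-tuple R -> R) : R := \int[leb2]_z (F z.1 * G z.2 * K (tsub z.1 z.2)).

Lemma integrable_bilin (F G K : d.-tuple R -> R) (B : R) : lebT.-integrable setT (EFin \o F) -> lebT.-integrable setT (EFin \o G) ->
  measurable_fun setT K -> (forall t, `|K t| <= B) ->
  leb2.-integrable setT (EFin \o (fun z => F z.1 * G z.2 * K (tsub z.1 z.2))).
Proof.
move=> Fi Gi mK KB.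
apply: (@integrable_le_bounded _ _ _ leb2 _ _ (fun z => F z.1 * G z.2) B) => //.
- apply: measurable_funM; first exact: (measurable_prodfun Fi Gi).
  by apply: (measurableT_comp mK); exact: measurable_tsub.
- exact: (integrable_prodfun Fi Gi).
- by move=> z _; rewrite normrM mulrC ler_wpM2r.
Qed.

End bilinear_form.

Section quadratic_form.
Context {R : realType} {d : nat}.
Notation lebT := (@lebesgue_tuple R d).
Notation leb2 := (prodm lebT lebT).
Variable H : d.-tuple R -> R.
Hypothesis Hi : lebT.-integrable setT (EFin \o H).

Definition quad (K : d.-tuple R -> R) : R := bilin H H K.

Let HH (z : d.-tuple R * d.-tuple R) := H z.1 * H z.2.

Let HHi : leb2.-integrable setT (EFin \o HH).
Proof. exact: (integrable_prodfun Hi Hi). Qed.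

Let mHH : measurable_fun setT HH.
Proof. exact: (measurable_prodfun Hi Hi). Qed.

Let msub : measurable_fun setT (fun z : d.-tuple R * d.-tuple R => tsub z.1 z.2).
Proof. exact: measurable_tsub. Qed.

Lemma integrable_quad (K : d.-tuple R -> R) (B : R) : measurable_fun setT K -> (forall t, `|K t| <= B) ->
  leb2.-integrable setT (EFin \o (fun z => H z.1 * H z.2 * K (tsub z.1 z.2))).
Proof. exact: (integrable_bilin Hi Hi). Qed.

Definition fcos (l : d.-tuple R) : R := \int[lebT]_x (H x * cos (2 * pi * tdot x l)).
Definition fsin (l : d.-tuple R) : R := \int[lebT]_x (H x * sin (2 * pi * tdot x l)).
(** The squared modulus of the Fourier transform of [H] in real terms; [normc_fourier] makes the
    link with [fourier]. *)
Definition power_spectrum l := fcos l ^+ 2 + fsin l ^+ 2.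

Lemma power_spectrum_ge0 l : 0 <= power_spectrum l.
Proof. by rewrite addr_ge0 ?sqr_ge0. Qed.

Let mdot l : measurable_fun setT (fun x : d.-tuple R => 2 * pi * tdot x l).
Proof. by apply: measurable_funM => //; exact: measurable_tdot. Qed.

Lemma integrable_mul_cos l : lebT.-integrable setT (EFin \o (fun x => H x * cos (2 * pi * tdot x l))).
Proof.
have mH : measurable_fun setT H by apply/measurable_EFinP; exact: measurable_int Hi.
apply: (@integrable_le_bounded _ _ _ lebT _ _ H 1) => //.
  apply: measurable_funM => //; apply: measurableT_comp => //.
  by apply: continuous_measurable_fun => x; exact: continuous_cos.
by move=> x _; rewrite mul1r normrM ler_piMr// ler_norml cos_geN1 cos_le1.
Qed.

Lemma integrable_mul_sin l : lebT.-integrable setT (EFin \o (fun x => H x * sin (2 * pi * tdot x l))).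
Proof.
have mH : measurable_fun setT H by apply/measurable_EFinP; exact: measurable_int Hi.
apply: (@integrable_le_bounded _ _ _ lebT _ _ H 1) => //.
  apply: measurable_funM => //; apply: measurableT_comp => //.
  by apply: continuous_measurable_fun => x; exact: continuous_sin.
by move=> x _; rewrite mul1r normrM ler_piMr// ler_norml sin_geN1 sin_le1.
Qed.

(** The squares of the cosine and sine transforms are integrals over the product space, and they
    combine by the subtraction formula for the cosine. *)
Lemma power_spectrum_quad l : power_spectrum l = quad (fun v => cos (2 * pi * tdot l v)).
Proof.
rewrite /power_spectrum !expr2 -!Rintegral_prodfun; try exact: integrable_mul_cos; try exact: integrable_mul_sin.
rewrite -RintegralD//; last 2 first.
- exact: (integrable_prodfun (integrable_mul_cos l) (integrable_mul_cos l)).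
- exact: (integrable_prodfun (integrable_mul_sin l) (integrable_mul_sin l)).
apply: eq_Rintegral => z _; rewrite tdot_tsub mulrBr cosB; ring.
Qed.

Let C : R := \int[leb2]_z `|HH z|.

Let aHHi : leb2.-integrable setT (EFin \o (fun z => `|HH z|)).
Proof. exact: integrable_norm. Qed.

Let E (l : d.-tuple R) z : R := `|HH z| + HH z * cos (2 * pi * tdot l (tsub z.1 z.2)).

(* Since |HH| + HH cos (2 pi l.v) = |HH| (1 + cos (c + 2 pi l.v)) with c = 0 or pi
   according to the sign of HH, Tonelli's theorem applies to nonnegative functions only. *)
Let phase z : R := if 0 <= HH z then 0 else pi.

Let phaseE l z : E l z = `|HH z| * (1 + cos (phase z + 2 * pi * tdot l (tsub z.1 z.2))).
Proof.
rewrite /E /phase; case: ifPn => [h|]; first by rewrite add0r ger0_norm//; ring.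
by rewrite -ltNge => h; rewrite [pi + _]addrC cosDpi ltr0_norm//; ring.
Qed.

Let E0 l z : 0 <= E l z.
Proof. by rewrite phaseE mulr_ge0// -lerBlDl sub0r cos_geN1. Qed.

Let int_E l : (\int[leb2]_z (E l z)%:E = (C + power_spectrum l)%:E)%E.
Proof.
have ci : leb2.-integrable setT (EFin \o (fun z => HH z * cos (2 * pi * tdot l (tsub z.1 z.2)))).
  apply: (@integrable_quad (fun v => cos (2 * pi * tdot l v)) 1).
    apply: measurableT_comp; first by apply: continuous_measurable_fun => x; exact: continuous_cos.
    by apply: measurable_funM => //; exact: measurable_tdot.
  by move=> t; rewrite ler_norml cos_geN1 cos_le1.
rewrite EFin_Rintegral//; last exact: integrable_funD.
by rewrite RintegralD// power_spectrum_quad.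
Qed.

Let mE2 : measurable_fun setT (fun p : d.-tuple R * (d.-tuple R * d.-tuple R) => (E p.1 p.2)%:E).
Proof.
apply/measurable_EFinP; apply: measurable_funD.
  by apply: measurableT_comp => //; exact: (measurableT_comp mHH).
apply: measurable_funM; first exact: (measurableT_comp mHH).
apply: measurableT_comp; first by apply: continuous_measurable_fun => x; exact: continuous_cos.
apply: measurable_funM => //; apply: measurable_tdot => //.
exact: (measurableT_comp msub).
Qed.

Let mE l : measurable_fun setT (fun z => (E l z)%:E).
Proof.
apply/measurable_EFinP; apply: measurable_funD; first by apply: measurableT_comp.
apply: measurable_funM => //.
apply: measurableT_comp; first by apply: continuous_measurable_fun => x; exact: continuous_cos.
by apply: measurable_funM => //; exact: measurable_tdot.
Qed.

(** Up to the constant [C], the power spectrum is the integral of the nonnegative, jointly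
    measurable function [E], whose measurability in the parameter is part of Tonelli's theorem. *)
Lemma measurable_power_spectrum : measurable_fun setT power_spectrum.
Proof.
rewrite (_ : power_spectrum = fun l => fine (\int[leb2]_z (E l z)%:E)%E - C); last first.
  by apply/funext => l; rewrite int_E/= addrC addKr.
apply: measurable_funB => //; apply: (measurableT_comp (fine_measurable _)) => //.
apply: (@measurable_fun_fubini_tonelli_F _ _ (d.-tuple R) (d.-tuple R * d.-tuple R)%type R _ (fun p : d.-tuple R * (d.-tuple R * d.-tuple R) => (E p.1 p.2)%:E)) => //.
by move=> p; rewrite lee_fin.
Qed.

Variables (g0 : R) (G : d.-tuple R -> R) (mG : measurable_fun setT G) (g00 : 0 <= g0)
  (Gb : forall t, `|G t| <= g0).

Let phase_cos z : `|HH z| * (g0 + cos (phase z) * G (tsub z.1 z.2)) =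
  g0 * `|HH z| + HH z * G (tsub z.1 z.2).
Proof.
rewrite /phase; case: ifPn => [h|]; first by rewrite cos0 ger0_norm//; ring.
by rewrite -ltNge => h; rewrite cospi ltr0_norm//; ring.
Qed.

Let int_G : (\int[leb2]_z (g0 * `|HH z| + HH z * G (tsub z.1 z.2))%:E = (g0 * C + quad G)%:E)%E.
Proof.
rewrite EFin_Rintegral//; last by apply: integrable_funD; [|exact: integrable_funZ|exact: (integrable_quad mG Gb)].
rewrite RintegralD//; [|exact: integrable_funZ|exact: (integrable_quad mG Gb)].
by rewrite RintegralZl.
Qed.

Let C0 : 0 <= C. Proof. exact: Rintegral_ge0. Qed.

(** After Tonelli's theorem the hypothesis on [w] is applied for each pair [z] with the phase
    [phase z]. This yields the identity with [C] added to the power spectrum, and the finite term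
    [g0 * C] is then subtracted. *)
Lemma integral_power_spectrum (w : d.-tuple R -> R) : measurable_fun setT w ->
  (forall l, 0 <= w l) ->
  (forall c t, (\int[lebT]_l (w l * (1 + cos (c + 2 * pi * tdot l t)))%:E = (g0 + cos c * G t)%:E)%E) ->
  (\int[lebT]_l (w l * power_spectrum l)%:E = (quad G)%:E)%E.
Proof.
move=> mw w0 wG.
(* At the phase [pi / 2] and [t = 0] the cosine vanishes, which reads off the total mass of [w]. *)
have iw : (\int[lebT]_l (w l)%:E = g0%:E)%E.
  have := wG (pi / 2) [tuple 0 | i < d]; rewrite cos_pihalf mul0r addr0 => <-.
  apply: eq_integral => l _; congr EFin.
  rewrite /tdot big1 ?mulr0 ?addr0 ?cos_pihalf ?addr0 ?mulr1// => i _.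
  by rewrite tnth_mktuple mulr0.
have : (\int[lebT]_l (w l * (C + power_spectrum l))%:E = (g0 * C + quad G)%:E)%E.
  transitivity (\int[lebT]_l \int[leb2]_z (w l * E l z)%:E)%E.
    apply: eq_integral => l _; rewrite EFinM -int_E -ge0_integralZl ?lee_fin//.
    by move=> z _; rewrite lee_fin.
  rewrite (@fubini_tonelli _ _ _ _ R lebT _ (fun p : d.-tuple R * (d.-tuple R * d.-tuple R) => (w p.1 * E p.1 p.2)%:E)); last 2 first.
  - apply/measurable_EFinP; apply: measurable_funM; first exact: (measurableT_comp mw).
    exact/measurable_EFinP.
  - by move=> p; rewrite lee_fin mulr_ge0.
  rewrite -int_G; apply: eq_integral => z _; rewrite -phase_cos EFinM -wG -ge0_integralZl ?lee_fin//.
  - by apply: eq_integral => l _; rewrite /= phaseE -EFinM; congr EFin; ring.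
  - apply/measurable_EFinP; apply: measurable_funM => //; apply: measurable_funD => //.
    apply: measurableT_comp; first by apply: continuous_measurable_fun => x; exact: continuous_cos.
    by apply: measurable_funD => //; apply: measurable_funM => //; exact: measurable_tdot.
  - by move=> l _; rewrite lee_fin mulr_ge0// -lerBlDl sub0r cos_geN1.
under eq_integral do rewrite mulrDr EFinD.
rewrite ge0_integralD//; last 4 first.
- by move=> l _; rewrite lee_fin mulr_ge0.
- by apply/measurable_EFinP; exact: measurable_funM.
- by move=> l _; rewrite lee_fin mulr_ge0// power_spectrum_ge0.
- by apply/measurable_EFinP; apply: measurable_funM => //; exact: measurable_power_spectrum.
under eq_integral do rewrite EFinM muleC.
have w0' (l : d.-tuple R) : setT l -> (0 <= (w l)%:E)%E by rewrite lee_fin.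
have mw' : measurable_fun setT (fun l => (w l)%:E) by apply/measurable_EFinP.
rewrite (ge0_integralZl _ measurableT mw' w0') ?lee_fin//.
rewrite iw -EFinM EFinD mulrC.
by move=> /(congr1 (fun y => y - (g0 * C)%:E)%E); rewrite ![((g0 * C)%:E + _)%E]addeC !addeK.
Qed.

(** The exchange of [integral_power_spectrum], with a lattice sum in place of the outer integral. *)
Lemma esum_power_spectrum (w : d.-tuple int -> R) :
  (forall m, 0 <= w m) ->
  (forall c t, (\esum_(m in [set: d.-tuple int]) (w m * (1 + cos (c + 2 * pi * tdot (tint m) t)))%:E = (g0 + cos c * G t)%:E)%E) ->
  (\esum_(m in [set: d.-tuple int]) (w m * power_spectrum (tint m))%:E = (quad G)%:E)%E.
Proof.
move=> w0 wG.
have iw : (\esum_(m in [set: d.-tuple int]) (w m)%:E = g0%:E)%E.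
  have := wG (pi / 2) [tuple 0 | i < d]; rewrite cos_pihalf mul0r addr0 => <-.
  apply: eq_esum => l _; congr EFin.
  rewrite /tdot big1 ?mulr0 ?addr0 ?cos_pihalf ?addr0 ?mulr1// => i _.
  by rewrite [X in _ * X]tnth_mktuple mulr0.
have : (\esum_(m in [set: d.-tuple int]) (w m * (C + power_spectrum (tint m)))%:E = (g0 * C + quad G)%:E)%E.
  transitivity (\esum_(m in [set: d.-tuple int]) \int[leb2]_z (w m * E (tint m) z)%:E)%E.
    apply: eq_esum => l _; rewrite EFinM -int_E -ge0_integralZl ?lee_fin//.
    by move=> z _; rewrite lee_fin.
  rewrite -ge0_integral_esum; last 2 first.
  - move=> m; apply/measurable_EFinP; apply: measurable_funM => //; apply/measurable_EFinP.
    exact: mE.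
  - by move=> m z; rewrite lee_fin mulr_ge0.
  rewrite -int_G; apply: eq_integral => z _; rewrite -phase_cos EFinM -wG -esumZl ?lee_fin//.
  - by apply: eq_esum => l _; rewrite /= phaseE -EFinM; congr EFin; ring.
  - by move=> l; rewrite lee_fin mulr_ge0// -lerBlDl sub0r cos_geN1.
under eq_esum do rewrite mulrDr EFinD.
rewrite esumD//; last 2 first.
- by move=> l _; rewrite lee_fin mulr_ge0.
- by move=> l _; rewrite lee_fin mulr_ge0// power_spectrum_ge0.
under eq_esum do rewrite EFinM muleC.
rewrite esumZl ?lee_fin//.
rewrite iw -EFinM EFinD mulrC.
by move=> /(congr1 (fun y => y - (g0 * C)%:E)%E); rewrite ![((g0 * C)%:E + _)%E]addeC !addeK.
Qed.

End quadratic_form.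

(** * Approximate identity and Plancherel *)

Section gaussian_weight.
Context {R : realType} {d : nat}.
Notation lebT := (@lebesgue_tuple R d).
Notation leb2 := (prodm lebT lebT).
Implicit Types x y u : d.-tuple R.

Definition gaussw (k : R) x : R := expR (- (k * tnorm x ^+ 2)).

Lemma gaussw_ge0 k x : 0 <= gaussw k x. Proof. exact: expR_ge0. Qed.

Lemma measurable_gaussw k : measurable_fun setT (gaussw k).
Proof.
apply: measurableT_comp => //; apply: measurableT_comp => //; apply: measurable_funM => //.
rewrite (_ : (fun x => _) = (fun x => tdot x x)); first exact: measurable_tdot.
by apply/funext => x; rewrite tnorm_sqr /tdot; apply: eq_bigr => i _; rewrite expr2.
Qed.

Lemma integral_gaussw_lty k : 0 < k -> (\int[lebT]_x (gaussw k x)%:E < +oo)%E.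
Proof.
move=> k0; have p0 : 0 < pi ^+ 2 :> R by rewrite exprn_gt0// pi_gt0.
have := @gauss_fourier_tuple R d (k / pi ^+ 2) (pi / 2) [tuple 0 | i < d] (divr_gt0 k0 p0).
rewrite cos_pihalf mul0r addr0 (_ : integral _ _ _ = \int[lebT]_x (gaussw k x)%:E)%E => [->|].
  by rewrite ltry.
apply: eq_integral => x _; congr EFin.
rewrite divfK ?gt_eqF// /tdot big1 ?mulr0 ?addr0 ?cos_pihalf ?addr0 ?mulr1// => i _.
by rewrite tnth_mktuple mulr0.
Qed.

Lemma integrable_gaussw k : 0 < k -> lebT.-integrable setT (EFin \o gaussw k).
Proof.
move=> k0; apply/integrableP; split; first by apply/measurable_EFinP; exact: measurable_gaussw.
under eq_integral do rewrite /= ger0_norm ?gaussw_ge0//.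
exact: integral_gaussw_lty.
Qed.

(** A finite weight on pairs of a point and a displacement. The exponent [1] in the displacement
    matches a rescaled Gaussian density, see [gauss_density_shift]; half of each exponent is given
    up in [pairw_displace_le]. *)
Definition pairw (z : d.-tuple R * d.-tuple R) : R := gaussw 2^-1 z.1 * gaussw 1 z.2.
Definition displace (s : R) (z : d.-tuple R * d.-tuple R) : d.-tuple R := tadd z.1 (tscale s z.2).

Lemma pairw_ge0 z : 0 <= pairw z. Proof. by rewrite mulr_ge0 ?gaussw_ge0. Qed.

Lemma measurable_pairw : measurable_fun setT pairw.
Proof. by apply: measurable_funM; apply: (measurableT_comp (measurable_gaussw _)). Qed.

Lemma measurable_displace s : measurable_fun setT (displace s).
Proof. by apply: measurable_tadd => //; exact: measurable_tscale. Qed.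

Lemma integrable_pairw : leb2.-integrable setT (EFin \o pairw).
Proof. by apply: (@integrable_prodfun _ _ _ _ _ lebT lebT); exact: integrable_gaussw. Qed.

(** Coordinatewise, the exponents differ by [(p - 2 s q)^2 / 4 + (q^2 - s^2 q^2) / 2], which is
    nonnegative because [s <= 1]. *)
Lemma pairw_displace_le s y u : 0 <= s <= 1 ->
  pairw (tadd y (tscale (- s) u), u) <= gaussw 4^-1 y * gaussw 2^-1 u.
Proof.
move=> /andP[s0 s1]; rewrite /pairw /gaussw -!expRD ler_expR/= -!opprD lerN2 !tnorm_sqr !mulr_sumr -!big_split/=.
apply: ler_sum => i _; rewrite !tnth_mktuple.
move: (tnth y i) (tnth u i) => p q.
have H : 0 <= (p - 2 * s * q) ^+ 2 by exact: sqr_ge0.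
have K : s ^+ 2 * q ^+ 2 <= q ^+ 2 by rewrite ler_piMl ?sqr_ge0// expr_le1.
rewrite -subr_ge0.
rewrite (_ : _ - _ = 4^-1 * (p - 2 * s * q) ^+ 2 + 2^-1 * (q ^+ 2 - s ^+ 2 * q ^+ 2)); last by field.
by rewrite addr_ge0// mulr_ge0// subr_ge0.
Qed.

Definition gaussw_mass : \bar R := (\int[lebT]_u (gaussw 2^-1 u)%:E)%E.

Lemma gaussw_mass_fin : gaussw_mass \is a fin_num.
Proof.
rewrite ge0_fin_numE; first exact: integral_gaussw_lty.
by apply: integral_ge0 => x _; rewrite lee_fin gaussw_ge0.
Qed.

(** The substitution [y = x + s u] moves the displacement into the weight, where [pairw_displace_le]
    removes it. The bound is uniform in [s], so an approximation of a function also controls its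
    displaced copies. *)
Lemma integral_displace_le s (F : d.-tuple R -> \bar R) : 0 <= s <= 1 ->
  measurable_fun setT F -> (forall x, 0 <= F x)%E ->
  (\int[leb2]_z ((pairw z)%:E * F (displace s z)) <= gaussw_mass * \int[lebT]_y ((gaussw 4^-1 y)%:E * F y))%E.
Proof.
move=> s01 mF F0.
have mWE : measurable_fun setT (EFin \o pairw) by apply/measurable_EFinP; exact: measurable_pairw.
have mG k : measurable_fun setT (EFin \o gaussw k) by apply/measurable_EFinP; exact: measurable_gaussw.
rewrite {1}/prodm fubini_tonelli2; last 2 first.
- by apply: emeasurable_funM => //; apply: (measurableT_comp mF); exact: measurable_displace.
- by move=> z; rewrite mule_ge0// lee_fin pairw_ge0.
rewrite /gaussw_mass -ge0_integralZr//; last 3 first.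
- exact: mG.
- by move=> x _; rewrite lee_fin gaussw_ge0.
- by apply: integral_ge0 => y _; rewrite mule_ge0// lee_fin gaussw_ge0.
have mWy u : measurable_fun setT (fun y : d.-tuple R => EFin (pairw (tadd y (tscale (- s) u), u))).
  apply: (measurableT_comp mWE); apply/measurable_fun_pair => //.
  exact: measurable_tadd.
apply: ge0_le_integral => //.
- by move=> u _; apply: integral_ge0 => x _; rewrite mule_ge0// lee_fin pairw_ge0.
- apply: (@measurable_fun_fubini_tonelli_G _ _ (d.-tuple R) (d.-tuple R) R lebT (fun z => (pairw z)%:E * F (displace s z))%E).
    by apply: emeasurable_funM => //; apply: (measurableT_comp mF); exact: measurable_displace.
  by move=> z; rewrite mule_ge0// lee_fin pairw_ge0.
- apply: emeasurable_funM => //; exact: mG.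
move=> u _ /=; rewrite /fubini_G.
have -> : (\int[lebT]_x ((pairw (x, u))%:E * F (displace s (x, u))) =
    \int[lebT]_y ((pairw (tadd y (tscale (- s) u), u))%:E * F y))%E.
  have := @ge0_integral_taffine R d 1 (tscale s u) (fun y => (pairw (tadd y (tscale (- s) u), u))%:E * F y)%E ltr01.
  rewrite invr1 expr1n mul1e => <-; last 2 first.
  - by apply: emeasurable_funM => //; exact: mWy.
  - by move=> y; rewrite mule_ge0// lee_fin pairw_ge0.
  apply: eq_integral => x _.
  have -> : tadd (tadd (tscale 1 x) (tscale s u)) (tscale (- s) u) = x.
    by apply: eq_from_tnth => i; rewrite !tnth_mktuple; ring.
  rewrite /displace/=; have -> // : tadd (tscale 1 x) (tscale s u) = tadd x (tscale s u).
  by apply: eq_from_tnth => i; rewrite !tnth_mktuple; ring.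
rewrite -ge0_integralZl//; last 3 first.
- by apply: emeasurable_funM => //; exact: mG.
- by move=> y _; rewrite mule_ge0// lee_fin gaussw_ge0.
- by rewrite lee_fin gaussw_ge0.
apply: ge0_le_integral => //.
- by move=> y _; rewrite mule_ge0// lee_fin pairw_ge0.
- by apply: emeasurable_funM => //; exact: mWy.
- by apply: emeasurable_funM => //; apply: emeasurable_funM => //; exact: mG.
move=> y _; rewrite muleA -EFinM [gaussw _ u * _]mulrC; apply: lee_wpmul2r => //.
by rewrite lee_fin pairw_displace_le.
Qed.

End gaussian_weight.

Lemma cvge0_near_le {R : realType} (u : nat -> \bar R) (e : R) : 0 < e ->
  u k @[k --> \oo] --> 0%E -> \forall k \near \oo, (u k <= e%:E)%E.
Proof.
move=> e0 u0; have : \forall k \near \oo, (u k < e%:E)%E.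
  apply: (u0 [set y | (y < e%:E)%E]); apply: open_nbhs_nbhs; split; last by rewrite /= lte_fin.
  exact: open_ereal_lt_ereal.
by apply: filterS => k /ltW.
Qed.

(** * Continuity of translations in Gaussian mean *)

Section approximate_identity.
Context {R : realType} {d : nat}.
Notation lebT := (@lebesgue_tuple R d).
Notation leb2 := (prodm lebT lebT).
Implicit Types (f g h : d.-tuple R -> R).

Definition osc (k : nat) f : \bar R :=
  (\int[leb2]_z (pairw z * `|f z.1 - f (displace (harmonic k) z)|)%:E)%E.

(** A weighted form of the continuity of translations in L^1, along displacements scaled by
    [harmonic k]. The finite weight makes bounded functions eligible and bounded pointwise limits
    harmless. *)
Definition vanishing f := forall e : R, 0 < e -> \forall k \near \oo, (osc k f <= e%:E)%E.

Lemma harmonic01 k : 0 <= (harmonic k : R) <= 1.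
Proof. by rewrite /harmonic invr_ge0 ler0n invf_le1 ?ler1n. Qed.

Lemma measurable_osc k f : measurable_fun setT f ->
  measurable_fun setT (fun z => (pairw z * `|f z.1 - f (displace (harmonic k) z)|)%:E).
Proof.
move=> mf; apply/measurable_EFinP; apply: measurable_funM; first exact: measurable_pairw.
apply: measurableT_comp => //; apply: measurable_funB; apply: (measurableT_comp mf) => //.
exact: measurable_displace.
Qed.

Lemma osc_ge0 k f (z : d.-tuple R * d.-tuple R) :
  (0 <= (pairw z * `|f z.1 - f (displace (harmonic k) z)|)%:E)%E.
Proof. by rewrite lee_fin mulr_ge0 ?pairw_ge0. Qed.

(** One domination principle for all algebraic closure properties used later: nested differences,
    intersections, and linear combinations. *)
Lemma vanishing_le2 (c : R) f g h : measurable_fun setT f -> measurable_fun setT g -> measurable_fun setT h ->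
  0 <= c ->
  (forall x y, `|f x - f y| <= c * `|g x - g y| + `|h x - h y|) ->
  vanishing g -> vanishing h -> vanishing f.
Proof.
move=> mf mg mh c0 fgh vg vh e e0.
have c1 : 0 < c + 1 by rewrite ltr_wpDl.
have e2 : 0 < e / 2 by rewrite divr_gt0.
near=> k; apply: (@le_trans _ _ (c%:E * osc k g + osc k h)%E).
  rewrite /osc -ge0_integralZl//; last 2 first.
  - exact: measurable_osc.
  - by move=> z _; exact: osc_ge0.
  rewrite -ge0_integralD//; last 4 first.
  - by move=> z _; rewrite mule_ge0 ?osc_ge0.
  - by apply: emeasurable_funM => //; exact: measurable_osc.
  - by move=> z _; exact: osc_ge0.
  - exact: measurable_osc.
  apply: ge0_le_integral => //.
  - by move=> z _; exact: osc_ge0.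
  - exact: measurable_osc.
  - apply: emeasurable_funD; last exact: measurable_osc.
    by apply: emeasurable_funM => //; exact: measurable_osc.
  - move=> z _; rewrite -EFinM -EFinD lee_fin mulrCA -mulrDr ler_wpM2l ?pairw_ge0//.
rewrite [e]splitr EFinD; apply: leeD; last by near: k; exact: vh.
apply: (@le_trans _ _ (c%:E * (e / 2 / (c + 1))%:E)%E).
  by apply: lee_wpmul2l => //; near: k; apply: vg; rewrite divr_gt0.
by rewrite -EFinM lee_fin mulrA ler_pdivrMr// mulrC ler_wpM2l ?ltW// ltrDl.
Unshelve. all: by end_near. Qed.

Lemma vanishing_cst (c : R) : vanishing (fun=> c).
Proof.
move=> e e0; near=> k; rewrite /osc integral0_eq ?lee_fin ?ltW// => z _.
by rewrite subrr normr0 mulr0.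
Unshelve. all: by end_near. Qed.

Lemma integrable_pairw_bounded (M : R) (F : d.-tuple R * d.-tuple R -> R) : measurable_fun setT F ->
  (forall z, `|F z| <= M) -> leb2.-integrable setT (EFin \o (fun z => pairw z * F z)).
Proof.
move=> mF FM; apply: (@integrable_le_bounded _ _ _ leb2 _ _ pairw M) => //.
- by apply: measurable_funM => //; exact: measurable_pairw.
- exact: integrable_pairw.
- by move=> z _; rewrite normrM mulrC ler_wpM2r.
Qed.

(** Dominated convergence, with a multiple of [pairw] as dominating function. *)
Lemma vanishing_continuous (M : R) f : measurable_fun setT f -> (forall x, `|f x| <= M) ->
  (forall z, f (displace (harmonic k) z) @[k --> \oo] --> f z.1) -> vanishing f.
Proof.
move=> mf fM fc e e0; apply: cvge0_near_le => //.
have M0 : 0 <= M by apply: le_trans (fM [tuple 0 | i < d]).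
rewrite -[X in _ --> X](integral0 leb2 setT).
apply: (@dominated_cvg _ _ R leb2 setT measurableT _ _ (fun z => (pairw z * (M + M))%:E)) => //.
- by move=> k; exact: measurable_osc.
- move=> z _; apply: cvg_EFin; first exact: nearW.
  rewrite (_ : 0 = pairw z * `|f z.1 - f z.1|); last by rewrite subrr normr0 mulr0.
  apply: cvgMr; apply: cvg_norm; apply: cvgB; first exact: cvg_cst.
  exact: fc.
- apply: (integrable_pairw_bounded (F := fun=> M + M) (M := M + M)) => // z.
  by rewrite ger0_norm// addr_ge0.
- move=> k z _; rewrite gee0_abs ?osc_ge0// lee_fin ler_wpM2l ?pairw_ge0//.
  by rewrite (le_trans (ler_normB _ _))// lerD.
Qed.

(** The increment of [f] splits into that of [f_ n] and the errors [f - f_ n] at the point and at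
    the displaced point. Dominated convergence makes both errors small, the second through
    [integral_displace_le], uniformly in [k]; [n] is thus fixed before [k] grows. *)
Lemma vanishing_lim (M : R) (f_ : nat -> d.-tuple R -> R) f :
  (forall n, measurable_fun setT (f_ n)) -> measurable_fun setT f ->
  (forall n x, `|f_ n x| <= M) -> (forall x, f_ n x @[n --> \oo] --> f x) ->
  (forall n, vanishing (f_ n)) -> vanishing f.
Proof.
move=> mf_ mf fM fc vf e e0.
have M0 : 0 <= M by apply: le_trans (fM 0%N [tuple 0 | i < d]).
have fM' x : `|f x| <= M.
  by apply: (@cvgr_to_le _ \oo _ _ (fun n => `|f_ n x|)); [exact: cvg_norm (fc x)|exact: nearW].
have fd n x : `|f x - f_ n x| <= M + M by rewrite (le_trans (ler_normB _ _))// lerD.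
have md n : measurable_fun setT (fun x => `|f x - f_ n x|).
  by apply: measurableT_comp => //; exact: measurable_funB.
have cd x : `|f x - f_ n x| @[n --> \oo] --> 0.
  rewrite -(normr0 R) -(subrr (f x)); apply: cvg_norm; apply: cvgB; first exact: cvg_cst.
  exact: fc.
pose A n := (\int[leb2]_z (pairw z * `|f z.1 - f_ n z.1|)%:E)%E.
pose B n := (\int[lebT]_y ((gaussw 4^-1 y)%:E * (`|f y - f_ n y|)%:E))%E.
have mA n : measurable_fun setT (fun z : d.-tuple R * d.-tuple R => (pairw z * `|f z.1 - f_ n z.1|)%:E).
  apply/measurable_EFinP; apply: measurable_funM; first exact: measurable_pairw.
  exact: (measurableT_comp (md n)).
have A0 : A n @[n --> \oo] --> 0%E.
  rewrite -[X in _ --> X](integral0 leb2 setT).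
  apply: (@dominated_cvg _ _ R leb2 setT measurableT _ _ (fun z => (pairw z * (M + M))%:E)) => //.
  - move=> z _; apply: cvg_EFin; first exact: nearW.
    by rewrite -(mulr0 (pairw z)); apply: cvgMr; exact: cd.
  - apply: (integrable_pairw_bounded (F := fun=> M + M) (M := M + M)) => // z.
    by rewrite ger0_norm// addr_ge0.
  - move=> n z _; rewrite gee0_abs; last by rewrite lee_fin mulr_ge0 ?pairw_ge0.
    by rewrite lee_fin ler_wpM2l ?pairw_ge0.
have B0 : (@gaussw_mass R d * B n)%E @[n --> \oo] --> 0%E.
  rewrite -(mule0 (@gaussw_mass R d)); apply: cvgeZl; first exact: gaussw_mass_fin.
  rewrite -[X in _ --> X](integral0 lebT setT).
  apply: (@dominated_cvg _ _ R lebT setT measurableT _ _ (fun y => ((M + M) * gaussw 4^-1 y)%:E)) => //.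
  - move=> n; apply: emeasurable_funM; apply/measurable_EFinP => //; exact: measurable_gaussw.
  - move=> y _; rewrite -(mule0 (gaussw 4^-1 y)%:E); apply: cvgeZl => //.
    by apply: cvg_EFin; [exact: nearW|exact: cd].
  - by apply: (@integrable_funZ _ _ _ lebT) => //; exact: integrable_gaussw.
  - move=> n y _; rewrite -EFinM gee0_abs lee_fin ?mulr_ge0 ?gaussw_ge0// mulrC.
    by rewrite ler_wpM2r ?gaussw_ge0.
have e3 : 0 < e / 3 by rewrite divr_gt0.
have [n [An Bn]] : exists n, (A n <= (e / 3)%:E)%E /\ (@gaussw_mass R d * B n <= (e / 3)%:E)%E.
  have /filter_ex[n [? ?]] : \forall n \near \oo, (A n <= (e / 3)%:E)%E /\ (@gaussw_mass R d * B n <= (e / 3)%:E)%E.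
    by near=> n; split; near: n; exact: cvge0_near_le.
  by exists n.
near=> k.
have Ck : (osc k (f_ n) <= (e / 3)%:E)%E by near: k; exact: vf.
rewrite (_ : e = e / 3 + e / 3 + e / 3); last by field.
have mB : measurable_fun setT (fun z : d.-tuple R * d.-tuple R => ((pairw z)%:E * (`|f (displace (harmonic k) z) - f_ n (displace (harmonic k) z)|)%:E)%E).
  apply: emeasurable_funM; apply/measurable_EFinP; first exact: measurable_pairw.
  by apply: (measurableT_comp (md n)); exact: measurable_displace.
have B1 := @integral_displace_le R d (harmonic k) (fun y => (`|f y - f_ n y|)%:E) (harmonic01 k).
apply: (@le_trans _ _ (A n + osc k (f_ n) + @gaussw_mass R d * B n)%E); last by rewrite !EFinD !leeD.
apply: (@le_trans _ _ (A n + osc k (f_ n) + \int[leb2]_z ((pairw z)%:E * (`|f (displace (harmonic k) z) - f_ n (displace (harmonic k) z)|)%:E))%E).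
  rewrite /A /osc -ge0_integralD//; last 3 first.
  - by move=> z _; rewrite lee_fin mulr_ge0 ?pairw_ge0.
  - by move=> z _; rewrite osc_ge0.
  - exact: measurable_osc.
  rewrite -ge0_integralD//; last 3 first.
  - by move=> z _; rewrite adde_ge0 ?osc_ge0// lee_fin mulr_ge0 ?pairw_ge0.
  - by apply: emeasurable_funD => //; exact: measurable_osc.
  - by move=> z _; rewrite mule_ge0// lee_fin ?pairw_ge0.
  apply: ge0_le_integral => //.
  - by move=> z _; rewrite osc_ge0.
  - exact: measurable_osc.
  - by apply: emeasurable_funD => //; apply: emeasurable_funD => //; exact: measurable_osc.
  move=> z _; rewrite -EFinM -!EFinD lee_fin -!mulrDr ler_wpM2l ?pairw_ge0//.
  set a := f z.1; set b := f_ n z.1; set c := f_ n _; set g := f _.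
  have -> : a - g = (a - b) + (b - c) + (c - g) by ring.
  by rewrite (le_trans (ler_normD _ _))// [`|g - c|]distrC lerD2r ler_normD.
by rewrite leeD2l// B1//; apply/measurable_EFinP.
Unshelve. all: by end_near. Qed.

End approximate_identity.

Import HBSimple HBNNSimple.

Section vanishing_measurable.
Context {R : realType} {d : nat}.
Implicit Types (A B : set (d.-tuple R)).

(** These sets form a sigma-algebra by the closure properties of [vanishing]; since it contains the
    coordinate rays, it contains all measurable sets. *)
Let goodset : set (set (d.-tuple R)) := [set A | measurable A /\ vanishing (\1_A : d.-tuple R -> R)].

Let goodset_sigma : sigma_algebra setT goodset.
Proof.
apply/sigma_algebraP => //; split.
- split; first exact: measurableT.
  rewrite (_ : \1_setT = fun=> 1) ; first exact: vanishing_cst.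
  by apply/funext => x; rewrite indicT.
- move=> A B BA [mA vA] [mB vB]; split; first exact: measurableD.
  apply: (@vanishing_le2 _ _ 1 _ \1_A \1_B) => //; try by apply: measurable_indic => //; exact: measurableD.
  move=> x y; rewrite mul1r.
  have E z : \1_(A `\` B) z = \1_A z - \1_B z :> R.
    rewrite !indicE in_setD; have [zB|zB] := boolP (z \in B).
      by rewrite (mem_set (BA _ (set_mem zB))) subrr.
    by rewrite andbT subr0.
  rewrite !E; move: (\1_A x) (\1_A y) (\1_B x) (\1_B y) => a a' b b'.
  rewrite [`|b - b'|]distrC (_ : _ - _ - _ = (a - a') + (b' - b)) ?ler_normD//; ring.
- move=> F ndF gF; split; first by apply: bigcup_measurable => n _; have [] := gF n.
  apply: (@vanishing_lim _ _ 1 (fun n => \1_(F n))) => //.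
  + by move=> n; apply: measurable_indic; have [] := gF n.
  + by apply: measurable_indic; apply: bigcup_measurable => n _; have [] := gF n.
  + by move=> n x; rewrite indicE ger0_norm// lern1 leq_b1.
  + move=> x; case: (pselect ((\bigcup_n F n) x)) => [[n _ Fn]|nF].
      apply: cvg_near_cst; near=> m; rewrite !indicE !mem_set//; first by exists n.
      have : F n `<=` F m by apply/subsetPset/ndF; near: m; exact: nbhs_infty_ge.
      exact.
    apply: cvg_near_cst; apply: nearW => m; rewrite !indicE !memNset// => Fm.
    by apply: nF; exists m.
  + by move=> n; have [] := gF n.
- move=> A B [mA vA] [mB vB]; split; first exact: measurableI.
  apply: (@vanishing_le2 _ _ 1 _ \1_A \1_B) => //; try by apply: measurable_indic => //; exact: measurableI.
  move=> x y; rewrite mul1r !indicE !in_setI.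
  by do 4 case: (_ \in _) => /=; rewrite ?subrr ?subr0 ?sub0r ?normrN ?normr0 ?normr1 ?addr0 ?add0r// ler_wpDr.
Unshelve. all: by end_near. Qed.

(** The indicator of an open ray is the pointwise limit of the ramps [min 1 (n * max 0 (t - p))],
    which are bounded and continuous. *)
Let vanishing_ray (i : 'I_d) (p : R) : vanishing (\1_((fun x : d.-tuple R => tnth x i) @^-1` `]p, +oo[%classic) : d.-tuple R -> R).
Proof.
have mt : measurable_fun setT (fun x : d.-tuple R => tnth x i) by exact: measurable_tnth.
pose ramp (n : nat) (t : R) : R := Order.min 1 (n%:R * Order.max 0 (t - p)).
have ramp0 n t : 0 <= ramp n t by rewrite /ramp le_min ler01 mulr_ge0// le_max lexx.
have ramp1 n t : ramp n t <= 1 by rewrite /ramp ge_min lexx.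
have cramp n : continuous (ramp n).
  move=> t.
  have cc (c : R) : {for t, continuous ((fun=> c) : R -> R^o)} by exact: cvg_cst.
  have c1 : {for t, continuous (fun t : R => t - p : R^o)}.
    by apply: (@continuousB R R^o) => //; exact: cvg_cst.
  have c2 := @continuous_max R R (fun=> 0) (fun t : R => t - p) t (cc _) c1.
  have c3 := @continuousM R R (fun=> n%:R) _ t (cc _) c2.
  exact: (@continuous_min R R (fun=> 1) _ t (cc _) c3).
have mr n : measurable_fun setT (fun x : d.-tuple R => ramp n (tnth x i)).
  by apply: (measurableT_comp _ mt); exact: continuous_measurable_fun.
apply: (@vanishing_lim _ _ 1 (fun n x => ramp n (tnth x i))) => //.
- by apply: measurable_indic; rewrite -[X in measurable X]setTI; exact: mt.
- by move=> n x; rewrite ger0_norm.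
- move=> x; rewrite indicE.
  have [px|xp] := ltP p (tnth x i).
    rewrite mem_set/=; last by rewrite in_itv/= px.
    apply: cvg_near_cst; near=> n; rewrite /ramp; apply/min_idPl.
    have tp : 0 < tnth x i - p by rewrite subr_gt0.
    rewrite (max_idPr (ltW tp)) -ler_pdivrMr//.
    by near: n; exact: nbhs_infty_ger.
  rewrite memNset/=; last by rewrite in_itv/= andbT; apply/negP; rewrite -leNgt.
  apply: cvg_near_cst; apply: nearW => n; rewrite /ramp.
  have tp : tnth x i - p <= 0 by rewrite subr_le0.
  by rewrite (max_idPl tp) mulr0 (min_idPr ler01).
- move=> n; apply: (@vanishing_continuous _ _ 1) => //.
    by move=> x; rewrite ger0_norm.
  move=> z; have cz : tnth (displace (harmonic k) z) i @[k --> \oo] --> tnth z.1 i.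
    rewrite (_ : (fun k => _) = (fun k => tnth z.1 i + harmonic k * tnth z.2 i)); last first.
      by apply/funext => k; rewrite !tnth_mktuple.
    rewrite -[X in _ --> X]addr0; apply: cvgD; first exact: cvg_cst.
    by rewrite -(mul0r (tnth z.2 i)); apply: cvgMl; exact: cvg_harmonic.
  exact: (cvg_comp (fun k => tnth (displace (harmonic k) z) i) (ramp n) cz (cramp n _)).
Unshelve. all: by end_near. Qed.

Lemma vanishing_indic A : measurable A -> vanishing (\1_A : d.-tuple R -> R).
Proof.
move=> mA; suff : goodset A by case.
rewrite -[goodset](sigma_algebra_id goodset_sigma).
(* Measurability of the identity out of the sigma-algebra [goodset] says that every measurable set
   is good; it can be tested coordinate by coordinate, on rays. *)
have mid : measurable_fun setT (id : g_sigma_algebraType goodset -> d.-tuple R).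
  apply/measurable_fun_tnthP => i.
  apply: (@measurability _ _ _ (measurableTypeR R) setT (fun x : g_sigma_algebraType goodset => tnth (x : d.-tuple R) i) _ (RGenOInfty.measurableE R)) => _ [_ [p ->]] <-.
  rewrite setTI; apply: sub_sigma_algebra; split; last exact: vanishing_ray.
  by rewrite -[X in measurable X]setTI; exact: (@measurable_tnth _ R d i).
by have := mid measurableT A mA; rewrite setTI.
Qed.

Let vanishing_nnsfun (f : {nnsfun (d.-tuple R) >-> R}) : vanishing f.
Proof.
have fE : (f : d.-tuple R -> R) = fun x => \sum_(y <- finmap.enum_fset (fset_set (range f))) y * \1_(f @^-1` [set y]) x.
  by apply/funext => x; rewrite [LHS]fimfunE fsbig_finite.
rewrite fE; elim: (finmap.enum_fset _) => [|y s IH].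
  rewrite (_ : (fun _ => _) = fun=> 0); first exact: vanishing_cst.
  by apply/funext => x; rewrite big_nil.
have mI z : measurable_fun setT (\1_(f @^-1` [set z]) : d.-tuple R -> R).
  by apply: measurable_indic; exact: measurable_sfunP.
have mS (t : seq R) : measurable_fun setT (fun x => \sum_(y <- t) y * \1_(f @^-1` [set y]) x : R).
  by apply: measurable_sum => z; apply: measurable_funM.
apply: (@vanishing_le2 _ _ `|y| _ (\1_(f @^-1` [set y])) (fun x => \sum_(y <- s) y * \1_(f @^-1` [set y]) x)) => //.
- move=> u v; rewrite !big_cons opprD addrACA -mulrBr (le_trans (ler_normD _ _))//.
  by rewrite normrM.
- by apply: vanishing_indic; exact: measurable_sfunP.
Qed.

Lemma vanishing_bounded (M : R) (f : d.-tuple R -> R) : measurable_fun setT f ->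
  (forall x, `|f x| <= M) -> vanishing f.
Proof.
move=> mf fM.
(* Adding [M] makes the function nonnegative, hence a limit of increasing simple functions, which
   are all bounded by [2 M]. *)
suff : vanishing (fun x => f x + M).
  move=> v; apply: (@vanishing_le2 _ _ 1 _ (fun x => f x + M) (fun=> 0)) => //.
  - exact: measurable_funD.
  - by move=> x y; rewrite mul1r subrr normr0 addr0 opprD addrACA subrr addr0.
  - exact: vanishing_cst.
have f0 x : 0 <= f x + M by have := fM x; rewrite ler_norml => /andP[]; rewrite -subr_ge0 opprK.
have f2 x : f x + M <= M + M by have := fM x; rewrite ler_norml => /andP[_]; rewrite lerD2r.
have mfM : measurable_fun setT (EFin \o (fun x => f x + M)).
  by apply/measurable_EFinP; exact: measurable_funD.
have cf x : nnsfun_approx measurableT mfM n x @[n --> \oo] --> f x + M.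
  have := @cvg_nnsfun_approx _ _ R setT measurableT _ mfM (fun x _ => f0 x) x I.
  by move/fine_cvg.
have nf x : nondecreasing_seq (fun n => nnsfun_approx measurableT mfM n x).
  by move=> m n mn; have /lefP/(_ x) := @nd_nnsfun_approx _ _ R setT measurableT _ mfM _ _ mn.
apply: (@vanishing_lim _ _ (M + M) (fun n => nnsfun_approx measurableT mfM n)) => //.
- exact: measurable_funD.
- move=> n x; rewrite ger0_norm//.
  apply: le_trans (f2 x); rewrite -(cvg_lim _ (cf x))//.
  apply: (nondecreasing_cvgn_le (nf x)); apply/cvg_ex; exists (f x + M); exact: cf.
Qed.

End vanishing_measurable.

Section gauss_mass.
Context {R : realType} {d : nat}.
Notation lebT := (@lebesgue_tuple R d).
Notation leb2 := (prodm lebT lebT).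
Implicit Types x y u t : d.-tuple R.

Lemma measurable_gauss_density (b : R) : 0 < b -> measurable_fun setT (@gauss_density R d b).
Proof.
move=> b0; rewrite (_ : gauss_density b = fun t => \prod_(i < d) gauss1 b (tnth t i)).
  by apply: (@measurable_tuple_prod _ _ (fun=> gauss1 b)) => i; exact: measurable_gauss1.
by apply/funext => t; exact: gauss_densityE.
Qed.

Lemma gauss_density_le (b : R) t : 0 < b -> `|gauss_density b t| <= gauss1 b 0 ^+ d.
Proof.
move=> b0; rewrite ger0_norm ?gauss_density_ge0// gauss_densityE// -[X in _ ^+ X]card_ord -prodr_const.
apply: ler_prod => i _; rewrite gauss1_ge0/= /gauss1 ler_wpM2l ?invr_ge0 ?sqrtr_ge0// ler_expR.
by rewrite expr0n/= mul0r lerN2 divr_ge0 ?sqr_ge0 ?ltW.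
Qed.

Lemma gauss1_pow_ge0 (b : R) : 0 <= gauss1 b 0 ^+ d.
Proof. by rewrite exprn_ge0 ?gauss1_ge0. Qed.

Lemma integral_gauss_density_r (b : R) x : 0 < b ->
  (\int[lebT]_y (gauss_density b (tsub x y))%:E = 1)%E.
Proof.
move=> b0; pose q (i : 'I_d) (u : R) := gauss1 b (u - tnth x i).
have := @integral_tuple_prod R d q (fun=> 1); rewrite prodr_const expr1n => <-.
- apply: eq_integral => y _; congr EFin; rewrite gauss_densityE//; apply: eq_bigr => i _.
  by rewrite !tnth_mktuple mulN1r -gauss1N opprB.
- move=> i; apply: (measurableT_comp (measurable_gauss1 _)); exact: measurable_funB.
- by move=> i u; exact: gauss1_ge0.
- by move=> i; rewrite integral_gauss1.
Qed.

Lemma gauss_density_sym (b : R) x y : 0 < b -> gauss_density b (tsub x y) = gauss_density b (tsub y x).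
Proof.
move=> b0; rewrite !gauss_densityE//; apply: eq_bigr => i _.
by rewrite !tnth_mktuple !mulN1r -gauss1N opprB.
Qed.

Lemma integral_gauss_density_l (b : R) y : 0 < b ->
  (\int[lebT]_x (gauss_density b (tsub x y))%:E = 1)%E.
Proof.
by move=> b0; under eq_integral do rewrite gauss_density_sym//; exact: integral_gauss_density_r.
Qed.

Lemma measurable_gauss_tsub (b : R) : 0 < b ->
  measurable_fun setT (fun z : d.-tuple R * d.-tuple R => (gauss_density b (tsub z.1 z.2))%:E).
Proof.
move=> b0; apply/measurable_EFinP; apply: (measurableT_comp (measurable_gauss_density b0)).
exact: measurable_tsub.
Qed.

Lemma measurable_gauss_tsub_r (b : R) x : 0 < b ->
  measurable_fun setT (fun y : d.-tuple R => (gauss_density b (tsub x y))%:E).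
Proof.
move=> b0; apply/measurable_EFinP; apply: (measurableT_comp (measurable_gauss_density b0)).
exact: measurable_tsub.
Qed.

Lemma measurable_gauss_tsub_l (b : R) y : 0 < b ->
  measurable_fun setT (fun x : d.-tuple R => (gauss_density b (tsub x y))%:E).
Proof.
move=> b0; apply/measurable_EFinP; apply: (measurableT_comp (measurable_gauss_density b0)).
exact: measurable_tsub.
Qed.

Lemma integral2_gauss_l (b : R) (F : d.-tuple R -> \bar R) : 0 < b ->
  measurable_fun setT F -> (forall x, 0 <= F x)%E ->
  (\int[leb2]_z (F z.1 * (gauss_density b (tsub z.1 z.2))%:E) = \int[lebT]_x F x)%E.
Proof.
move=> b0 mF F0; rewrite ge0_integral_prodm//; last 2 first.
- apply: emeasurable_funM; [exact: (measurableT_comp mF)|exact: measurable_gauss_tsub].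
- by move=> z; rewrite mule_ge0// lee_fin gauss_density_ge0.
apply: eq_integral => x _ /=; rewrite ge0_integralZl//; last 2 first.
- exact: measurable_gauss_tsub_r.
- by move=> y _; rewrite lee_fin gauss_density_ge0.
by rewrite integral_gauss_density_r// mule1.
Qed.

Lemma integral2_gauss_r (b : R) (F : d.-tuple R -> \bar R) : 0 < b ->
  measurable_fun setT F -> (forall x, 0 <= F x)%E ->
  (\int[leb2]_z (F z.2 * (gauss_density b (tsub z.1 z.2))%:E) = \int[lebT]_x F x)%E.
Proof.
move=> b0 mF F0; rewrite /prodm fubini_tonelli2; last 2 first.
- apply: emeasurable_funM; [exact: (measurableT_comp mF)|exact: measurable_gauss_tsub].
- by move=> z; rewrite mule_ge0// lee_fin gauss_density_ge0.
apply: eq_integral => y _; rewrite /fubini_G/= ge0_integralZl//; last 2 first.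
- exact: measurable_gauss_tsub_l.
- by move=> x _; rewrite lee_fin gauss_density_ge0.
by rewrite integral_gauss_density_l// mule1.
Qed.

Lemma gauss_density_shift (s : R) x u : 0 < s ->
  gauss_density (s ^+ 2) (tsub x (tadd (tscale s u) x)) = s^-1 ^+ d * (gauss1 1 0 ^+ d * gaussw 1 u).
Proof.
move=> s0; rewrite gauss_densityE ?exprn_gt0// /gaussw expR_tnorm.
have powE (c : R) : c ^+ d = \prod_(i < d) c by rewrite prodr_const card_ord.
rewrite !powE -!big_split/=.
apply: eq_bigr => i _; rewrite !tnth_mktuple.
rewrite (_ : _ + _ = - (s * tnth u i)); last by ring.
rewrite gauss1N /gauss1 expr0n/= mul0r oppr0 expR0 mulr1 mul1r mul1r.
rewrite sqrtrM ?exprn_ge0 ?ltW// sqrtr_sqr gtr0_norm// invfM mulrA.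
congr (_ * expR (- _)); field; by rewrite gt_eqF.
Qed.

(** The substitution [y = x + s u] with [s = harmonic k]: its Jacobian cancels the factor [s^-d] of
    the density of parameter [s^2], so the kernel in [x - y] becomes the fixed weight on
    displacements of [osc]. *)
Lemma integral2_gauss_shift (k : nat) (f : d.-tuple R -> R) : measurable_fun setT f ->
  (\int[leb2]_z (gaussw 2^-1 z.1 * `|f z.1 - f z.2| * gauss_density (harmonic k ^+ 2) (tsub z.1 z.2))%:E =
   (gauss1 1 0 ^+ d)%:E * osc k f)%E.
Proof.
move=> mf; have s0 : 0 < harmonic k :> R by exact: harmonic_gt0.
have ss0 : 0 < harmonic k ^+ 2 :> R by rewrite exprn_gt0.
have mabs : measurable_fun setT (fun z : d.-tuple R * d.-tuple R => gaussw 2^-1 z.1 * `|f z.1 - f z.2|).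
  apply: measurable_funM; first exact: (measurableT_comp (measurable_gaussw _)).
  by apply: measurableT_comp => //; apply: measurable_funB; apply: (measurableT_comp mf).
have mF : measurable_fun setT (fun z : d.-tuple R * d.-tuple R =>
    (gaussw 2^-1 z.1 * `|f z.1 - f z.2| * gauss_density (harmonic k ^+ 2) (tsub z.1 z.2))%:E).
  apply/measurable_EFinP; apply: measurable_funM => //.
  by apply/measurable_EFinP; exact: measurable_gauss_tsub.
rewrite ge0_integral_prodm//; last first.
  by move=> z; rewrite lee_fin mulr_ge0 ?gauss_density_ge0// mulr_ge0 ?gaussw_ge0.
rewrite /osc -ge0_integralZl//; last 3 first.
- exact: measurable_osc.
- by move=> z _; exact: osc_ge0.
- by rewrite lee_fin gauss1_pow_ge0.
rewrite [RHS]ge0_integral_prodm; last 2 first.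
- by apply: emeasurable_funM => //; exact: measurable_osc.
- by move=> z; rewrite mule_ge0 ?osc_ge0// lee_fin gauss1_pow_ge0.
apply: eq_integral => x _ /=.
have := @ge0_integral_taffine R d (harmonic k) x
  (fun y => (gaussw 2^-1 x * `|f x - f y| * gauss_density (harmonic k ^+ 2) (tsub x y))%:E) s0.
have hd : harmonic k ^+ d != 0 :> R by rewrite expf_neq0// gt_eqF.
move=> /(_ _ _)/(congr1 (fun a => (harmonic k ^+ d)%:E * a)%E).
rewrite muleA -EFinM exprVn divff// mul1e => <-; last 2 first.
- exact: (measurableT_comp mF (pair1_measurable x)).
- by move=> y; rewrite lee_fin mulr_ge0 ?gauss_density_ge0// mulr_ge0 ?gaussw_ge0.
rewrite -ge0_integralZl//; last 3 first.
- apply: (measurableT_comp (measurableT_comp mF (pair1_measurable x))).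
  by apply: measurable_tadd => //; exact: measurable_tscale.
- by move=> y _; rewrite lee_fin mulr_ge0 ?gauss_density_ge0// mulr_ge0 ?gaussw_ge0.
- by rewrite lee_fin exprn_ge0// ltW.
apply: eq_integral => u _; rewrite gauss_density_shift// -!EFinM; congr EFin.
rewrite /pairw/= (_ : displace _ (x, u) = tadd (tscale (harmonic k) u) x); last first.
  by apply: eq_from_tnth => i; rewrite !tnth_mktuple addrC.
rewrite exprVn; move: (harmonic k ^+ d) hd => v v0.
by field.
Qed.

End gauss_mass.

Lemma young {R : realType} (t p q : R) : 0 < t -> `|p| * `|q| <= 2^-1 * (t * p ^+ 2 + t^-1 * q ^+ 2).
Proof.
move=> t0; rewrite -subr_ge0 -[p ^+ 2]real_normK ?num_real// -[q ^+ 2]real_normK ?num_real//.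
rewrite (_ : _ - _ = 2^-1 * t^-1 * (t * `|p| - `|q|) ^+ 2); last by field; rewrite gt_eqF.
by rewrite mulr_ge0 ?sqr_ge0// mulr_ge0 ?invr_ge0 ?ltW.
Qed.

(** * Plancherel's identity by Gaussian regularization *)

Section plancherel.
Context {R : realType} {d : nat}.
Notation lebT := (@lebesgue_tuple R d).
Notation leb2 := (prodm lebT lebT).
Variable H : d.-tuple R -> R.
Hypothesis Hi : lebT.-integrable setT (EFin \o H).
Hypothesis H2 : lebT.-integrable setT (EFin \o (fun x => H x ^+ 2)).

Definition sqnorm : R := \int[lebT]_x (H x ^+ 2).

Let mH : measurable_fun setT H.
Proof. by apply/measurable_EFinP; exact: measurable_int Hi. Qed.

Let b (k : nat) : R := harmonic k ^+ 2.
Let b0 k : 0 < b k. Proof. by rewrite exprn_gt0// harmonic_gt0. Qed.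
Let phi k (z : d.-tuple R * d.-tuple R) : R := gauss_density (b k) (tsub z.1 z.2).
Let phi0 k z : 0 <= phi k z. Proof. exact: gauss_density_ge0. Qed.
Let mphi k : measurable_fun setT (phi k).
Proof. by apply/measurable_EFinP; exact: measurable_gauss_tsub. Qed.

Let sqnorm0 : 0 <= sqnorm.
Proof. by apply: Rintegral_ge0 => x _; exact: sqr_ge0. Qed.

Let int_sq : (\int[lebT]_x (H x ^+ 2)%:E = sqnorm%:E)%E.
Proof. by rewrite EFin_Rintegral. Qed.

(* Truncating at a multiple of the Gaussian weight makes [vanishing_bounded] control the unweighted
   oscillation of [Hn n]. *)
Let Hn (n : nat) x := if `|H x| <= n%:R * gaussw 2^-1 x then H x else 0.
Let Dn n x := H x - Hn n x.

Let mHn n : measurable_fun setT (Hn n).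
Proof.
apply: measurable_fun_ifT => //; apply: measurable_fun_ler; first exact: measurableT_comp.
apply: measurable_funM => //; exact: measurable_gaussw.
Qed.

Let mDn n : measurable_fun setT (Dn n).
Proof. exact: measurable_funB. Qed.

Let Dn_le n x : `|Dn n x| <= `|H x|.
Proof. by rewrite /Dn /Hn; case: ifP; rewrite ?subrr ?normr0 ?subr0. Qed.

Let Hn_vanishing n : vanishing (Hn n).
Proof.
apply: (@vanishing_bounded _ _ n%:R) => // x; rewrite /Hn; case: ifP => [h|]; last by rewrite normr0.
by apply: (le_trans h); rewrite ler_piMr// -expR0 ler_expR oppr_le0 mulr_ge0// sqr_ge0.
Qed.

Let Dn_cvg : (\int[lebT]_x (Dn n x ^+ 2)%:E)%E @[n --> \oo] --> 0%E.
Proof.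
rewrite -[X in _ --> X](integral0 lebT setT).
apply: (@dominated_cvg _ _ R lebT setT measurableT _ _ (fun x => (H x ^+ 2)%:E)) => //.
- by move=> n; apply/measurable_EFinP; exact: measurable_funX.
(* The Gaussian weight is positive at [x], so the threshold eventually exceeds [|H x|] and the
   remainder becomes exactly [0]. *)
- move=> x _; apply: cvg_near_cst; near=> n; rewrite /Dn /Hn ifT ?subrr ?expr0n//.
  rewrite -ler_pdivrMr ?expR_gt0//.
  by near: n; exact: nbhs_infty_ger.
- move=> n x _; rewrite gee0_abs ?lee_fin ?sqr_ge0//.
  by rewrite -[leLHS]real_normK ?num_real// -[leRHS]real_normK ?num_real// lerXn2r ?nnegrE.
Unshelve. all: by end_near. Qed.

(** If [x] is below the threshold, [H x] equals [Hn n x], is dominated by [n] times the Gaussian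
    weight, and only [Dn n y] remains besides the truncated increment; otherwise [H x] equals
    [Dn n x]. Young's inequality puts the small [t] on the squares of [H] and the large [t^-1] on
    those of the remainder. *)
Let dev_bound (t : R) n (x y : d.-tuple R) : 0 < t ->
  `|H x| * `|H x - H y| <= (t * H x ^+ 2 + t^-1 * Dn n x ^+ 2) + (t * H y ^+ 2 + t^-1 * Dn n y ^+ 2)
    + n%:R * (gaussw 2^-1 x * `|Hn n x - Hn n y|).
Proof.
move=> t0; have ti : 0 <= t^-1 by rewrite invr_ge0 ltW.
have q0 (v : R) : 0 <= t * v ^+ 2 by rewrite mulr_ge0 ?sqr_ge0// ltW.
have q1 (v : R) : 0 <= t^-1 * v ^+ 2 by rewrite mulr_ge0 ?sqr_ge0.
have w0 : 0 <= n%:R * (gaussw 2^-1 x * `|Hn n x - Hn n y|) by rewrite mulr_ge0// mulr_ge0 ?gaussw_ge0.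
have Y := young (H x) (Dn n y) t0.
have [h|h] := boolP (`|H x| <= n%:R * gaussw 2^-1 x).
  have E : Hn n x = H x by rewrite /Hn h.
  have -> : H x - H y = (Hn n x - Hn n y) - Dn n y by rewrite /Dn E; ring.
  apply: (@le_trans _ _ (`|H x| * `|Dn n y| + `|H x| * `|Hn n x - Hn n y|)).
    by rewrite -mulrDr ler_wpM2l// [leRHS]addrC ler_normB.
  apply: lerD; last by rewrite mulrA ler_wpM2r.
  apply: (le_trans Y); have := q0 (H x); have := q0 (H y); have := q1 (Dn n x); have := q1 (Dn n y).
  lra.
have E : Dn n x = H x by rewrite /Dn /Hn (negbTE h) subr0.
apply: (@le_trans _ _ (`|H x| * `|H x| + `|H y| * `|H x|)).
  by rewrite [`|H y| * _]mulrC -mulrDr ler_wpM2l// ler_normB.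
have Y1 := young (H x) (H x) t0; have Y2 := young (H y) (H x) t0.
rewrite E; have := q0 (H x); have := q0 (H y); have := q1 (H x); have := q1 (Dn n y).
lra.
Qed.

Let dev k : \bar R := (\int[leb2]_z (`|H z.1| * `|H z.1 - H z.2| * phi k z)%:E)%E.

Let mHH k : measurable_fun setT (fun z : d.-tuple R * d.-tuple R => `|H z.1| * `|H z.1 - H z.2| * phi k z).
Proof.
apply: measurable_funM => //; apply: measurable_funM.
  by apply: measurableT_comp => //; exact: (measurableT_comp mH).
by apply: measurableT_comp => //; apply: measurable_funB; apply: (measurableT_comp mH).
Qed.

(** [dev_bound] integrated against the kernel: terms in one variable lose the kernel, whose
    marginals have mass [1], and the truncated increment becomes an [osc]. *)
Let dev_le (t : R) n k : 0 < t ->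
  (dev k <= (2 * (t * sqnorm))%:E + (2 * t^-1)%:E * (\int[lebT]_x (Dn n x ^+ 2)%:E) +
    (n%:R * gauss1 1 0 ^+ d)%:E * osc k (Hn n))%E.
Proof.
move=> t0; have ti : 0 <= t^-1 by rewrite invr_ge0 ltW.
pose F x : \bar R := (t * H x ^+ 2 + t^-1 * Dn n x ^+ 2)%:E.
have F0 x : (0 <= F x)%E by rewrite lee_fin addr_ge0// mulr_ge0 ?sqr_ge0// ltW.
have mF : measurable_fun setT F.
  by apply/measurable_EFinP; apply: measurable_funD; apply: measurable_funM => //; exact: measurable_funX.
have mH2 : measurable_fun setT (fun x => (H x ^+ 2)%:E) by apply/measurable_EFinP; exact: measurable_funX.
have mD2 : measurable_fun setT (fun x => (Dn n x ^+ 2)%:E) by apply/measurable_EFinP; exact: measurable_funX.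
have intF : (\int[lebT]_x F x = (t * sqnorm)%:E + (t^-1)%:E * (\int[lebT]_x (Dn n x ^+ 2)%:E))%E.
  rewrite /F; under eq_integral do rewrite EFinD !EFinM.
  rewrite ge0_integralD//; last 4 first.
  - by move=> x _; rewrite -EFinM lee_fin mulr_ge0 ?sqr_ge0// ltW.
  - exact: emeasurable_funM.
  - by move=> x _; rewrite -EFinM lee_fin mulr_ge0 ?sqr_ge0.
  - exact: emeasurable_funM.
  rewrite !ge0_integralZl ?lee_fin ?(ltW t0)//; last 2 first.
  - by move=> x _; rewrite lee_fin sqr_ge0.
  - by move=> x _; rewrite lee_fin sqr_ge0.
  by rewrite int_sq EFinM.
have mg : measurable_fun setT (fun z : d.-tuple R * d.-tuple R => gaussw 2^-1 z.1 * `|Hn n z.1 - Hn n z.2|).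
  apply: measurable_funM; first exact: (measurableT_comp (measurable_gaussw _)).
  by apply: measurableT_comp => //; apply: measurable_funB; apply: (measurableT_comp (mHn n)).
have mphiE : measurable_fun setT (EFin \o phi k) by apply/measurable_EFinP.
have mF1 : measurable_fun setT (fun z : d.-tuple R * d.-tuple R => F z.1 * (phi k z)%:E)%E.
  by apply: emeasurable_funM => //; exact: (measurableT_comp mF).
have mF2 : measurable_fun setT (fun z : d.-tuple R * d.-tuple R => F z.2 * (phi k z)%:E)%E.
  by apply: emeasurable_funM => //; exact: (measurableT_comp mF).
have mG : measurable_fun setT (fun z : d.-tuple R * d.-tuple R => (gaussw 2^-1 z.1 * `|Hn n z.1 - Hn n z.2| * phi k z)%:E).
  by apply/measurable_EFinP; exact: measurable_funM.
have G0 z : (0 <= (gaussw 2^-1 z.1 * `|Hn n z.1 - Hn n z.2| * phi k z)%:E)%E.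
  by rewrite lee_fin mulr_ge0// mulr_ge0 ?gaussw_ge0.
have -> : ((2 * (t * sqnorm))%:E + (2 * t^-1)%:E * (\int[lebT]_x (Dn n x ^+ 2)%:E) =
    \int[lebT]_x F x + \int[lebT]_x F x)%E.
  rewrite intF addeACA -EFinD -ge0_muleDl ?lee_fin//.
  rewrite -EFinD; congr ((_)%:E + _%:E * _)%E; ring.
rewrite EFinM -muleA -integral2_gauss_shift//.
rewrite -{1}(integral2_gauss_l (b0 k) mF F0) -(integral2_gauss_r (b0 k) mF F0).
rewrite -ge0_integralZl ?lee_fin//.
rewrite -ge0_integralD//; last 2 first.
- by move=> z _; apply: mule_ge0; [exact: F0|rewrite lee_fin gauss_density_ge0].
- by move=> z _; apply: mule_ge0; [exact: F0|rewrite lee_fin gauss_density_ge0].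
rewrite -ge0_integralD//; last 4 first.
- by move=> z _; apply: adde_ge0; apply: mule_ge0; try exact: F0; rewrite lee_fin gauss_density_ge0.
- exact: emeasurable_funD.
- by move=> z _; rewrite mule_ge0.
- exact: emeasurable_funM.
apply: ge0_le_integral => //.
- by move=> z _; rewrite lee_fin mulr_ge0// mulr_ge0.
- exact/measurable_EFinP.
- apply: emeasurable_funD; last exact: emeasurable_funM.
  exact: emeasurable_funD.
move=> z _; rewrite -!EFinM -!EFinD lee_fin -/(phi k z).
rewrite [n%:R * (_ * _)]mulrA -!mulrDl ler_wpM2r//.
exact: dev_bound.
Qed.

(** The choices are made in order: [t] bounds the first term of [dev_le], then [n] the second by
    [Dn_cvg], then [k] the third by [Hn_vanishing]. The [1] added to [sqnorm] and to [c] keeps the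
    denominators positive. *)
Let dev_cvg (e : R) : 0 < e -> \forall k \near \oo, (dev k <= e%:E)%E.
Proof.
move=> e0; have e3 : 0 < e / 3 by rewrite divr_gt0.
pose t := e / 3 / (2 * (sqnorm + 1)).
have s1 : 0 < sqnorm + 1 by rewrite ltr_wpDl.
have t0 : 0 < t by rewrite divr_gt0// mulr_gt0.
have [n nP] : exists n, ((2 * t^-1)%:E * (\int[lebT]_x (Dn n x ^+ 2)%:E) <= (e / 3)%:E)%E.
  have /filter_ex[n nP] : \forall n \near \oo, ((2 * t^-1)%:E * (\int[lebT]_x (Dn n x ^+ 2)%:E) <= (e / 3)%:E)%E.
    by apply: cvge0_near_le => //; rewrite -(mule0 (2 * t^-1)%:E); exact: cvgeZl.
  by exists n.
pose c := n%:R * gauss1 1 0 ^+ d :> R.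
have c0 : 0 <= c by rewrite mulr_ge0// gauss1_pow_ge0.
have c1 : 0 < c + 1 by rewrite ltr_wpDl.
near=> k; apply: (le_trans (dev_le n k t0)).
rewrite (_ : e = e / 3 + e / 3 + e / 3); last by field.
rewrite !EFinD; apply: leeD; first apply: leeD => //.
  rewrite lee_fin /t; set u := e / 3.
  rewrite (_ : 2 * (u / (2 * (sqnorm + 1)) * sqnorm) = u * (sqnorm / (sqnorm + 1))); last first.
    by field; rewrite gt_eqF.
  by rewrite ler_piMr ?ltW// ltr_pdivrMr// mul1r ltrDl.
apply: (@le_trans _ _ (c%:E * (e / 3 / (c + 1))%:E)%E).
  apply: lee_wpmul2l => //; near: k; apply: Hn_vanishing; exact: divr_gt0.
by rewrite -EFinM lee_fin mulrA ler_pdivrMr// mulrC ler_wpM2l ?ltW// ltrDl.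
Unshelve. all: by end_near. Qed.

(** The kernel has mass [1] in its second variable, so [sqnorm] is also a double integral, of
    [H x ^ 2] against the kernel; the two integrands differ by [H x * (H y - H x)] times the
    kernel. *)
Let quad_dev k : (`|(quad H (gauss_density (b k)) - sqnorm)%:E| <= dev k)%E.
Proof.
have i1 : leb2.-integrable setT (EFin \o (fun z => H z.1 * H z.2 * phi k z)).
  by apply: (integrable_quad Hi (measurable_gauss_density (b0 k))) => t; exact: gauss_density_le.
have m2 : measurable_fun setT (fun x => (H x ^+ 2)%:E) by apply/measurable_EFinP; exact: measurable_funX.
have n2 x : (0 <= (H x ^+ 2)%:E)%E by rewrite lee_fin sqr_ge0.
have s2 : (\int[leb2]_z (H z.1 ^+ 2 * phi k z)%:E = sqnorm%:E)%E.
  by rewrite -int_sq -(integral2_gauss_l (b0 k) m2 n2).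
have mm : measurable_fun setT (fun z : d.-tuple R * d.-tuple R => (H z.1 ^+ 2 * phi k z)%:E).
  apply/measurable_EFinP; apply: measurable_funM => //; apply: measurable_funX.
  exact: (measurableT_comp mH).
have i2 : leb2.-integrable setT (EFin \o (fun z => H z.1 ^+ 2 * phi k z)).
  apply/integrableP; split => //.
  rewrite (eq_integral (fun z : d.-tuple R * d.-tuple R => (H z.1 ^+ 2 * phi k z)%:E)) ?s2 ?ltry// => z _.
  by rewrite /= ger0_norm// mulr_ge0 ?sqr_ge0.
have -> : (quad H (gauss_density (b k)) - sqnorm)%:E =
    (\int[leb2]_z (H z.1 * H z.2 * phi k z - H z.1 ^+ 2 * phi k z)%:E)%E.
  rewrite (EFin_Rintegral measurableT (integrable_funB measurableT i1 i2)) RintegralB//; congr (_ - _)%:E.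
  by rewrite /Rintegral s2.
apply: le_trans (le_abse_integral _ measurableT _) _.
  by apply: (measurable_int leb2); exact: integrable_funB.
rewrite /dev; set I1 := integral _ _ _; set I2 := integral _ _ _.
rewrite (_ : I1 = I2)//; apply: eq_integral => z _ /=; congr EFin.
rewrite -mulrBl normrM (ger0_norm (phi0 _ _)); congr (_ * _).
by rewrite expr2 -mulrBr normrM distrC.
Qed.

Lemma quad_gauss_cvg : quad H (gauss_density (b k)) @[k --> \oo] --> sqnorm.
Proof.
apply/cvgrPdist_le => e e0; near=> k.
rewrite -lee_fin distrC; apply: (le_trans (quad_dev k)).
by near: k; exact: dev_cvg.
Unshelve. all: by end_near. Qed.

Lemma integral_power_spectrum_gauss (c : R) : 0 < c ->
  (\int[lebT]_l (expR (- (c * pi ^+ 2 * tnorm l ^+ 2)) * power_spectrum H l)%:E =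
   (quad H (gauss_density c))%:E)%E.
Proof.
move=> c0; apply: (integral_power_spectrum Hi (g0 := gauss1 c 0 ^+ d)).
- exact: measurable_gauss_density.
- by move=> t; exact: gauss_density_le.
- exact: (measurable_gaussw (c * pi ^+ 2)).
- by move=> l; exact: expR_ge0.
- by move=> p t; exact: gauss_fourier_tuple.
Qed.

(** As [b k] decreases to [0] the Gaussian weights increase to [1]: monotone convergence treats the
    spectral side, [quad_gauss_cvg] the other. Integrability of the power spectrum is thereby a
    conclusion. *)
Lemma integral_power_spectrum_sqnorm : (\int[lebT]_l (power_spectrum H l)%:E = sqnorm%:E)%E.
Proof.
pose g k l := (expR (- (b k * pi ^+ 2 * tnorm l ^+ 2)) * power_spectrum H l)%:E.
have mps := measurable_power_spectrum Hi.
have mg k : measurable_fun setT (g k).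
  apply/measurable_EFinP; apply: measurable_funM => //.
  exact: (measurable_gaussw (b k * pi ^+ 2)).
have g0 k l : (0 <= g k l)%E by rewrite lee_fin mulr_ge0 ?expR_ge0 ?power_spectrum_ge0.
have ng l : {homo g^~ l : n m / (n <= m)%N >-> (n <= m)%E}.
  move=> n m nm; rewrite lee_fin ler_wpM2r ?power_spectrum_ge0// ler_expR lerN2.
  rewrite ler_wpM2r ?sqr_ge0// ler_wpM2r ?sqr_ge0// lerXn2r ?nnegrE ?harmonic_ge0//.
  by rewrite /harmonic lef_pV2 ?posrE// ler_nat.
have cg l : g n l @[n --> \oo] --> (power_spectrum H l)%:E.
  apply: cvg_EFin; first exact: nearW.
  rewrite -[X in _ --> X]mul1r; apply: cvgMl.
  rewrite -expR0 -oppr0 -(mul0r (pi ^+ 2 * tnorm l ^+ 2)).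
  apply: continuous_cvg; first exact: continuous_expR.
  apply: cvgN; under eq_fun do rewrite -mulrA; apply: cvgMl.
  rewrite (_ : b = fun k => harmonic k * harmonic k); last by apply/funext => k; rewrite /b expr2.
  by rewrite -(mulr0 0); apply: cvgM; exact: cvg_harmonic.
have := @cvg_monotone_convergence _ _ R lebT setT measurableT g mg (fun n x _ => g0 n x) (fun x _ => ng x).
have -> : (\int[lebT]_x limn (g^~ x) = \int[lebT]_l (power_spectrum H l)%:E)%E.
  by apply: eq_integral => l _; exact: cvg_lim.
under eq_fun do rewrite integral_power_spectrum_gauss//.
move=> c1; have c2 : (quad H (gauss_density (b n)))%:E @[n --> \oo] --> sqnorm%:E.
  by apply: cvg_EFin; [exact: nearW|exact: quad_gauss_cvg].
exact: (cvg_unique _ c1 c2).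
Qed.

Lemma integral_power_spectrum_deficit (c : R) : 0 < c ->
  (\int[lebT]_l (power_spectrum H l * (1 - expR (- (c * pi ^+ 2 * tnorm l ^+ 2))))%:E =
   (sqnorm - quad H (gauss_density c))%:E)%E.
Proof.
move=> c0; have mps := measurable_power_spectrum Hi.
have e1 l : expR (- (c * pi ^+ 2 * tnorm l ^+ 2)) <= 1 :> R.
  by rewrite -expR0 ler_expR oppr_le0 mulr_ge0 ?sqr_ge0// mulr_ge0 ?sqr_ge0// ltW.
have me : measurable_fun setT (fun l : d.-tuple R => expR (- (c * pi ^+ 2 * tnorm l ^+ 2))).
  exact: (measurable_gaussw (c * pi ^+ 2)).
set J := (\int[lebT]_l _)%E.
have : (J + (quad H (gauss_density c))%:E = sqnorm%:E)%E.
  rewrite -integral_power_spectrum_sqnorm -(integral_power_spectrum_gauss c0) -ge0_integralD//.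
  - apply: eq_integral => l _; rewrite -EFinD; congr EFin; ring.
  - by move=> l _; rewrite lee_fin mulr_ge0 ?power_spectrum_ge0// subr_ge0.
  - by apply/measurable_EFinP; apply: measurable_funM => //; exact: measurable_funB.
  - by move=> l _; rewrite lee_fin mulr_ge0 ?power_spectrum_ge0// expR_ge0.
  - by apply/measurable_EFinP; exact: measurable_funM.
move=> /(congr1 (fun y => y - (quad H (gauss_density c))%:E)%E).
by rewrite addeK// EFinB.
Qed.

End plancherel.

(** * Densities and independence *)

Section density.
Context {d} {T : measurableType d} {R : realType}.
Variables (D mu : {measure set T -> \bar R}) (phi : T -> R).
Hypotheses (mphi : measurable_fun setT phi) (phi0 : forall x, 0 <= phi x).
Hypothesis Dphi : forall A, measurable A -> D A = (\int[mu]_(x in A) (phi x)%:E)%E.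

Let nnsfun_density (g : {nnsfun T >-> R}) :
  (\int[D]_x (g x)%:E = \int[mu]_x ((g x)%:E * (phi x)%:E))%E.
Proof.
pose s : seq R := finmap.enum_fset (fset_set (range g)).
have gE x : (g x)%:E = (\sum_(y <- s) y%:E * (\1_(g @^-1` [set y]) x)%:E)%E.
  by rewrite [in LHS]fimfunE fsbig_finite//= -sumEFin.
have t0 y x : (0 <= y%:E * (\1_(g @^-1` [set y]) x : R)%:E)%E.
  exact: nnfun_muleindic_ge0.
have mI (y : R) : measurable_fun setT (fun x => (\1_(g @^-1` [set y]) x : R)%:E).
  by apply/measurable_EFinP; apply: measurable_indic; exact: measurable_sfunP.
have mt y : measurable_fun setT (fun x => (y%:E * (\1_(g @^-1` [set y]) x : R)%:E)%E).
  exact: emeasurable_funM.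
under eq_integral do rewrite gE.
under [RHS]eq_integral => x _.
  rewrite gE ge0_sume_distrl//.
  over.
rewrite ge0_integral_sum// [RHS]ge0_integral_sum//; last 2 first.
- by move=> y; apply: emeasurable_funM => //; exact/measurable_EFinP.
- by move=> y x _; rewrite mule_ge0// lee_fin.
apply: eq_bigr => y _.
have [y0|y0] := leP 0 y; last first.
  have y_empty : g @^-1` [set y] = set0.
    rewrite -subset0 => x /= gy; move: y0; rewrite -gy ltNge => /negP; apply; exact: fun_ge0.
  rewrite !integral0_eq// => x _; rewrite y_empty indic0/= mule0// mul0e//.
under [RHS]eq_integral do rewrite -muleA.
rewrite !ge0_integralZl//; last 2 first.
- by apply: emeasurable_funM => //; exact/measurable_EFinP.
- by move=> x _; rewrite mule_ge0// lee_fin.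
have mgy : measurable (g @^-1` [set y]) by exact: measurable_sfunP.
congr (_ * _)%E; rewrite integral_indic// setIT Dphi//.
rewrite integral_mkcond; apply: eq_integral => x _; rewrite patchE indicE.
by case: ifP => _; rewrite ?mul1e ?mul0e.
Qed.

Lemma ge0_integral_density (f : T -> \bar R) : measurable_fun setT f -> (forall x, 0 <= f x)%E ->
  (\int[D]_x f x = \int[mu]_x (f x * (phi x)%:E))%E.
Proof.
move=> mf f0; pose g n := nnsfun_approx measurableT mf n.
have cg x : (g n x)%:E @[n --> \oo] --> f x by exact: (@cvg_nnsfun_approx _ _ R setT measurableT).
have ng x : {homo (fun n => g n x) : n m / (n <= m)%N >-> n <= m}.
  by move=> n m nm; have /lefP/(_ x) := @nd_nnsfun_approx _ _ R setT measurableT _ mf _ _ nm.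
have mg n : measurable_fun setT (fun x => (g n x)%:E) by apply/measurable_EFinP.
have c1 : (\int[D]_x (g n x)%:E)%E @[n --> \oo] --> (\int[D]_x f x)%E.
  rewrite (eq_integral (fun x => limn (fun n => (g n x)%:E))); last first.
    by move=> x _; apply/esym/cvg_lim => //; exact: cg.
  apply: (@cvg_monotone_convergence _ _ R D setT measurableT (fun n x => (g n x)%:E)) => //.
  - by move=> n x _; rewrite lee_fin.
  - by move=> x _ n m nm; rewrite lee_fin ng.
have c2 : (\int[mu]_x ((g n x)%:E * (phi x)%:E))%E @[n --> \oo] --> (\int[mu]_x (f x * (phi x)%:E))%E.
  rewrite (eq_integral (fun x => limn (fun n => (g n x)%:E * (phi x)%:E)%E)); last first.
    by move=> x _; apply/esym/cvg_lim => //; apply: cvgeZr => //; exact: cg.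
  apply: (@cvg_monotone_convergence _ _ R mu setT measurableT (fun n x => (g n x)%:E * (phi x)%:E)%E) => //.
  - by move=> n; apply: emeasurable_funM => //; exact/measurable_EFinP.
  - by move=> n x _; rewrite mule_ge0 ?lee_fin.
  - by move=> x _ n m nm; rewrite -!EFinM lee_fin ler_wpM2r// ng.
have E : (fun n => \int[D]_x (g n x)%:E)%E = (fun n => \int[mu]_x ((g n x)%:E * (phi x)%:E))%E.
  by apply/funext => n; exact: nnsfun_density.
by move: c1; rewrite E => c1; exact: (cvg_unique _ c1 c2).
Qed.

End density.

Section random_pair.
Context {d d1 d2 : measure_display} {O : measurableType d} {T1 : measurableType d1}
  {T2 : measurableType d2} {R : realType}.
Variables (P : probability O R) (X : {RV P >-> T1}) (Y : {RV P >-> T2}).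

Definition rvpair (w : O) : T1 * T2 := (X w, Y w).

Let measurable_rvpair : measurable_fun setT rvpair.
Proof. exact/measurable_fun_pair. Qed.

HB.instance Definition _ := isMeasurableFun.Build _ _ _ _ rvpair measurable_rvpair.

Hypothesis XY : forall A B, measurable A -> measurable B ->
  P (X @^-1` A `&` Y @^-1` B) = (P (X @^-1` A) * P (Y @^-1` B))%E.

Lemma ge0_integral_rvpair (F : T1 * T2 -> \bar R) : measurable_fun setT F -> (forall z, 0 <= F z)%E ->
  (\int[P]_w F (X w, Y w) = \int[distribution P X]_x \int[distribution P Y]_y F (x, y))%E.
Proof.
move=> mF F0.
transitivity (\int[distribution P [the {RV P >-> (T1 * T2)%type} of rvpair]]_z F z)%E.
  by rewrite ge0_integral_distribution.
transitivity (\int[(distribution P X \x distribution P Y)%E]_z F z)%E; last by rewrite fubini_tonelli1.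
apply: eq_measure_integral => /= A mA _; apply/esym.
apply: (@product_measure_unique _ _ _ _ R (distribution P X) (distribution P Y) (distribution P [the {RV P >-> (T1 * T2)%type} of rvpair])) => //.
Qed.

End random_pair.

Section random_triple.
Context {d d1 d2 d3 : measure_display} {O : measurableType d} {T1 : measurableType d1}
  {T2 : measurableType d2} {T3 : measurableType d3} {R : realType}.
Variables (P : probability O R) (X : {RV P >-> T1}) (Y : {RV P >-> T2}) (Z : {RV P >-> T3}).
Hypothesis YZ : forall B C, measurable B -> measurable C ->
  P (Y @^-1` B `&` Z @^-1` C) = (P (Y @^-1` B) * P (Z @^-1` C))%E.
Hypothesis XYZ : forall A B C, measurable A -> measurable B -> measurable C ->
  P (X @^-1` A `&` (Y @^-1` B `&` Z @^-1` C)) = (P (X @^-1` A) * (P (Y @^-1` B) * P (Z @^-1` C)))%E.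

Let YZrv : {RV P >-> (T2 * T3)%type} := [the {RV P >-> (T2 * T3)%type} of rvpair Y Z].

(** Both sides are finite measures in [D], and they agree on rectangles, an intersection-stable
    family that generates the product sigma-algebra. *)
Let indep_pair (A : set T1) (D : set (T2 * T3)) : measurable A -> measurable D ->
  P (X @^-1` A `&` YZrv @^-1` D) = (P (X @^-1` A) * P (YZrv @^-1` D))%E.
Proof.
move=> mA mD.
have mXA : measurable (X @^-1` A) by rewrite -[X in measurable X]setTI; exact: measurable_funP.
have pA : P (X @^-1` A) \is a fin_num by exact: fin_num_measure.
have pA0 : 0 <= fine (P (X @^-1` A)) by rewrite fine_ge0.
pose m1 : {measure set (T2 * T3) -> \bar R} := pushforward (mrestr P mXA) YZrv.
pose m2 : {measure set (T2 * T3) -> \bar R} := mscale (NngNum pA0) (distribution P YZrv).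
have mYZ : measurable_fun setT YZrv by exact: measurable_funP.
have m1E E : m1 mYZ E = P (X @^-1` A `&` YZrv @^-1` E) by rewrite setIC.
have m2E E : m2 E = (P (X @^-1` A) * P (YZrv @^-1` E))%E by rewrite -[in RHS](fineK pA).
rewrite -m1E -m2E.
apply: (@measure_unique _ _ _ [set B `*` C | B in measurable & C in measurable] (fun=> setT)) => //.
- exact: measurable_prod_measurableType.
- move=> _ _ [B1 mB1 [C1 mC1 <-]] [B2 mB2 [C2 mC2 <-]].
  exists (B1 `&` B2); first exact: measurableI.
  by exists (C1 `&` C2); [exact: measurableI|rewrite setXI].
- by move=> i; exists setT => //; exists setT => //; rewrite setXTT.
- by rewrite bigcup_const.
- move=> _ [B mB [C mC <-]].
  rewrite m1E m2E.
  rewrite (_ : YZrv @^-1` (B `*` C) = Y @^-1` B `&` Z @^-1` C)//.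
  by rewrite XYZ// YZ.
- by move=> k; rewrite m1E preimage_setT setIT ltey_eq pA.
Qed.

Lemma ge0_integral_rvtriple (F : T1 * (T2 * T3) -> \bar R) : measurable_fun setT F -> (forall z, 0 <= F z)%E ->
  (\int[P]_w F (X w, (Y w, Z w)) =
   \int[distribution P X]_x \int[distribution P Y]_y \int[distribution P Z]_z F (x, (y, z)))%E.
Proof.
move=> mF F0; rewrite (ge0_integral_rvpair (Y := YZrv) indep_pair mF F0).
apply: eq_integral => x _; rewrite ge0_integral_distribution//; last first.
  exact: (measurableT_comp mF (pair1_measurable x)).
rewrite -(ge0_integral_rvpair YZ (F := fun yz => F (x, yz)))//.
exact: (measurableT_comp mF (pair1_measurable x)).
Qed.

End random_triple.

(** * Moments of lattice sums *)

Section esum_countable.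
Context {R : realType} {T : countType}.
Local Open Scope ereal_scope.
Implicit Types a : T -> \bar R.

(** The factor will be a lattice sum, which may be infinite. In that case either all terms vanish or
    a single positive one makes both sides infinite. *)
Lemma esumZl_ereal (c : \bar R) a : 0 <= c -> (forall i, 0 <= a i) ->
  \esum_(i in [set: T]) (c * a i) = c * \esum_(i in [set: T]) a i.
Proof.
move=> c0 a0; case: c c0 => [c c0||//]; first by rewrite esumZl// -lee_fin.
move=> _; have [az|/existsNP[i /eqP ai]] := pselect (forall i, a i = 0).
  by rewrite !esum1 ?mule0// => i _; rewrite az ?mule0.
have ai0 : 0 < a i by rewrite lt0e ai a0.
have le_esum (b : T -> \bar R) : (forall j, 0 <= b j) -> b i <= \esum_(j in [set: T]) b j.
  move=> b0; rewrite (esumID [set i])// setTI esum_set1// leeDl// esum_ge0//.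
rewrite gt0_mulye; last by rewrite (lt_le_trans ai0)// le_esum.
apply/eqP; rewrite -leye_eq; apply: le_trans (le_esum _ _); first by rewrite gt0_mulye.
by move=> j; rewrite mule_ge0.
Qed.

Lemma esum_exchange (S : countType) (b : T -> S -> \bar R) : (forall i j, 0 <= b i j) ->
  \esum_(i in [set: T]) \esum_(j in [set: S]) b i j = \esum_(j in [set: S]) \esum_(i in [set: T]) b i j.
Proof.
move=> b0; rewrite !esum_esum//.
rewrite (reindex_esum (setT `*`` (fun=> setT)) (setT `*`` (fun=> setT)) (fun p : S * T => (p.2, p.1)))//.
split => //; first by move=> [? ?] [? ?] _ _ [-> ->].
by move=> [i j] _; exists (j, i).
Qed.

Lemma esum_diag (c : T -> \bar R) i : (forall j, 0 <= c j) ->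
  \esum_(j in [set: T]) (if j == i then c j else 0) = c i.
Proof.
move=> c0; rewrite (esumID [set i])//; last by move=> j _; case: ifP.
rewrite setTI esum_set1 ?eqxx// esum1 ?adde0// => j [_ /= /eqP ji].
by rewrite (negbTE ji).
Qed.

End esum_countable.

Section lattice.
Context {R : realType} {d : nat}.

Definition zadd (n j : d.-tuple int) : d.-tuple int := [tuple tnth n i + tnth j i | i < d].

Lemma esum_translate (n : d.-tuple int) (a : d.-tuple int -> \bar R) :
  \esum_(k in [set: d.-tuple int]) a k = \esum_(j in [set: d.-tuple int]) a (zadd n j).
Proof.
apply: (reindex_esum setT setT); split => //.
- move=> j k _ _ /(congr1 (fun t => tnth t)) E; apply: eq_from_tnth => i.
  by have := congr1 (fun t => t i) E; rewrite !tnth_mktuple => /addrI.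
- move=> k _; exists [tuple tnth k i - tnth n i | i < d] => //.
  by apply: eq_from_tnth => i; rewrite !tnth_mktuple addrC subrK.
Qed.

End lattice.

Section unit_cube.
Context {R : realType}.

Lemma integral_tcube d : (\int[lebesgue_tuple d]_z (\1_(@tcube R d) z)%:E = 1)%E.
Proof.
elim: d => [|d IH].
  rewrite integral_tuple0; last by apply/measurable_EFinP; apply: measurable_indic; exact: measurable_tcube.
  by rewrite indicE mem_set// => -[].
rewrite ge0_integral_tcons//; last first.
  by apply/measurable_EFinP; apply: measurable_indic; exact: measurable_tcube.
have mc : measurable_fun setT (fun y => (\1_(@tcube R d) y)%:E : \bar R).
  by apply/measurable_EFinP; apply: measurable_indic; exact: measurable_tcube.
under eq_integral => x _.
  under eq_integral do rewrite indic_tcube_tcons EFinM.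
  rewrite ge0_integralZl//= IH mule1.
  over.
rewrite integral_indic//= setIT.
transitivity (lebesgue_measure (`[0, 1]%classic : set R)); first by [].
by rewrite lebesgue_measure_itv/= lte_fin ltr01 oppr0 adde0.
Qed.

Lemma measure_tcube d : lebesgue_tuple d (@tcube R d) = 1%E.
Proof. by rewrite -(integral_tcube d) integral_indic ?setIT//; exact: measurable_tcube. Qed.

End unit_cube.

Section smoothing.
Context {R : realType} {d : nat}.
Notation lebT := (@lebesgue_tuple R d).
Notation leb2 := (prodm lebT lebT).
Variable a : R.
Hypothesis a0 : 0 < a.
Implicit Types F G : d.-tuple R -> R.

(** The mean of [F (t + xi_n)], the same for every [n]. *)
Definition smooth F (t : d.-tuple R) : \bar R :=
  (\int[lebT]_x ((F (tadd t x))%:E * (gauss_density a x)%:E))%E.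

Lemma smoothE F t : measurable_fun setT F -> (forall x, 0 <= F x) ->
  smooth F t = (\int[lebT]_x (F x * gauss_density a (tsub x t))%:E)%E.
Proof.
move=> mF F0.
have := @ge0_integral_taffine R d 1 t (fun x => (F x * gauss_density a (tsub x t))%:E) ltr01.
rewrite invr1 expr1n mul1e => <-; last 2 first.
- apply/measurable_EFinP; apply: measurable_funM => //.
  by apply/measurable_EFinP; exact: measurable_gauss_tsub_l.
- by move=> x; rewrite lee_fin mulr_ge0 ?gauss_density_ge0.
apply: eq_integral => x _; rewrite -EFinM.
have -> : tadd (tscale 1 x) t = tadd t x by apply: eq_from_tnth => i; rewrite !tnth_mktuple; ring.
congr (_ * gauss_density a _)%:E.
by apply: eq_from_tnth => i; rewrite !tnth_mktuple; ring.
Qed.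

Lemma smooth_ge0 F t : (forall x, 0 <= F x) -> (0 <= smooth F t)%E.
Proof. by move=> F0; apply: integral_ge0 => x _; rewrite mule_ge0 ?lee_fin ?gauss_density_ge0. Qed.

Lemma measurable_smooth F : measurable_fun setT F -> (forall x, 0 <= F x) -> measurable_fun setT (smooth F).
Proof.
move=> mF F0; rewrite (_ : smooth F = fun t => \int[lebT]_x (F x * gauss_density a (tsub x t))%:E)%E; last first.
  by apply/funext => t; exact: smoothE.
apply: (@measurable_fun_fubini_tonelli_F _ _ (d.-tuple R) (d.-tuple R) R lebT (fun z => (F z.2 * gauss_density a (tsub z.2 z.1))%:E)) => //.
- apply/measurable_EFinP; apply: measurable_funM; first exact: (measurableT_comp mF).
  by apply: (measurableT_comp (measurable_gauss_density a0)); exact: measurable_tsub.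
- by move=> z; rewrite lee_fin mulr_ge0 ?gauss_density_ge0.
Qed.

Lemma integral_smooth F : measurable_fun setT F -> (forall x, 0 <= F x) ->
  (\int[lebT]_t smooth F t = \int[lebT]_x (F x)%:E)%E.
Proof.
move=> mF F0; under eq_integral do rewrite smoothE//.
have mFE : measurable_fun setT (fun x => (F x)%:E) by apply/measurable_EFinP.
rewrite -(integral2_gauss_l a0 mFE); last by move=> x; rewrite lee_fin.
rewrite /prodm fubini_tonelli2//; last 2 first.
- by apply: emeasurable_funM; [exact: (measurableT_comp mFE)|exact: measurable_gauss_tsub].
- by move=> z; rewrite mule_ge0 ?lee_fin ?gauss_density_ge0.
Qed.

Lemma gauss_density_conv (x y : d.-tuple R) :
  (\int[lebT]_t (gauss_density a (tsub x t) * gauss_density a (tsub y t))%:E =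
   (gauss_density (2 * a) (tsub x y))%:E)%E.
Proof.
have a2 : 0 < 2 * a by rewrite mulr_gt0.
pose q (i : 'I_d) (u : R) := gauss1 a (tnth x i - u) * gauss1 a (tnth y i - u).
have mg (v : R) : measurable_fun [set: R] (fun u => gauss1 a (v - u)).
  by apply: (measurableT_comp (measurable_gauss1 _)); exact: measurable_funB.
rewrite gauss_densityE//; under eq_bigr do rewrite !tnth_mktuple mulN1r.
rewrite -(@integral_tuple_prod R d q).
- apply: eq_integral => t _; rewrite !gauss_densityE// -big_split/=; congr EFin.
  by apply: eq_bigr => i _; rewrite !tnth_mktuple !mulN1r.
- by move=> i; exact: measurable_funM.
- by move=> i u; rewrite mulr_ge0 ?gauss1_ge0.
- by move=> i; exact: integral_gauss1_conv.
Qed.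

(** After Tonelli's theorem [t] occurs only in the two Gaussian factors, and [gauss_density_conv]
    integrates it out. *)
Lemma integral_smooth_mul F G (s : d.-tuple R) : measurable_fun setT F -> measurable_fun setT G ->
  (forall x, 0 <= F x) -> (forall x, 0 <= G x) ->
  (\int[lebT]_t (smooth F t * smooth G (tadd t s)) =
   \int[leb2]_z (F z.1 * G z.2 * gauss_density (2 * a) (tadd (tsub z.1 z.2) s))%:E)%E.
Proof.
move=> mF mG F0 G0.
have mq (t : d.-tuple R) : measurable_fun setT (fun x => gauss_density a (tsub x t)).
  by apply/measurable_EFinP; exact: measurable_gauss_tsub_l.
have q0 (x : d.-tuple R) : 0 <= gauss_density a x := gauss_density_ge0 a x.
transitivity (\int[lebT]_t \int[leb2]_z (F z.1 * G z.2 * (gauss_density a (tsub z.1 t) * gauss_density a (tsub (tsub z.2 s) t)))%:E)%E.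
  apply: eq_integral => t _; rewrite !smoothE// muleC -ge0_integralZl//; last 3 first.
  - by apply/measurable_EFinP; exact: measurable_funM.
  - by move=> x _; rewrite lee_fin mulr_ge0.
  - by apply: integral_ge0 => x _; rewrite lee_fin mulr_ge0.
  rewrite ge0_integral_prodm//; last 2 first.
  - apply/measurable_EFinP; apply: measurable_funM.
      by apply: measurable_funM; [exact: (measurableT_comp mF)|exact: (measurableT_comp mG)].
    apply: measurable_funM; apply: (measurableT_comp (mq t)) => //.
    exact: measurable_tsub.
  - by move=> z; rewrite lee_fin; apply: mulr_ge0; apply: mulr_ge0.
  apply: eq_integral => x _ /=.
  have mGs : measurable_fun setT (fun y => (G y * gauss_density a (tsub y (tadd t s)))%:E).
    by apply/measurable_EFinP; exact: measurable_funM.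
  have Gs0 y : setT y -> (0 <= (G y * gauss_density a (tsub y (tadd t s)))%:E)%E.
    by move=> _; rewrite lee_fin mulr_ge0.
  have c0 : (0 <= (F x * gauss_density a (tsub x t))%:E)%E by rewrite lee_fin mulr_ge0.
  rewrite muleC -(ge0_integralZl lebT measurableT mGs Gs0 c0).
  apply: eq_integral => y _; rewrite -EFinM/=; congr EFin.
  have -> : tsub y (tadd t s) = tsub (tsub y s) t.
    by apply: eq_from_tnth => i; rewrite !tnth_mktuple; ring.
  by ring.
rewrite (@fubini_tonelli _ _ _ _ R lebT leb2 (fun p : d.-tuple R * (d.-tuple R * d.-tuple R) =>
  (F p.2.1 * G p.2.2 * (gauss_density a (tsub p.2.1 p.1) * gauss_density a (tsub (tsub p.2.2 s) p.1)))%:E)); last 2 first.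
- have m1 : measurable_fun setT (fun p : d.-tuple R * (d.-tuple R * d.-tuple R) => p.2.1).
    exact: (measurableT_comp measurable_fst measurable_snd).
  have m2 : measurable_fun setT (fun p : d.-tuple R * (d.-tuple R * d.-tuple R) => p.2.2).
    exact: (measurableT_comp measurable_snd measurable_snd).
  apply/measurable_EFinP; apply: measurable_funM.
    by apply: measurable_funM; [exact: (measurableT_comp mF)|exact: (measurableT_comp mG)].
  apply: measurable_funM; apply: (measurableT_comp (measurable_gauss_density a0)); apply: measurable_tsub => //.
  exact: measurable_tsub.
- by move=> p; rewrite lee_fin; apply: mulr_ge0; apply: mulr_ge0.
apply: eq_integral => z _; rewrite EFinM.
have -> : tadd (tsub z.1 z.2) s = tsub z.1 (tsub z.2 s).
  by apply: eq_from_tnth => i; rewrite !tnth_mktuple; ring.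
rewrite -gauss_density_conv -ge0_integralZl//.
- by apply/measurable_EFinP; apply: measurable_funM; apply: (measurableT_comp (measurable_gauss_density a0)); exact: measurable_tsub.
- by move=> t _; rewrite lee_fin mulr_ge0.
- by rewrite lee_fin mulr_ge0.
Qed.

End smoothing.

Section esum_offdiag.
Context {R : realType} {I : countType}.
Local Open Scope ereal_scope.

(** An additive form of replacing the diagonal terms: the sums may be infinite, so each side
    receives the diagonal of the other instead of losing its own. *)
Lemma esum_offdiag (u v : I -> I -> \bar R) : (forall n k, 0 <= u n k) -> (forall n k, 0 <= v n k) ->
  (forall n k, n != k -> u n k = v n k) ->
  \esum_(n in [set: I]) \esum_(k in [set: I]) u n k + \esum_(n in [set: I]) v n n =
  \esum_(n in [set: I]) u n n + \esum_(n in [set: I]) \esum_(k in [set: I]) v n k.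
Proof.
move=> u0 v0 uv.
have diag (w : I -> I -> \bar R) : (forall n k, 0 <= w n k) ->
    \esum_(n in [set: I]) w n n = \esum_(n in [set: I]) \esum_(k in [set: I]) (if k == n then w k k else 0).
  by move=> w0; apply: eq_esum => n _; rewrite (@esum_diag R I (fun k => w k k)).
rewrite (diag v)// (diag u)//.
have ge0 (w : I -> I -> \bar R) n k : (forall n k, 0 <= w n k) -> 0 <= (if k == n then w k k else 0).
  by move=> w0; case: ifP.
rewrite -!esumD; try by move=> n _; apply: esum_ge0 => k _ //; exact: ge0.
apply: eq_esum => n _; rewrite -!esumD; try by move=> k _ //; exact: ge0.
apply: eq_esum => k _; case: eqP => [->|/eqP kn]; first by rewrite addeC.
by rewrite adde0 add0e uv// eq_sym.
Qed.

End esum_offdiag.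

(** * First and second moments of nonnegative lattice sums *)

Section perturbed_lattice_moments.
Context {R : realType} {d : nat} {disp : measure_display} {Omega : measurableType disp}.
Variables (P : probability Omega R) (a : R).
Variables (xi : d.-tuple int -> {RV P >-> d.-tuple R}) (zeta : {RV P >-> d.-tuple R}).
Notation lebT := (@lebesgue_tuple R d).
Notation leb2 := (prodm lebT lebT).
Hypothesis a0 : 0 < a.
Hypothesis xi_density : forall n, has_density lebT (xi n) (gauss_density a).
Hypothesis zeta_unif : uniform_on lebT zeta tcube.
Hypothesis indep : mutually_independent
  (fun k : option (d.-tuple int) => if k is Some n then xi n else zeta).

Import finmap.

Lemma indep_zeta_xi_xi (n k : d.-tuple int) (A B C : set (d.-tuple R)) : n != k -> measurable A -> measurable B -> measurable C ->
  P (zeta @^-1` A `&` (xi n @^-1` B `&` xi k @^-1` C)) =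
  (P (zeta @^-1` A) * (P (xi n @^-1` B) * P (xi k @^-1` C)))%E.
Proof.
move=> nk mA mB mC.
pose S (o : option (d.-tuple int)) := if o is Some m then (if m == n then B else C) else A.
have mS o : measurable (S o) by case: o => [m|] //=; case: ifP.
have := indep (None |` (Some n |` [fset Some k]))%fset mS.
rewrite bigcap_fset !big_fsetU1 ?big_seq_fset1 ?inE//=.
by rewrite eqxx eq_sym (negbTE nk).
Qed.

Lemma indep_zeta_xi (n : d.-tuple int) (A B : set (d.-tuple R)) : measurable A -> measurable B ->
  P (zeta @^-1` A `&` xi n @^-1` B) = (P (zeta @^-1` A) * P (xi n @^-1` B))%E.
Proof.
move=> mA mB.
pose S (o : option (d.-tuple int)) := if o is Some m then B else A.
have mS o : measurable (S o) by case: o.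
have := indep (None |` [fset Some n])%fset mS.
by rewrite bigcap_fset !big_fsetU1 ?big_seq_fset1 ?inE.
Qed.

Lemma indep_xi_xi (n k : d.-tuple int) (B C : set (d.-tuple R)) : n != k -> measurable B -> measurable C ->
  P (xi n @^-1` B `&` xi k @^-1` C) = (P (xi n @^-1` B) * P (xi k @^-1` C))%E.
Proof.
move=> nk mB mC; have := indep_zeta_xi_xi nk measurableT mB mC.
by rewrite preimage_setT setTI probability_setT mul1e.
Qed.

Let mcube : measurable_fun setT (\1_(@tcube R d) : d.-tuple R -> R).
Proof. by apply: measurable_indic; exact: measurable_tcube. Qed.

Lemma ge0_integral_zeta (f : d.-tuple R -> \bar R) : measurable_fun setT f -> (forall x, 0 <= f x)%E ->
  (\int[distribution P zeta]_z f z = \int[lebT]_z (f z * (\1_(@tcube R d) z)%:E))%E.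
Proof.
move=> mf f0; apply: ge0_integral_density => // A mA.
transitivity (lebT (A `&` tcube)).
  apply: (eq_trans (zeta_unif mA)).
  rewrite (_ : fine _ = 1); last exact: (congr1 fine (@measure_tcube R d)).
  by rewrite invr1 mul1e.
by rewrite setIC; apply/esym; apply: integral_indic => //; exact: measurable_tcube.
Qed.

Lemma ge0_integral_xi n (f : d.-tuple R -> \bar R) : measurable_fun setT f -> (forall x, 0 <= f x)%E ->
  (\int[distribution P (xi n)]_z f z = \int[lebT]_z (f z * (gauss_density a z)%:E))%E.
Proof.
move=> mf f0; apply: ge0_integral_density => //.
- exact: measurable_gauss_density.
- exact: gauss_density_ge0.
- exact: xi_density.
Qed.

Notation point := (stationarized_point xi zeta).

Lemma pointE n w : point n w = tadd (tadd (tint n) (zeta w)) (xi n w).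
Proof. by apply: eq_from_tnth => i; rewrite !tnth_mktuple; ring. Qed.

Lemma measurable_point n : measurable_fun setT (point n).
Proof. by apply: measurable_tadd => //; apply: measurable_tadd. Qed.

Definition lattice_sum (F : d.-tuple R -> R) (w : Omega) : \bar R :=
  \esum_(n in [set: d.-tuple int]) (F (point n w))%:E.

Section one_function.
Variable F : d.-tuple R -> R.
Hypotheses (mF : measurable_fun setT F) (F0 : forall x, 0 <= F x).

Let mFE : measurable_fun setT (EFin \o F). Proof. exact/measurable_EFinP. Qed.

Lemma measurable_lattice_sum : measurable_fun setT (lattice_sum F).
Proof.
apply: measurable_esum => [n|n w]; last by rewrite lee_fin.
by apply: (measurableT_comp mFE); exact: measurable_point.
Qed.

Lemma lattice_sum_ge0 w : (0 <= lattice_sum F w)%E.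
Proof. by apply: esum_ge0 => n _; rewrite lee_fin. Qed.

Lemma integral_point n :
  (\int[P]_w (F (point n w))%:E = \int[lebT]_z (smooth a F (tadd (tint n) z) * (\1_(@tcube R d) z)%:E))%E.
Proof.
have mG : measurable_fun setT (fun p : d.-tuple R * d.-tuple R => (F (tadd (tadd (tint n) p.1) p.2))%:E).
  apply: (measurableT_comp mFE); apply: measurable_tadd => //; exact: measurable_tadd.
have := ge0_integral_rvpair (P := P) (X := zeta) (Y := xi n) (indep_zeta_xi n) mG.
rewrite (_ : (\int[P]_w _) = \int[P]_w (F (point n w))%:E)%E => [->|]; last first.
- by apply: eq_integral => w _; rewrite pointE.
- by move=> z; rewrite lee_fin.
have mSF := measurable_smooth a0 mF F0.
transitivity (\int[distribution P zeta]_z smooth a F (tadd (tint n) z))%E.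
  apply: eq_integral => z _; rewrite ge0_integral_xi//; last by move=> x; rewrite lee_fin.
  exact: (measurableT_comp mG (pair1_measurable z)).
rewrite ge0_integral_zeta//; last by move=> z; exact: smooth_ge0.
by apply: (measurableT_comp mSF); exact: measurable_tadd.
Qed.

Let mSF : measurable_fun setT (smooth a F). Proof. exact: measurable_smooth. Qed.

(** The lattice index and the uniform variable together run over R^d, and convolution with a
    probability density preserves the integral. *)
Lemma esum_integral_point :
  (\esum_(n in [set: d.-tuple int]) \int[P]_w (F (point n w))%:E = \int[lebT]_x (F x)%:E)%E.
Proof.
under eq_esum do rewrite integral_point.
rewrite -(ge0_integral_unfold mSF); last by move=> x; exact: smooth_ge0.
exact: integral_smooth.
Qed.

Lemma integral_lattice_sum : (\int[P]_w lattice_sum F w = \int[lebT]_x (F x)%:E)%E.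
Proof.
rewrite ge0_integral_esum; [exact: esum_integral_point| |by move=> n w; rewrite lee_fin].
by move=> n; apply: (measurableT_comp mFE); exact: measurable_point.
Qed.

End one_function.

Section two_functions.
Variables F G : d.-tuple R -> R.
Hypotheses (mF : measurable_fun setT F) (F0 : forall x, 0 <= F x).
Hypotheses (mG : measurable_fun setT G) (G0 : forall x, 0 <= G x).

Let mFE : measurable_fun setT (EFin \o F). Proof. exact/measurable_EFinP. Qed.
Let mGE : measurable_fun setT (EFin \o G). Proof. exact/measurable_EFinP. Qed.
Let mSF : measurable_fun setT (smooth a F). Proof. exact: measurable_smooth. Qed.
Let mSG : measurable_fun setT (smooth a G). Proof. exact: measurable_smooth. Qed.
Let SF0 x : (0 <= smooth a F x)%E. Proof. exact: smooth_ge0. Qed.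
Let SG0 x : (0 <= smooth a G x)%E. Proof. exact: smooth_ge0. Qed.

(* What [E (F (point n) * G (point k))] would be for all [n] and [k], including [n = k],
   if the two displacements were independent. *)
Let psi n k : \bar R :=
  (\int[lebT]_z (smooth a F (tadd (tint n) z) * smooth a G (tadd (tint k) z) * (\1_(@tcube R d) z)%:E))%E.

Let T n k : \bar R := (\int[P]_w ((F (point n w))%:E * (G (point k w))%:E))%E.

Let psi0 n k : (0 <= psi n k)%E.
Proof. by apply: integral_ge0 => z _; rewrite !mule_ge0// lee_fin. Qed.

Let T0 n k : (0 <= T n k)%E.
Proof. by apply: integral_ge0 => z _; rewrite mule_ge0// lee_fin. Qed.

Let T_offdiag n k : n != k -> T n k = psi n k.
Proof.
move=> nk.
pose Q (p : d.-tuple R * (d.-tuple R * d.-tuple R)) :=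
  ((F (tadd (tadd (tint n) p.1) p.2.1))%:E * (G (tadd (tadd (tint k) p.1) p.2.2))%:E)%E.
have mQ : measurable_fun setT Q.
  have m1 : measurable_fun setT (fun p : d.-tuple R * (d.-tuple R * d.-tuple R) => p.2.1).
    exact: (measurableT_comp measurable_fst measurable_snd).
  have m2 : measurable_fun setT (fun p : d.-tuple R * (d.-tuple R * d.-tuple R) => p.2.2).
    exact: (measurableT_comp measurable_snd measurable_snd).
  apply: emeasurable_funM; [apply: (measurableT_comp mFE)|apply: (measurableT_comp mGE)];
    apply: measurable_tadd => //; exact: measurable_tadd.
have Q0 p : (0 <= Q p)%E by rewrite mule_ge0// lee_fin.
have := ge0_integral_rvtriple (P := P) (X := zeta) (Y := xi n) (Z := xi k)
  (fun B C => @indep_xi_xi n k B C nk) (fun A B C => @indep_zeta_xi_xi n k A B C nk) mQ Q0.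
rewrite (_ : (\int[P]_w _)%E = T n k) => [->|]; last first.
  by apply: eq_integral => w _; rewrite !pointE.
have shiftm (H : d.-tuple R -> R) (m : d.-tuple int) z : measurable_fun setT H ->
    measurable_fun setT (fun x => (H (tadd (tadd (tint m) z) x))%:E).
  move=> mH; apply/measurable_EFinP; apply: (measurableT_comp mH); apply: measurable_tadd => //.
have mgE : measurable_fun setT (fun x => (@gauss_density R d a x)%:E).
  by apply/measurable_EFinP; exact: measurable_gauss_density.
have inner z : (\int[distribution P (xi n)]_x \int[distribution P (xi k)]_y Q (z, (x, y)) =
    smooth a F (tadd (tint n) z) * smooth a G (tadd (tint k) z))%E.
  transitivity (\int[distribution P (xi n)]_x ((F (tadd (tadd (tint n) z) x))%:E * smooth a G (tadd (tint k) z)))%E.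
    apply: eq_integral => x _; rewrite /Q/= ge0_integralZl//; last 3 first.
    - exact: shiftm.
    - by move=> y _; rewrite lee_fin.
    - by rewrite lee_fin.
    rewrite ge0_integral_xi//; last by move=> y; rewrite lee_fin.
    exact: shiftm.
  rewrite ge0_integralZr//; last 2 first.
  - exact: shiftm.
  - by move=> x _; rewrite lee_fin.
  rewrite ge0_integral_xi//; last by move=> y; rewrite lee_fin.
  exact: shiftm.
under eq_integral do rewrite inner.
rewrite ge0_integral_zeta//.
- apply: emeasurable_funM; [apply: (measurableT_comp mSF)|apply: (measurableT_comp mSG)]; exact: measurable_tadd.
- by move=> z; rewrite mule_ge0.
Qed.

(** With the difference [j] of the two lattice indices held fixed, the sum over [n] unfolds the cube
    into the whole space. *)
Let esum_psi_shift j :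
  (\esum_(n in [set: d.-tuple int]) psi n (zadd n j) =
   \int[leb2]_z (F z.1 * G z.2 * gauss_density (2 * a) (tadd (tsub z.1 z.2) (tint j)))%:E)%E.
Proof.
rewrite -integral_smooth_mul//.
have mK : measurable_fun setT (fun t => smooth a F t * smooth a G (tadd t (tint j)))%E.
  by apply: emeasurable_funM => //; apply: (measurableT_comp mSG); exact: measurable_tadd.
have K0 x : (0 <= smooth a F x * smooth a G (tadd x (tint j)))%E by rewrite mule_ge0.
rewrite (ge0_integral_unfold mK K0).
apply: eq_esum => n _; apply: eq_integral => z _; congr (_ * _)%E; congr (_ * _)%E.
by congr (smooth a G _); apply: eq_from_tnth => i; rewrite !tnth_mktuple intrD; ring.
Qed.

(** Reindexing by [k = n + j] and summing over [n] first leaves a sum over [j], which periodizes the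
    Gaussian density into [theta_tuple]. *)
Let esum_psi :
  (\esum_(n in [set: d.-tuple int]) \esum_(k in [set: d.-tuple int]) psi n k =
   \int[leb2]_z (F z.1 * G z.2 * theta_tuple (2 * a) (tsub z.1 z.2))%:E)%E.
Proof.
have a2 : 0 < 2 * a by rewrite mulr_gt0.
under eq_esum => n _ do rewrite (esum_translate n).
rewrite (@esum_exchange R _ _ (fun n j => psi n (zadd n j)) (fun n j => psi0 _ _)).
under eq_esum do rewrite esum_psi_shift.
rewrite -ge0_integral_esum.
- apply: eq_integral => z _; rewrite EFinM -esum_gauss_density// -esumZl ?mulr_ge0//.
  by move=> j; rewrite lee_fin gauss_density_ge0.
- move=> j; apply/measurable_EFinP; apply: measurable_funM.
    by apply: measurable_funM; [exact: (measurableT_comp mF)|exact: (measurableT_comp mG)].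
  apply: (measurableT_comp (measurable_gauss_density a2)); apply: measurable_tadd => //.
  exact: measurable_tsub.
- by move=> j z; rewrite lee_fin mulr_ge0 ?gauss_density_ge0// mulr_ge0.
Qed.

Let esum_psi_diag :
  (\esum_(n in [set: d.-tuple int]) psi n n =
   \int[leb2]_z (F z.1 * G z.2 * gauss_density (2 * a) (tsub z.1 z.2))%:E)%E.
Proof.
have z0 n : zadd n [tuple 0 | i < d] = n.
  by apply: eq_from_tnth => i; rewrite !tnth_mktuple addr0.
rewrite -(eq_esum (fun n _ => congr1 (psi n) (z0 n))) esum_psi_shift.
apply: eq_integral => z _; congr (_ * gauss_density _ _)%:E.
by apply: eq_from_tnth => i; rewrite !tnth_mktuple addr0.
Qed.

Let esum_T : (\esum_(n in [set: d.-tuple int]) \esum_(k in [set: d.-tuple int]) T n k =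
  \int[P]_w (lattice_sum F w * lattice_sum G w))%E.
Proof.
have mp (H : d.-tuple R -> R) n : measurable_fun setT H -> measurable_fun setT (fun w => (H (point n w))%:E).
  by move=> mH; apply/measurable_EFinP; apply: (measurableT_comp mH); exact: measurable_point.
transitivity (\esum_(n in [set: d.-tuple int]) \int[P]_w ((F (point n w))%:E * lattice_sum G w))%E.
  apply: eq_esum => n _; rewrite -ge0_integral_esum.
  - apply: eq_integral => w _; rewrite esumZl_ereal ?lee_fin// => k.
    by rewrite lee_fin.
  - by move=> k; apply: emeasurable_funM; exact: mp.
  - by move=> k w; rewrite mule_ge0 ?lee_fin.
rewrite -ge0_integral_esum.
- apply: eq_integral => w _; rewrite muleC -esumZl_ereal.
  + by apply: eq_esum => n _; rewrite muleC.
  + exact: lattice_sum_ge0.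
  + by move=> n; rewrite lee_fin.
- by move=> n; apply: emeasurable_funM; [exact: mp|exact: measurable_lattice_sum].
- by move=> n w; rewrite mule_ge0 ?lee_fin ?lattice_sum_ge0.
Qed.

(** The Gaussian term on the left is the diagonal sum of [psi]; it stays there until [moment2],
    where integrability makes it finite and subtraction legitimate. *)
Lemma integral_lattice_sum_mul :
  (\int[P]_w (lattice_sum F w * lattice_sum G w) +
     \int[leb2]_z (F z.1 * G z.2 * gauss_density (2 * a) (tsub z.1 z.2))%:E =
   \int[lebT]_x (F x * G x)%:E +
     \int[leb2]_z (F z.1 * G z.2 * theta_tuple (2 * a) (tsub z.1 z.2))%:E)%E.
Proof.
have diagT : (\esum_(n in [set: d.-tuple int]) T n n = \int[lebT]_x (F x * G x)%:E)%E.
  rewrite -(@esum_integral_point (fun x => F x * G x)).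
  - by apply: eq_esum => n _; apply: eq_integral => w _; rewrite EFinM.
  - exact: measurable_funM.
  - by move=> x; rewrite mulr_ge0.
rewrite -esum_T -esum_psi_diag -diagT -esum_psi.
exact: (@esum_offdiag R _ T psi T0 psi0 T_offdiag).
Qed.

End two_functions.

End perturbed_lattice_moments.

Section theta_bound.
Context {R : realType} {d : nat}.
Variable b : R.
Hypothesis b0 : 0 < b.

Lemma measurable_theta_tuple : measurable_fun setT (@theta_tuple R d b).
Proof. by apply: (@measurable_tuple_prod _ _ (fun=> theta b)) => i; exact: measurable_theta. Qed.

Lemma theta_tuple_ge0 (t : d.-tuple R) : 0 <= theta_tuple b t.
Proof. by apply: prodr_ge0 => i _; exact: theta_ge0. Qed.

(** Poisson summation at the phase [pi] writes the difference of the two sides as a sum of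
    nonnegative terms. *)
Lemma theta_tuple_le (t : d.-tuple R) : `|theta_tuple b t| <= theta b 0 ^+ d.
Proof.
rewrite ger0_norm ?theta_tuple_ge0// -subr_ge0 -lee_fin.
have := @poisson_tuple R d b pi t b0; rewrite cospi mulN1r => <-.
by apply: esum_ge0 => m _; rewrite lee_fin mulr_ge0 ?expR_ge0// -lerBlDl sub0r cos_geN1.
Qed.

End theta_bound.

(** * Variance of the signed statistic *)

Section lattice_sum_moments.
Context {R : realType} {d : nat} {disp : measure_display} {Omega : measurableType disp}.
Variables (P : probability Omega R) (a : R).
Variables (xi : d.-tuple int -> {RV P >-> d.-tuple R}) (zeta : {RV P >-> d.-tuple R}).
Notation lebT := (@lebesgue_tuple R d).
Notation leb2 := (prodm lebT lebT).
Hypothesis a0 : 0 < a.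
Hypothesis xi_density : forall n, has_density lebT (xi n) (gauss_density a).
Hypothesis zeta_unif : uniform_on lebT zeta tcube.
Hypothesis indep : mutually_independent
  (fun k : option (d.-tuple int) => if k is Some n then xi n else zeta).

Let U (F : d.-tuple R -> R) w : R := fine (lattice_sum xi zeta F w).

Section one_function.
Variable F : d.-tuple R -> R.
Hypothesis (F0 : forall x, 0 <= F x) (Fi : lebT.-integrable setT (EFin \o F)).

Let mF : measurable_fun setT F.
Proof. by apply/measurable_EFinP; exact: measurable_int Fi. Qed.

Lemma measurable_fine_lattice_sum : measurable_fun setT (U F).
Proof. by apply: (measurableT_comp (fine_measurable _)) => //; exact: measurable_lattice_sum. Qed.

Lemma fine_lattice_sum_ge0 w : 0 <= U F w.
Proof. by apply: fine_ge0; exact: lattice_sum_ge0. Qed.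

Lemma integrable_lattice_sum : P.-integrable setT (lattice_sum xi zeta F).
Proof.
apply/integrableP; split; first exact: measurable_lattice_sum.
under eq_integral do rewrite gee0_abs ?lattice_sum_ge0//.
rewrite (integral_lattice_sum a0 xi_density zeta_unif indep mF F0).
by rewrite EFin_Rintegral// ltry.
Qed.

Lemma lattice_sum_fin : {ae P, forall w, lattice_sum xi zeta F w \is a fin_num}.
Proof.
by apply: filterS (integrable_ae measurableT integrable_lattice_sum) => w /(_ I).
Qed.

End one_function.

Lemma moment2 F G : (forall x, 0 <= F x) -> (forall x, 0 <= G x) ->
  lebT.-integrable setT (EFin \o F) -> lebT.-integrable setT (EFin \o G) ->
  lebT.-integrable setT (EFin \o (fun x => F x * G x)) ->
  P.-integrable setT (EFin \o (fun w => U F w * U G w)) /\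
  \int[P]_w (U F w * U G w) = \int[lebT]_x (F x * G x) +
    (bilin F G (theta_tuple (2 * a)) - bilin F G (gauss_density (2 * a))).
Proof.
move=> F0 G0 Fi Gi FGi.
have a2 : 0 < 2 * a by rewrite mulr_gt0.
have mF : measurable_fun setT F by apply/measurable_EFinP; exact: measurable_int Fi.
have mG : measurable_fun setT G by apply/measurable_EFinP; exact: measurable_int Gi.
have := integral_lattice_sum_mul a0 xi_density zeta_unif indep mF F0 mG G0.
rewrite [in X in _ = X -> _]EFin_Rintegral//.
rewrite (EFin_Rintegral _ (integrable_bilin Fi Gi (measurable_gauss_density a2) (fun t => gauss_density_le t a2)))//.
rewrite (EFin_Rintegral _ (integrable_bilin Fi Gi (measurable_theta_tuple (2 * a)) (theta_tuple_le a2)))//.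
rewrite -/(bilin F G _) -/(bilin F G _) => E.
have {}E : (\int[P]_w (lattice_sum xi zeta F w * lattice_sum xi zeta G w) =
    (\int[lebT]_x (F x * G x) + (bilin F G (theta_tuple (2 * a)) - bilin F G (gauss_density (2 * a))))%:E)%E.
  move/(congr1 (fun y => y - (bilin F G (gauss_density (2 * a)))%:E)%E): E.
  by rewrite addeK// => ->; rewrite addrA EFinB EFinD.
have mU : measurable_fun setT (fun w => (U F w * U G w)%:E).
  by apply/measurable_EFinP; apply: measurable_funM; exact: measurable_fine_lattice_sum.
have mA : measurable_fun setT (fun w => lattice_sum xi zeta F w * lattice_sum xi zeta G w)%E.
  by apply: emeasurable_funM; exact: measurable_lattice_sum.
(* Both sums are almost surely finite, and there [fine] is multiplicative. *)
have EU : (\int[P]_w (U F w * U G w)%:E =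
    \int[P]_w (lattice_sum xi zeta F w * lattice_sum xi zeta G w))%E.
  apply: ae_eq_integral => //.
  apply: filterS2 (lattice_sum_fin F0 Fi) (lattice_sum_fin G0 Gi) => w fF fG _.
  by rewrite EFinM !fineK.
split; last by rewrite /Rintegral EU E.
apply/integrableP; split => //.
rewrite (eq_integral (fun w => (U F w * U G w)%:E)); first by rewrite EU E ltry.
by move=> w _; rewrite /= ger0_norm// mulr_ge0// fine_lattice_sum_ge0.
Qed.

Variable H : d.-tuple R -> R.
Hypothesis Hi : lebT.-integrable setT (EFin \o H).
Hypothesis H2 : lebT.-integrable setT (EFin \o (fun x => H x ^+ 2)).

Let N w : R := rsum (fun n => H (stationarized_point xi zeta n w)).
Let Hp x := Num.max (H x) 0.
Let Hm x := Num.max (- H x) 0.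

Let mH : measurable_fun setT H.
Proof. by apply/measurable_EFinP; exact: measurable_int Hi. Qed.

Let Hp0 x : 0 <= Hp x. Proof. by rewrite /Hp le_max lexx orbT. Qed.
Let Hm0 x : 0 <= Hm x. Proof. by rewrite /Hm le_max lexx orbT. Qed.

Let HpE x : Hp x = if 0 <= H x then H x else 0.
Proof. by rewrite /Hp; case: ifPn => [h|]; [exact/max_idPl|rewrite -ltNge => /ltW/max_idPr]. Qed.

Let HmE x : Hm x = if 0 <= H x then 0 else - H x.
Proof.
rewrite /Hm; case: ifPn => [h|]; first by apply/max_idPr; rewrite oppr_le0.
by rewrite -ltNge => /ltW h; apply/max_idPl; rewrite oppr_ge0.
Qed.

Let mHp : measurable_fun setT Hp. Proof. exact: measurable_maxr. Qed.
Let mHm : measurable_fun setT Hm. Proof. by apply: measurable_maxr => //; apply: measurable_funN. Qed.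

Let HpHm x : H x = Hp x - Hm x.
Proof. by rewrite HpE HmE; case: ifP; rewrite ?subr0 ?sub0r ?opprK. Qed.

Let Hp_le x : `|Hp x| <= `|H x|.
Proof. by rewrite HpE; case: ifP => // _; rewrite normr0. Qed.

Let Hm_le x : `|Hm x| <= `|H x|.
Proof. by rewrite HmE; case: ifP => // _; rewrite ?normr0 ?normrN. Qed.

Let Hpi : lebT.-integrable setT (EFin \o Hp).
Proof. by apply: (@integrable_le_bounded _ _ _ lebT _ _ H 1) => // x _; rewrite mul1r. Qed.

Let Hmi : lebT.-integrable setT (EFin \o Hm).
Proof. by apply: (@integrable_le_bounded _ _ _ lebT _ _ H 1) => // x _; rewrite mul1r. Qed.

Let sq_i (F G : d.-tuple R -> R) : measurable_fun setT F -> measurable_fun setT G ->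
  (forall x, `|F x| <= `|H x|) -> (forall x, `|G x| <= `|H x|) ->
  lebT.-integrable setT (EFin \o (fun x => F x * G x)).
Proof.
move=> mF mG FH GH; apply: (@integrable_le_bounded _ _ _ lebT _ _ (fun x => H x ^+ 2) 1) => //.
  exact: measurable_funM.
by move=> x _; rewrite mul1r normrM normrX expr2 ler_pM.
Qed.

(** Almost surely the sums of the positive and negative parts are both finite, and then [fine] in
    [rsum] commutes with their difference. *)
Let N_ae : {ae P, forall w, N w = U Hp w - U Hm w}.
Proof.
apply: filterS2 (lattice_sum_fin Hp0 Hpi) (lattice_sum_fin Hm0 Hmi) => w fp fm.
rewrite /N /rsum -fineB//; congr (fine (_ - _)).
- by apply: eq_esum => n _; rewrite funeposE /Hp EFin_max.
- by apply: eq_esum => n _; rewrite funenegE /Hm EFin_max EFinN.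
Qed.

Let mN : measurable_fun setT N.
Proof.
apply: (measurableT_comp (fine_measurable _)) => //; apply: emeasurable_funB.
- rewrite (_ : (fun w => _) = lattice_sum xi zeta Hp); first exact: measurable_lattice_sum.
  by apply/funext => w; apply: eq_esum => n _; rewrite funeposE /Hp EFin_max.
- rewrite (_ : (fun w => _) = lattice_sum xi zeta Hm); first exact: measurable_lattice_sum.
  by apply/funext => w; apply: eq_esum => n _; rewrite funenegE /Hm EFin_max EFinN.
Qed.

Let ae_transfer (f g : Omega -> R) : measurable_fun setT f -> P.-integrable setT (EFin \o g) ->
  {ae P, forall w, f w = g w} -> P.-integrable setT (EFin \o f) /\ \int[P]_w f w = \int[P]_w g w.
Proof.
move=> mf gi fg; have mfE : measurable_fun setT (EFin \o f) by exact/measurable_EFinP.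
have mgE := measurable_int P gi.
have E : (\int[P]_w (f w)%:E = \int[P]_w (g w)%:E)%E.
  by apply: ae_eq_integral => //; apply: filterS fg => w ->.
split; last by rewrite /Rintegral E.
apply/integrableP; split => //; have [_] := integrableP _ _ _ gi.
rewrite (ae_eq_integral (abse \o (EFin \o f)))//; try exact: measurableT_comp.
by apply: filterS fg => w /= ->.
Qed.

Let moment1 F : (forall x, 0 <= F x) -> lebT.-integrable setT (EFin \o F) ->
  P.-integrable setT (EFin \o U F) /\ \int[P]_w U F w = \int[lebT]_x F x.
Proof.
move=> F0 Fi.
have mF : measurable_fun setT F by apply/measurable_EFinP; exact: measurable_int Fi.
have mU : measurable_fun setT (EFin \o U F).
  by apply/measurable_EFinP; exact: measurable_fine_lattice_sum.
have E : (\int[P]_w (U F w)%:E = (\int[lebT]_x F x)%:E)%E.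
  rewrite -EFin_Rintegral// -(integral_lattice_sum a0 xi_density zeta_unif indep mF F0).
  apply: ae_eq_integral => //; first exact: measurable_lattice_sum.
  by apply: filterS (lattice_sum_fin F0 Fi) => w fF _; rewrite fineK.
split; last by rewrite /Rintegral E.
apply/integrableP; split => //.
rewrite (eq_integral (fun w => (U F w)%:E)); first by rewrite E ltry.
by move=> w _; rewrite /= ger0_norm// fine_lattice_sum_ge0.
Qed.

Let N1 : P.-integrable setT (EFin \o N) /\ \int[P]_w N w = \int[lebT]_x H x.
Proof.
have [pi1 pE] := moment1 Hp0 Hpi; have [mi1 mE] := moment1 Hm0 Hmi.
have [Ni NE] := ae_transfer mN (integrable_funB measurableT pi1 mi1) N_ae.
split => //; rewrite NE RintegralB// pE mE -RintegralB//.
by apply: eq_Rintegral => x _; rewrite -HpHm.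
Qed.

(** Expanding the square of [U Hp - U Hm] produces mixed moments, the reason why [moment2] is stated
    for two functions; bilinearity reassembles the four results into quadratic forms of [H]. *)
Let N2 : P.-integrable setT (EFin \o (fun w => N w ^+ 2)) /\
  \int[P]_w (N w ^+ 2) = \int[lebT]_x (H x ^+ 2) +
    (quad H (theta_tuple (2 * a)) - quad H (gauss_density (2 * a))).
Proof.
have a2 : 0 < 2 * a by rewrite mulr_gt0.
have ppi := sq_i mHp mHp Hp_le Hp_le; have pmi := sq_i mHp mHm Hp_le Hm_le.
have mpi := sq_i mHm mHp Hm_le Hp_le; have mmi := sq_i mHm mHm Hm_le Hm_le.
have [i1 e1] := moment2 Hp0 Hp0 Hpi Hpi ppi; have [i2 e2] := moment2 Hp0 Hm0 Hpi Hmi pmi.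
have [i3 e3] := moment2 Hm0 Hp0 Hmi Hpi mpi; have [i4 e4] := moment2 Hm0 Hm0 Hmi Hmi mmi.
have mN2 : measurable_fun setT (fun w => N w ^+ 2) by exact: measurable_funX.
have i12 := integrable_funB measurableT i1 i2; have i34 := integrable_funB measurableT i3 i4.
have N2_ae : {ae P, forall w, N w ^+ 2 =
    (U Hp w * U Hp w - U Hp w * U Hm w) - (U Hm w * U Hp w - U Hm w * U Hm w)}.
  by apply: filterS N_ae => w ->; ring.
have [Ni NE] := ae_transfer mN2 (integrable_funB measurableT i12 i34) N2_ae.
split => //; rewrite NE RintegralB// !RintegralB// e1 e2 e3 e4.
have bilinE (K : d.-tuple R -> R) (B : R) : measurable_fun setT K -> (forall t, `|K t| <= B) ->
    quad H K = (bilin Hp Hp K - bilin Hp Hm K) - (bilin Hm Hp K - bilin Hm Hm K).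
  move=> mK KB.
  have j1 := integrable_bilin Hpi Hpi mK KB; have j2 := integrable_bilin Hpi Hmi mK KB.
  have j3 := integrable_bilin Hmi Hpi mK KB; have j4 := integrable_bilin Hmi Hmi mK KB.
  have j12 := integrable_funB measurableT j1 j2; have j34 := integrable_funB measurableT j3 j4.
  rewrite /quad /bilin -!RintegralB//; apply: eq_Rintegral => z _.
  by rewrite [H z.1]HpHm [H z.2]HpHm; ring.
rewrite (bilinE _ _ (measurable_theta_tuple (2 * a)) (theta_tuple_le a2)).
rewrite (bilinE _ _ (measurable_gauss_density a2) (fun t => gauss_density_le t a2)).
have -> : \int[lebT]_x (H x ^+ 2) = (\int[lebT]_x (Hp x * Hp x) - \int[lebT]_x (Hp x * Hm x)) -
    (\int[lebT]_x (Hm x * Hp x) - \int[lebT]_x (Hm x * Hm x)).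
  have k12 := integrable_funB measurableT ppi pmi; have k34 := integrable_funB measurableT mpi mmi.
  rewrite -!RintegralB//; apply: eq_Rintegral => x _.
  by rewrite [H x]HpHm; ring.
ring.
Qed.

Lemma variance_lattice : ('V_P[N] = (\int[lebT]_x (H x ^+ 2) +
    (quad H (theta_tuple (2 * a)) - quad H (gauss_density (2 * a))) - (\int[lebT]_x H x) ^+ 2)%:E)%E.
Proof.
have [i1 e1] := N1; have [i2 e2] := N2.
rewrite /variance covarianceE.
- rewrite unlock /= (EFin_Rintegral measurableT i1) e1 (_ : \int[P]_x _ = \int[P]_w (N w ^+ 2)%:E)%E; last first.
    by apply: eq_integral => w _; rewrite expr2.
  by rewrite EFin_Rintegral// e2 -EFinM -expr2 -EFinB.
- exact/Lfun1_integrable.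
- exact/Lfun1_integrable.
- by apply/Lfun1_integrable; apply: eq_integrable i2.
Qed.

End lattice_sum_moments.

(** * Scaling and the variance formula *)

Section scaling.
Context {R : realType} {d : nat}.
Notation lebT := (@lebesgue_tuple R d).

Lemma ge0_integral_tscale (c : R) (f : d.-tuple R -> \bar R) : 0 < c ->
  measurable_fun setT f -> (forall x, 0 <= f x)%E ->
  (\int[lebT]_x f (tscale c x) = (c^-1 ^+ d)%:E * \int[lebT]_x f x)%E.
Proof.
move=> c0 mf f0; rewrite -(ge0_integral_taffine [tuple 0 | i < d] c0 mf f0).
apply: eq_integral => x _; congr f.
by apply: eq_from_tnth => i; rewrite !tnth_mktuple addr0.
Qed.

Lemma integrable_tscale (c : R) (f : d.-tuple R -> R) : 0 < c ->
  lebT.-integrable setT (EFin \o f) -> lebT.-integrable setT (EFin \o (fun x => f (tscale c x))).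
Proof.
move=> c0 fi; have mf := measurable_int lebT fi.
have ms : measurable_fun setT (fun x : d.-tuple R => tscale c x) by exact: measurable_tscale.
apply/integrableP; split; first exact: (measurableT_comp mf).
rewrite (ge0_integral_tscale (f := abse \o (EFin \o f)))//; last 2 first.
- exact: measurableT_comp.
- by move=> x; exact: (abse_ge0 (f x)%:E).
have [_ foo] := integrableP _ _ _ fi.
apply: lte_mul_pinfty => //.
by rewrite lee_fin exprn_ge0// invr_ge0 ltW.
Qed.

Lemma Rintegral_tscale (c : R) (f : d.-tuple R -> R) : 0 < c ->
  lebT.-integrable setT (EFin \o f) ->
  \int[lebT]_x f (tscale c x) = c^-1 ^+ d * \int[lebT]_x f x.
Proof.
move=> c0 fi; have mf := measurable_int lebT fi.
have fp := integrable_funepos measurableT fi; have fn := integrable_funeneg measurableT fi.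
rewrite /Rintegral [in LHS]integralE [in RHS]integralE.
have -> : (\int[lebT]_x ((fun x => (f (tscale c x))%:E)^\+ x) = (c^-1 ^+ d)%:E * \int[lebT]_x ((EFin \o f)^\+ x))%E.
  rewrite -ge0_integral_tscale//; last exact: measurable_funepos.
  by apply: eq_integral => x _; rewrite !funeposE.
have -> : (\int[lebT]_x ((fun x => (f (tscale c x))%:E)^\- x) = (c^-1 ^+ d)%:E * \int[lebT]_x ((EFin \o f)^\- x))%E.
  rewrite -ge0_integral_tscale//; last exact: measurable_funeneg.
  by apply: eq_integral => x _; rewrite !funenegE.
have pf := integrable_fin_num measurableT fp; have nf := integrable_fin_num measurableT fn.
rewrite -muleBr//; last by rewrite fin_num_adde_defl ?fin_numN.
by rewrite fineM// fin_numB pf nf.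
Qed.

End scaling.

Section fourier_power_spectrum.
Context {R : realType} {d : nat}.
Notation lebT := (@lebesgue_tuple R d).
Variable h : d.-tuple R -> R.
Hypothesis hi : lebT.-integrable setT (EFin \o h).

Lemma normc_fourier (l : d.-tuple R) :
  Normc.normc (fourier (fun x => real_complex R (h x)) l) ^+ 2 = power_spectrum h l.
Proof.
rewrite /fourier /complex_integral /=.
have -> : \int[lebT]_x complex.Re (real_complex R (h x) * expi (- (2 * pi * tdot x l))) = fcos h l.
  by apply: eq_Rintegral => x _; rewrite /expi /= mul0r subr0 cosN.
have -> : \int[lebT]_x complex.Im (real_complex R (h x) * expi (- (2 * pi * tdot x l))) = - fsin h l.
  rewrite /fsin -mulN1r -RintegralZl//; last exact: integrable_mul_sin.
  by apply: eq_Rintegral => x _; rewrite /expi /= mul0r addr0 sinN mulrN mulN1r.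
by rewrite sqr_sqrtr ?addr_ge0 ?sqr_ge0// sqrrN.
Qed.

Variable r : R.
Hypothesis r0 : 0 < r.

Lemma tdot_tscale (x l : d.-tuple R) : tdot x (tscale r l) = tdot (tscale r x) l.
Proof. by apply: eq_bigr => i _; rewrite !tnth_mktuple; ring. Qed.

Lemma tscaleK (x : d.-tuple R) : tscale r (tscale r^-1 x) = x.
Proof. by apply: eq_from_tnth => i; rewrite !tnth_mktuple mulrA divff ?gt_eqF// mul1r. Qed.

(** The dilation multiplies the cosine and sine transforms by its Jacobian [r^d] and their frequency
    by [r]; squaring doubles the exponent. *)
Lemma power_spectrum_scale (l : d.-tuple R) :
  power_spectrum (fun x => h (tscale r^-1 x)) l = r ^+ (2 * d) * power_spectrum h (tscale r l).
Proof.
have ri : 0 < r^-1 by rewrite invr_gt0.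
rewrite /power_spectrum.
have -> : fcos (fun x => h (tscale r^-1 x)) l = r ^+ d * fcos h (tscale r l).
  rewrite /fcos -[r in RHS]invrK -(Rintegral_tscale ri); last exact: integrable_mul_cos.
  by apply: eq_Rintegral => x _; rewrite invrK tdot_tscale tscaleK.
have -> : fsin (fun x => h (tscale r^-1 x)) l = r ^+ d * fsin h (tscale r l).
  rewrite /fsin -[r in RHS]invrK -(Rintegral_tscale ri); last exact: integrable_mul_sin.
  by apply: eq_Rintegral => x _; rewrite invrK tdot_tscale tscaleK.
by rewrite mulnC exprM; ring.
Qed.

End fourier_power_spectrum.

Section lattice_zero.
Context {R : realType} {d : nat}.
Notation lebT := (@lebesgue_tuple R d).
Variable H : d.-tuple R -> R.
Hypothesis Hi : lebT.-integrable setT (EFin \o H).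

Let zero : d.-tuple int := nseq_tuple d 0%R.

Let tint_zero i : tnth (tint zero : d.-tuple R) i = 0.
Proof. by rewrite tnth_mktuple tnth_nseq. Qed.

Lemma power_spectrum_zero : power_spectrum H (tint zero) = (\int[lebT]_x H x) ^+ 2.
Proof.
have t0 x : tdot x (tint zero) = 0 :> R.
  by rewrite /tdot big1// => i _; rewrite tint_zero mulr0.
rewrite /power_spectrum.
have -> : fcos H (tint zero) = \int[lebT]_x H x.
  by apply: eq_Rintegral => x _; rewrite t0 mulr0 cos0 mulr1.
have -> : fsin H (tint zero) = 0.
  rewrite /fsin (@eq_Rintegral _ _ _ _ _ (fun=> 0)) ?Rintegral_cst ?mul0r//.
  by move=> x _; rewrite t0 mulr0 sin0 mulr0.
by rewrite expr0n addr0.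
Qed.

Lemma esum_power_spectrum_nonzero (b : R) : 0 < b ->
  (\esum_(m in [set m : d.-tuple int | m != nseq_tuple d 0%R])
     (expR (- (b * pi ^+ 2 * tnorm (tint m) ^+ 2)) * power_spectrum H (tint m))%:E =
   (quad H (theta_tuple b) - (\int[lebT]_x H x) ^+ 2)%:E)%E.
Proof.
move=> b0; set w := fun m : d.-tuple int => expR (- (b * pi ^+ 2 * tnorm (tint m) ^+ 2)) : R.
have := esum_power_spectrum Hi (g0 := theta b 0 ^+ d) (measurable_theta_tuple b) (theta_tuple_le b0)
  (w := w) (fun m => expR_ge0 _) (fun c t => poisson_tuple c t b0).
rewrite (esumID [set zero]); last by move=> m _; rewrite lee_fin mulr_ge0 ?expR_ge0 ?power_spectrum_ge0.
rewrite !setTI esum_set1; last by rewrite lee_fin mulr_ge0 ?expR_ge0 ?power_spectrum_ge0.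
have -> : ~` [set zero] = [set m | m != zero] by apply/seteqP; split => m /= /eqP.
have -> : w zero = 1.
  by rewrite /w tnorm_sqr big1 ?mulr0 ?oppr0 ?expR0// => i _; rewrite tint_zero expr0n.
rewrite mul1r power_spectrum_zero => E; rewrite EFinB -E [X in (X - _)%E]addeC addeK//.
Qed.

End lattice_zero.

Local Open Scope complex_scope.

Theorem theorem3 (R : realType) (d : nat) (a r : R) (h : d.-tuple R -> R)
    (disp : measure_display) (Omega : measurableType disp)
    (P : probability Omega R)
    (xi : d.-tuple int -> {RV P >-> d.-tuple R})
    (zeta : {RV P >-> d.-tuple R}) :
  (1 <= d)%N -> 0 < a -> 0 < r ->
  h \in Lfun (lebesgue_tuple d) 1%:E -> h \in Lfun (lebesgue_tuple d) 2%:E ->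
  (forall n, has_density (lebesgue_tuple d) (xi n) (gauss_density a)) ->
  uniform_on (lebesgue_tuple d) zeta tcube ->
  mutually_independent
    (fun k : option (d.-tuple int) => if k is Some n then xi n else zeta) ->
  ('V_P[linear_statistic xi zeta h r] =
   (r ^+ d)%:E *
     \int[lebesgue_tuple d]_l
       (Normc.normc (fourier (fun x => (h x)%:C%C) l) ^+ 2 *
        (1 - expR (- (2 * a * pi ^+ 2 * tnorm l ^+ 2 / r ^+ 2))))%:E +
   (r ^+ (2 * d))%:E *
     \esum_(m in [set m : d.-tuple int | m != nseq_tuple d 0%R])
       (expR (- (2 * a * pi ^+ 2 * tnorm (tint m) ^+ 2)) *
        Normc.normc (fourier (fun x => (h x)%:C%C) (tscale r (tint m))) ^+ 2)%:E)%E.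
Proof.
move=> _ a0 r0 h1 h2 xi_density zeta_unif indep.
have hi := (Lfun1_integrable _ _).1 h1; have h2i := Lfun2_integrable_sqr h2.
have ri : 0 < r^-1 by rewrite invr_gt0.
have a2 : 0 < 2 * a by rewrite mulr_gt0.
have rd : r ^+ d != 0 by rewrite expf_neq0// gt_eqF.
(* Absorbing the scale into the function reduces the statistic to the unscaled lattice sum of
   [H]. *)
pose H x := h (tscale r^-1 x).
have Hi : (lebesgue_tuple d).-integrable setT (EFin \o H) by exact: integrable_tscale.
have H2 : (lebesgue_tuple d).-integrable setT (EFin \o (fun x => H x ^+ 2)).
  exact: (integrable_tscale (f := fun x => h x ^+ 2)).
rewrite (variance_lattice a0 xi_density zeta_unif indep Hi H2).
have -> : ((r ^+ (2 * d))%:E * (\esum_(m in [set m : d.-tuple int | m != nseq_tuple d 0%R])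
     (expR (- (2 * a * pi ^+ 2 * tnorm (tint m) ^+ 2)) *
      Normc.normc (fourier (fun x => (h x)%:C%C) (tscale r (tint m))) ^+ 2)%:E) =
    (quad H (theta_tuple (2 * a)) - (\int[lebesgue_tuple d]_x H x) ^+ 2)%:E)%E.
  rewrite -(esum_power_spectrum_nonzero Hi a2) esum_mkcond [in RHS]esum_mkcond -esumZl.
  - apply: eq_esum => m _; case: ifP => _; rewrite ?mule0// -EFinM; congr EFin.
    by rewrite normc_fourier// power_spectrum_scale//; ring.
  - by rewrite exprn_ge0// ltW.
  - by move=> m; case: ifP => // _; rewrite lee_fin mulr_ge0 ?expR_ge0 ?sqr_ge0.
have -> : ((r ^+ d)%:E * (\int[lebesgue_tuple d]_l
       (Normc.normc (fourier (fun x => (h x)%:C%C) l) ^+ 2 *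
        (1 - expR (- (2 * a * pi ^+ 2 * tnorm l ^+ 2 / r ^+ 2))))%:E) =
    (sqnorm H - quad H (gauss_density (2 * a)))%:E)%E.
  rewrite -(integral_power_spectrum_deficit Hi H2 a2).
  under eq_integral do rewrite normc_fourier//.
  set f := fun l : d.-tuple R => (power_spectrum h l * (1 - expR (- (2 * a * pi ^+ 2 * tnorm l ^+ 2 / r ^+ 2))))%:E.
  have e1 (l : d.-tuple R) : expR (- (2 * a * pi ^+ 2 * tnorm l ^+ 2 / r ^+ 2)) <= 1 :> R.
    rewrite -[leRHS]expR0 ler_expR oppr_le0 mulr_ge0 ?invr_ge0 ?sqr_ge0// mulr_ge0 ?sqr_ge0//.
    by rewrite mulr_ge0 ?sqr_ge0// ltW.
  have f0 l : (0 <= f l)%E by rewrite lee_fin mulr_ge0 ?power_spectrum_ge0// subr_ge0.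
  have mf : measurable_fun setT f.
    apply/measurable_EFinP; apply: measurable_funM; first exact: measurable_power_spectrum.
    apply: measurable_funB => //.
    rewrite (_ : (fun l => _) = gaussw (2 * a * pi ^+ 2 / r ^+ 2)); first exact: measurable_gaussw.
    by apply/funext => l; rewrite /gaussw; congr (expR (- _)); ring.
  (* Substituting [r l] for [l] supplies a second factor [r^d], which completes the [r^(2 d)] of
     [power_spectrum_scale] and cancels the [r^2] in the exponent. *)
  have {1}-> : (\int[lebesgue_tuple d]_l f l = (r ^+ d)%:E * \int[lebesgue_tuple d]_l f (tscale r l))%E.
    by rewrite ge0_integral_tscale// muleA -EFinM exprVn divff// mul1e.
  rewrite muleA -EFinM -ge0_integralZl//.
  - apply: eq_integral => l _; rewrite power_spectrum_scale// -EFinM; congr EFin.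
    rewrite mulrA; congr (_ * _ * (1 - expR (- _))); first by rewrite -exprD addnn mul2n.
    rewrite !tnorm_sqr mulr_sumr mulr_suml mulr_sumr; apply: eq_bigr => i _.
    by rewrite tnth_mktuple; field; rewrite gt_eqF.
  - by apply: (measurableT_comp mf); exact: measurable_tscale.
  - by rewrite lee_fin mulr_ge0 ?exprn_ge0 ?ltW.
rewrite -EFinD; congr EFin.
rewrite /sqnorm; ring.
Qed.
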